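(* Let $D$ be a pseudoconvex complete Reinhardt domain in $\mathbb{C}^2$. Assume that the point $p_0:=(1,0)$ lies in the topological boundary of $D$ and that the boundary of $D$ is $\mathcal{C}^\infty$ smooth in a neighborhood of $p_0$. Let $f$ denote the complex geodesic $\mathbb{D}\ni\lambda\mapsto(\lambda,0)\in D$. Then $f$ has a unique left inverse in $D$ (i.e. there is exactly one holomorphic function $F:D\to\mathbb{D}$ with $F\circ f=\operatorname{id}_{\mathbb{D}}$) if and only if the boundary of $D$ is of infinite type at the point $p_0$.
   Context: $\mathbb{D}$ denotes the open unit disc in $\mathbb{C}$. A domain $D\subset\mathbb{C}^2$ is complete Reinhardt if $(\mu_1z_1,\mu_2z_2)\in D$ whenever $(z_1,z_2)\in D$ and $\mu_1,\mu_2\in\overline{\mathbb{D}}$. The boundary is of finite type at $p_0$ if the order of contact of $\partial D$ at $p_0$ with one-dimensional complex analytic curves through $p_0$ is bounded (type in the usual sense of Kohn/D'Angelo); otherwise it is of infinite type. A holomorphic map $f:\mathbb{D}\to D$ is a complex geodesic if there is a holomorphic function $F:D\to\mathbb{D}$ with $F\circ f=\operatorname{id}_{\mathbb{D}}$; any such $F$ is called a left inverse of $f$. *)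

(* Defs.v *)
From HB Require Import structures.
From mathcomp Require Import all_boot all_order all_algebra.
From mathcomp Require Import all_classical all_reals all_analysis.
From mathcomp Require Import complex.
Set Implicit Arguments.
Unset Strict Implicit.
Unset Printing Implicit Defensive.
Import Order.TTheory GRing.Theory Num.Theory numFieldNormedType.Exports.
Local Open Scope classical_set_scope.
Local Open Scope ring_scope.
Local Open Scope complex_scope.

(* R[i]^o carries the topology and the norm of the complex field, so that
   [differentiable] between normed modules over it is complex
   differentiability. *)
Notation Cplx R := (R[i]^o)%type.
Notation Cplx2 R := (R[i]^o * R[i]^o)%type.

Section Topology.
Context {T : topologicalType}.

Definition domain (D : set T) := [/\ open D, connected D & D !=set0].

Definition boundary (D : set T) : set T := closure D `\` interior D.

End Topology.

Section Holomorphy.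
Context {R : realType}.

Definition unit_disc : set (Cplx R) := [set z | `|z| < 1].

Definition holomorphic_on (D : set (Cplx2 R)) (F : Cplx2 R -> Cplx R) :=
  forall z, D z -> differentiable F z.

Definition holomorphic_left_inverse (D : set (Cplx2 R))
    (f : Cplx R -> Cplx2 R) (F : Cplx2 R -> Cplx R) :=
  [/\ holomorphic_on D F,
      forall z, D z -> unit_disc (F z) &
      forall l, unit_disc l -> F (f l) = l].

(* Functions on D are represented by total functions, hence are compared
   only on D. *)
Definition has_unique_left_inverse (D : set (Cplx2 R))
    (f : Cplx R -> Cplx2 R) :=
  exists F, holomorphic_left_inverse D f F /\
    forall G, holomorphic_left_inverse D f G -> forall z, D z -> G z = F z.

End Holomorphy.

Section ReinhardtPseudoconvex.
Context {R : realType}.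

Definition complete_reinhardt (D : set (Cplx2 R)) :=
  forall (mu1 mu2 : Cplx R) (z : Cplx2 R), D z ->
    `|mu1| <= 1 -> `|mu2| <= 1 -> D (mu1 * z.1, mu2 * z.2).

Definition unit_circle (t : R) : Cplx R := cos t +i* sin t.

(* Sub-mean value inequality on the boundary of every closed affine analytic
   disc contained in D. *)
Definition continuous_plurisubharmonic (D : set (Cplx2 R))
    (u : Cplx2 R -> R) :=
  (forall z, D z -> {for z, continuous u}) /\
  forall a b : Cplx2 R,
    (forall zeta : Cplx R, `|zeta| <= 1 -> D (a + zeta *: b)) ->
    u a <= (2 * pi)^-1 *
      \int[lebesgue_measure]_(t in `[0, 2 * pi]) u (a + unit_circle t *: b).

(* Existence of a continuous plurisubharmonic exhaustion function. *)
Definition pseudoconvex (D : set (Cplx2 R)) :=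
  exists u : Cplx2 R -> R, continuous_plurisubharmonic D u /\
    forall c : R, compact [set z | D z /\ u z <= c].

End ReinhardtPseudoconvex.

Section Smoothness.
Context {R : realType}.

Fixpoint Ck_on {V : normedModType R} (k : nat) (U : set V) (g : V -> R) :
    Prop :=
  (forall x, U x -> {for x, continuous g}) /\
  if k is k'.+1 then
    forall v : V, (forall x, U x -> derivable g x v) /\ Ck_on k' U ('D_v g)
  else True.

Definition smooth_on {V : normedModType R} (U : set V) (g : V -> R) :=
  forall k, Ck_on k U g.

(* Real coordinates on C^2. *)
Definition of_real4 (x : (R * R) * (R * R)) : Cplx2 R :=
  (x.1.1 +i* x.1.2, x.2.1 +i* x.2.2).

(* r is a C^infinity defining function of D near p; the gradient condition
   says that some real directional derivative of r is nonzero. *)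
Definition local_defining_function (D : set (Cplx2 R)) (p : Cplx2 R)
    (r : Cplx2 R -> R) :=
  exists U : set (Cplx2 R),
    [/\ open U, U p, smooth_on (of_real4 @^-1` U) (r \o of_real4),
        forall z, U z -> (D z <-> r z < 0) &
        forall x, U (of_real4 x) -> r (of_real4 x) = 0 ->
          exists v, 'D_v (r \o of_real4) x != 0].

Definition smooth_boundary_near (D : set (Cplx2 R)) (p : Cplx2 R) :=
  exists r, local_defining_function D p r.

End Smoothness.

Section FiniteType.
Context {R : realType}.

Definition vanishes_to_order {V : normedModType (Cplx R)}
    (g : Cplx R -> V) (m : nat) :=
  exists M : R, \forall z \near (0 : Cplx R), `|g z| <= M%:C * `|z| ^+ m.

Definition vanishing_order {V : normedModType (Cplx R)}
    (g : Cplx R -> V) (m : nat) :=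
  vanishes_to_order g m /\ ~ vanishes_to_order g m.+1.

(* Parametrized germ of a one-dimensional analytic curve through p. *)
Definition analytic_curve_at (p : Cplx2 R) (gamma : Cplx R -> Cplx2 R) :=
  [/\ \forall z \near (0 : Cplx R), differentiable gamma z,
      gamma 0 = p &
      ~ \forall z \near (0 : Cplx R), gamma z = p].

(* D'Angelo finite type: the orders of contact v(r o gamma) / v(gamma - p)
   are bounded by some c, where r is a local defining function (the orders of
   contact do not depend on its choice) and v is the order of vanishing at 0.
   The inequality is written without division, and for every m <= v(r o gamma)
   because v(r o gamma) may be infinite. *)
Definition finite_type (D : set (Cplx2 R)) (p : Cplx2 R) :=
  exists r, local_defining_function D p r /\
  exists c : nat, forall gamma, analytic_curve_at p gamma ->
    forall nu m : nat,
      vanishing_order (fun z => gamma z - p) nu ->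
      vanishes_to_order (fun z => (r (gamma z))%:C : Cplx R) m ->
      (m <= c * nu)%N.

Definition infinite_type (D : set (Cplx2 R)) (p : Cplx2 R) :=
  ~ finite_type D p.

End FiniteType.

(* Main.v *)
(** Over the z1-axis D is the unit disc, D lies in |z1| < 1, and z1 is always a
    left inverse. Let r be a defining function near p = (1, 0). The derivative
    of r in the real direction of z1 is positive at p, so r (1, s) is comparable
    to the height of the boundary below |z1| = 1 over |z2| = s. By Taylor, as a
    function of s it is either flat at 0 or bounded below by c s^N.

    Flat case. The line (1, z) has infinite contact with the boundary. Moreover
    D contains |z1| < 1 - C |z2|^m near p for every m. If F is a left inverse,
    Schwarz-Pick in z2 over the circles |z1| = rho, with rho close to 1, and the
    maximum principle in z1 give F (z1, s) - z1 = O(|s|^m) for every m, hence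
    F = z1.

    Non-flat case. D lies in |z1| < 1 - c |z2|^N near p. Borel-Caratheodory
    bounds the contact of curves, so the type is finite. By pseudoconvexity
    z2 z1^M is bounded on D for some M, so z1 + e (z2 z1^M)^N is another left
    inverse for small e > 0: this is a continuity principle for the annuli
    z2 = c z1^-M, proved by maximizing u + e |z1|^2 - K |z2 z1^M - H0|^2 for a
    plurisubharmonic exhaustion u.

    Holomorphy is pointwise differentiability, so the one-variable theory starts
    from Goursat's theorem, for squares. *)

Require Import Defs.
From mathcomp Require Import all_boot all_order all_algebra.
From mathcomp Require Import all_classical all_reals all_analysis.
From mathcomp Require Import complex.
From mathcomp Require Import ring lra.
Set Implicit Arguments.
Unset Strict Implicit.
Unset Printing Implicit Defensive.
Import Normc Order.TTheory GRing.Theory Num.Theory numFieldNormedType.Exports.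
Local Open Scope classical_set_scope.
Local Open Scope ring_scope.
Local Open Scope complex_scope.
Local Notation Re := complex.Re.
Local Notation Im := complex.Im.

(** * Complex moduli, limits and derivatives *)

Section ComplexBasics.
Context {R : realType}.
Implicit Types (z w : R[i]).

(** In the coordinates (log |z1|, log |z2|) the curves |z2| |z1|^M = c are lines of slope -M, and
    the bound on z2 z1^M says that the logarithmic image of D lies below such a line. This is the
    only instance of logarithmic convexity that is proved; the slope is an integer so that z2 z1^M
    is holomorphic and can serve in the penalty. The one-variable theory uses neither power series
    nor removable singularities. The maximum principle is therefore proved for functions that are
    merely continuous at the origin, so that it applies to f(z)/z and to f(z)/z^k: the first
    quotient gives the Schwarz lemma, the second replaces the identity theorem. Crude constants in
    the contour integrals do no harm, because passing to powers removes them. The Reinhardt symmetry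
    belongs to D and not to the defining function, which is arbitrary. An estimate of r on real s
    reaches complex z2 only through membership in D. Since [finite_type] quantifies r existentially,
    each direction runs the dichotomy for its own r. *)

Lemma normc_norm (z : Cplx R) : `|z| = (normc z)%:C.
Proof. by []. Qed.

Lemma normc_ge0 z : 0 <= normc z.
Proof. by case: z => a b; rewrite sqrtr_ge0. Qed.

Lemma normc_eq0 z : (normc z == 0) = (z == 0).
Proof. by apply/eqP/eqP => [/eq0_normc|->] //; rewrite normc0. Qed.

Lemma normc_gt0 z : (0 < normc z) = (z != 0).
Proof. by rewrite lt0r normc_eq0 normc_ge0 andbT. Qed.

Lemma normcD z w : normc (z + w) <= normc z + normc w.
Proof. exact: le_normcD. Qed.

Lemma normc_opp z : normc (- z) = normc z.
Proof. exact: normcN. Qed.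

Lemma normcB z w : normc (z - w) <= normc z + normc w.
Proof. by rewrite -(normc_opp w) normcD. Qed.

Lemma normc_distC z w : normc (z - w) = normc (w - z).
Proof. by rewrite -normc_opp opprB. Qed.

Lemma normc_subl z w : normc z - normc w <= normc (z - w).
Proof. by rewrite lerBlDr -{1}(subrK w z) normcD. Qed.

Lemma normcX z n : normc (z ^+ n) = normc z ^+ n.
Proof. by elim: n => [|n IH]; rewrite ?expr0 ?normc1// !exprS normcM IH. Qed.

Lemma normc_real (x : R) : normc x%:C = `|x|.
Proof. by rewrite /= expr0n/= addr0 sqrtr_sqr. Qed.

Lemma normc_sqr z : normc z ^+ 2 = Re z ^+ 2 + Im z ^+ 2.
Proof. by case: z => a b; rewrite /= sqr_sqrtr// addr_ge0 ?sqr_ge0. Qed.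

Lemma normc_Re z : `|Re z| <= normc z.
Proof.
rewrite -(ler_pXn2r (n := 2))// ?nnegrE ?normr_ge0 ?normc_ge0//.
by rewrite normc_sqr real_normK ?num_real// lerDl sqr_ge0.
Qed.

Lemma normc_Im z : `|Im z| <= normc z.
Proof.
rewrite -(ler_pXn2r (n := 2))// ?nnegrE ?normr_ge0 ?normc_ge0//.
by rewrite normc_sqr real_normK ?num_real// lerDr sqr_ge0.
Qed.

Lemma normc_le_ReIm z : normc z <= `|Re z| + `|Im z|.
Proof.
rewrite -(ler_pXn2r (n := 2))// ?nnegrE ?addr_ge0 ?normr_ge0 ?normc_ge0//.
rewrite normc_sqr sqrrD !real_normK ?num_real// lerD2r lerDl.
by rewrite mulrn_wge0// mulr_ge0.
Qed.

Lemma Re_le_normc z : Re z <= normc z.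
Proof. by rewrite (le_trans _ (normc_Re z))// ler_norm. Qed.

Lemma normc_conj z : normc (conjc z) = normc z.
Proof. by case: z => a b; rewrite /= sqrrN. Qed.

Lemma lt0_cplx (e : R[i]) : 0 < e -> exists2 x : R, 0 < x & e = x%:C.
Proof.
case: e => a b; rewrite ltcE /= => /andP[/eqP -> a0]; exists a => //.
Qed.

(** The norm of [Cplx R] has values in [R[i]], so radii there are complex numbers; a positive one is
    real by [lt0_cplx], and all later estimates use [normc] with real radii. *)
Lemma nbhs_cplxP (z : Cplx R) (P : set (Cplx R)) :
  nbhs z P <->
  exists2 d : R, 0 < d & forall w : Cplx R, normc (w - z) < d -> P w.
Proof.
split=> [/nbhs_normP [e /= e0 he]|[d d0 hd]].
- have [x x0 ex] := lt0_cplx e0; exists x => // w wz; apply: he.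
  by rewrite /ball_ /= normc_norm normc_distC ex ltcR.
- apply/nbhs_ballP; exists d%:C => /=; first by rewrite ltcR.
  by move=> w; rewrite -ball_normE /= normc_norm normc_distC ltcR; exact: hd.
Qed.

Lemma continuous_cplxP (f : Cplx R -> Cplx R) (z : Cplx R) :
  {for z, continuous f} <->
  forall e : R, 0 < e -> exists2 d : R, 0 < d &
    forall w : Cplx R, normc (w - z) < d -> normc (f w - f z) < e.
Proof.
split=> [fc e e0|h].
- have : nbhs (f z) [set w : Cplx R | normc (w - f z) < e].
    by apply/nbhs_cplxP; exists e.
  by move=> /fc /nbhs_cplxP.
- move=> A /nbhs_cplxP [e e0 hA]; have [d d0 hd] := h _ e0.
  by apply/nbhs_cplxP; exists d => // w /hd; exact: hA.
Qed.

Lemma continuous_cplx_realP (f : R -> Cplx R) (x : R) :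
  {for x, continuous f} <->
  forall e : R, 0 < e -> exists2 d : R, 0 < d &
    forall y : R, `|y - x| < d -> normc (f y - f x) < e.
Proof.
split=> [fc e e0|h].
- have : nbhs (f x) [set w : Cplx R | normc (w - f x) < e].
    by apply/nbhs_cplxP; exists e.
  move=> /fc h.
  have /nbhs_ballP [d /= d0 hd] :
    nbhs x (f @^-1` [set w : Cplx R | normc (w - f x) < e]) by exact: h.
  by exists d => // y yx; apply: hd; rewrite /ball/= distrC.
- move=> A /nbhs_cplxP [e e0 hA]; have [d d0 hd] := h _ e0.
  apply/nbhs_ballP; exists d => //= y; rewrite /ball/= distrC => /hd.
  exact: hA.
Qed.

(** The form without quotient also makes sense at [w = z], where the difference quotient says
    nothing. *)
Lemma differentiable_cplxP (f : Cplx R -> Cplx R) (z : Cplx R) :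
  differentiable f z ->
  exists d : Cplx R, forall e : R, 0 < e -> exists2 r : R, 0 < r &
    forall w : Cplx R, normc (w - z) < r ->
      normc (f w - f z - d * (w - z)) <= e * normc (w - z).
Proof.
move=> /derivable1_diffP df; exists ('D_1 f z) => e e0.
have /cvg_ballP/(_ e%:C) := df.
rewrite -/('D_1 f z) ltcR e0 => /(_ isT).
move=> nf.
have /nbhs_cplxP [r r0 hr] : nbhs (0 : Cplx R) (fun x : Cplx R => x != 0 ->
    ball ('D_1 f z) e%:C (x^-1 *: ((f \o shift z) x%:A - f z))) by exact: nf.
exists r => // w wr.
have [->|wz] := eqVneq w z; first by rewrite !subrr mulr0 subr0 normc0 mulr0.
have wz0 : w - z != 0 by rewrite subr_eq0.
have := hr (w - z); rewrite subr0 => /(_ wr wz0).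
rewrite -ball_normE /= normc_norm ltcR => /ltW h.
have -> : f w - f z - 'D_1 f z * (w - z)
  = - (('D_1 f z - (w - z)^-1 *: (f ((w - z) *: 1 + z) - f z)) * (w - z)).
  rewrite [_ *: 1]mulr1 subrK mulrBl -[_ *: _]/(_ * _) mulrAC mulVf// mul1r.
  by rewrite opprB.
by rewrite normc_opp normcM ler_wpM2r// normc_ge0.
Qed.

End ComplexBasics.

(** * Integrals of complex-valued functions *)

Section ComplexIntegral.
Context {R : realType}.
Notation mu := (@lebesgue_measure R).
Implicit Types (f g : R -> Cplx R) (a b c : R).

Definition cint f a b : R[i] :=
  (\int[mu]_(x in `[a, b]) Re (f x)) +i* (\int[mu]_(x in `[a, b]) Im (f x)).

Definition cont_on f a b := forall x, a <= x <= b -> {for x, continuous f}.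

Lemma continuous_real_epsP (h : R -> R) (x : R) :
  (forall e : R, 0 < e -> exists2 d : R, 0 < d &
    forall y : R, `|y - x| < d -> `|h y - h x| < e) -> {for x, continuous h}.
Proof.
move=> H; apply/cvg_ballP => e e0; have [d d0 hd] := H _ e0.
apply/nbhs_ballP; exists d => //= y; rewrite /ball/= distrC => /hd.
by rewrite /ball/= distrC.
Qed.

Lemma integrable_cont (h : R -> R) a b :
  (forall x, a <= x <= b -> {for x, continuous h}) ->
  mu.-integrable `[a, b] (EFin \o h).
Proof.
move=> hc; apply: continuous_compact_integrable; first exact: segment_compact.
apply: continuous_in_subspaceT => x; rewrite inE/= in_itv/= => /hc.
exact.
Qed.

Lemma cont_on_Re f a b : cont_on f a b ->
  forall x, a <= x <= b -> {for x, continuous (fun y => Re (f y))}.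
Proof.
move=> fc x /fc /continuous_cplx_realP H; apply: continuous_real_epsP =>
  e /H [d d0 hd].
exists d => // y /hd; apply: le_lt_trans.
by have := normc_Re (f y - f x); case: (f y) (f x) => ? ? [? ?].
Qed.

Lemma cont_on_Im f a b : cont_on f a b ->
  forall x, a <= x <= b -> {for x, continuous (fun y => Im (f y))}.
Proof.
move=> fc x /fc /continuous_cplx_realP H; apply: continuous_real_epsP =>
  e /H [d d0 hd].
exists d => // y /hd; apply: le_lt_trans.
by have := normc_Im (f y - f x); case: (f y) (f x) => ? ? [? ?].
Qed.

Lemma Rint_split (h : R -> R) a b c : a <= b -> b <= c ->
  (forall x, a <= x <= c -> {for x, continuous h}) ->
  \int[mu]_(x in `[a, c]) h x =
  \int[mu]_(x in `[a, b]) h x + \int[mu]_(x in `[b, c]) h x.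
Proof.
move=> ab bc hc; have ih := integrable_cont hc.
have := @Rintegral_itvB R h (BLeft a) (BRight c) b ih.
rewrite !bnd_simp => /(_ ab bc).
rewrite Rintegral_itv_obnd_cbnd; first by move=> <-; rewrite addrC subrK.
apply: integrableS ih => //; apply: subset_itv; rewrite ?bnd_simp//.
Qed.

Lemma cint_split f a b c : a <= b -> b <= c -> cont_on f a c ->
  cint f a c = cint f a b + cint f b c.
Proof.
move=> ab bc fc; rewrite /cint.
rewrite (Rint_split ab bc (cont_on_Re fc)) (Rint_split ab bc (cont_on_Im fc)).
by simpc.
Qed.

Lemma cintB f g a b : cont_on f a b -> cont_on g a b ->
  cint (fun x => f x - g x) a b = cint f a b - cint g a b.
Proof.
move=> fc gc; rewrite /cint.
have -> : \int[mu]_(x in `[a, b]) Re (f x - g x) =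
   \int[mu]_(x in `[a, b]) (Re (f x) - Re (g x)).
  by apply: eq_Rintegral => x _; case: (f x) (g x) => ? ? [].
have -> : \int[mu]_(x in `[a, b]) Im (f x - g x) =
   \int[mu]_(x in `[a, b]) (Im (f x) - Im (g x)).
  by apply: eq_Rintegral => x _; case: (f x) (g x) => ? ? [].
rewrite !RintegralB//; try exact: integrable_cont (cont_on_Re _);
  try exact: integrable_cont (cont_on_Im _).
Qed.

Lemma Rint_cst a b (r : R) : a <= b -> \int[mu]_(x in `[a, b]) r = r * (b - a).
Proof.
move=> ab; rewrite Rintegral_cst//; congr (_ * _).
transitivity (fine (mu `[a, b]%classic)); first by [].
rewrite (lebesgue_measure_itv `[a, b])/= lte_fin; case: ltP => //= ba.
by rewrite (@le_anti _ _ a b) ?subrr// ab ba.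
Qed.

Lemma cint_cst (k : Cplx R) a b : a <= b -> cint (fun=> k) a b = (b - a)%:C * k.
Proof.
move=> ab; rewrite /cint !Rint_cst//; case: k => p q.
by apply/eqP; rewrite eq_complex /=; apply/andP; split; apply/eqP; ring.
Qed.

Lemma Rint_ge (h : R -> R) a b (m : R) : a <= b ->
  (forall x, a <= x <= b -> {for x, continuous h}) ->
  (forall x, a <= x <= b -> m <= h x) ->
  m * (b - a) <= \int[mu]_(x in `[a, b]) h x.
Proof.
move=> ab hc hm; rewrite -Rint_cst//; apply: le_Rintegral => //.
- by apply: integrable_cont => x _; exact: cst_continuous.
- exact: integrable_cont.
Qed.

Lemma Rint_le (h : R -> R) a b (M : R) : a <= b ->
  (forall x, a <= x <= b -> {for x, continuous h}) ->
  (forall x, a <= x <= b -> h x <= M) ->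
  \int[mu]_(x in `[a, b]) h x <= M * (b - a).
Proof.
move=> ab hc hM; rewrite -!Rint_cst//; apply: le_Rintegral => //.
- exact: integrable_cont.
- by apply: integrable_cont => x _; exact: cst_continuous.
Qed.

(** The factor 2 is the cost of bounding real and imaginary parts separately. It only affects the
    constant of the weak maximum principle, which [max_at_center] removes. *)
Lemma cint_bound f a b (M : R) : a <= b -> cont_on f a b ->
  (forall x, a <= x <= b -> normc (f x) <= M) ->
  normc (cint f a b) <= 2 * M * (b - a).
Proof.
move=> ab fc fM; apply: (le_trans (normc_le_ReIm _)).
have -> : 2 * M * (b - a) = M * (b - a) + M * (b - a) by ring.
have hRe x : a <= x <= b -> - M <= Re (f x) <= M.
  by move=> /fM; move: (normc_Re (f x)); rewrite -ler_norml; exact: le_trans.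
have hIm x : a <= x <= b -> - M <= Im (f x) <= M.
  by move=> /fM; move: (normc_Im (f x)); rewrite -ler_norml; exact: le_trans.
by rewrite lerD//= ler_norml -mulNr; apply/andP; split;
  [apply: Rint_ge (cont_on_Re fc) _|apply: Rint_le (cont_on_Re fc) _|
   apply: Rint_ge (cont_on_Im fc) _|apply: Rint_le (cont_on_Im fc) _] => // x;
  [move=> /hRe/andP[]|move=> /hRe/andP[]|move=> /hIm/andP[]|move=> /hIm/andP[]].
Qed.

End ComplexIntegral.

(** * Goursat's theorem on squares *)

Section Goursat.
Context {R : realType}.
Implicit Types (f g : Cplx R -> Cplx R) (x y l : R).

(* The integral of [f z dz] along the positively oriented boundary of the
   rectangle [x1, x2] x [y1, y2]. *)
Definition rint f x1 x2 y1 y2 : R[i] :=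
  cint (fun t => f (t +i* y1)) x1 x2 - cint (fun t => f (t +i* y2)) x1 x2
  + 'i%C * (cint (fun t => f (x2 +i* t)) y1 y2
            - cint (fun t => f (x1 +i* t)) y1 y2).

Lemma normc_horiz (s t y : R) : normc ((s +i* y) - (t +i* y)) = `|s - t|.
Proof. by rewrite -normc_real; congr normc; simpc. Qed.

Lemma normc_vert (s t x : R) : normc ((x +i* s) - (x +i* t)) = `|s - t|.
Proof.
have -> : (x +i* s) - (x +i* t) = 'i%C * (s - t)%:C.
  by rewrite /= mulrC; simpc.
by rewrite normcM normc_real /= expr0n /= add0r expr1n sqrtr1 mul1r.
Qed.

Lemma cont_horiz f x y : {for (x +i* y : Cplx R), continuous f} ->
  {for x, continuous (fun t : R => f (t +i* y))}.
Proof.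
move=> /continuous_cplxP H; apply/continuous_cplx_realP => e /H [d d0 hd].
by exists d => // t ht; apply: hd; rewrite normc_horiz.
Qed.

Lemma cont_vert f x y : {for (x +i* y : Cplx R), continuous f} ->
  {for y, continuous (fun t : R => f (x +i* t))}.
Proof.
move=> /continuous_cplxP H; apply/continuous_cplx_realP => e /H [d d0 hd].
by exists d => // t ht; apply: hd; rewrite normc_vert.
Qed.

Definition cont_at f x y := {for (x +i* y : Cplx R), continuous f}.

Lemma rint_splitx f x1 x2 x3 y1 y2 : x1 <= x2 -> x2 <= x3 ->
  (forall x, x1 <= x <= x3 -> cont_at f x y1 /\ cont_at f x y2) ->
  rint f x1 x3 y1 y2 = rint f x1 x2 y1 y2 + rint f x2 x3 y1 y2.
Proof.
move=> h12 h23 fc; rewrite /rint.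
rewrite (@cint_split R (fun t => f (t +i* y1)) x1 x2 x3)//; last first.
  by move=> x /fc [h _]; exact: (cont_horiz h).
rewrite (@cint_split R (fun t => f (t +i* y2)) x1 x2 x3)//; last first.
  by move=> x /fc [_ h]; exact: (cont_horiz h).
ring.
Qed.

Lemma rint_splity f x1 x2 y1 y2 y3 : y1 <= y2 -> y2 <= y3 ->
  (forall y, y1 <= y <= y3 -> cont_at f x1 y /\ cont_at f x2 y) ->
  rint f x1 x2 y1 y3 = rint f x1 x2 y1 y2 + rint f x1 x2 y2 y3.
Proof.
move=> h12 h23 fc; rewrite /rint.
rewrite (@cint_split R (fun t => f (x1 +i* t)) y1 y2 y3)//; last first.
  by move=> y /fc [h _]; exact: (cont_vert h).
rewrite (@cint_split R (fun t => f (x2 +i* t)) y1 y2 y3)//; last first.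
  by move=> y /fc [_ h]; exact: (cont_vert h).
ring.
Qed.

Definition sqint f x y l := rint f x (x + l) y (y + l).

Definition in_square x y l (s t : R) := (x <= s <= x + l) && (y <= t <= y + l).

Lemma rint_splitx3 f x y1 y2 l : 0 <= l ->
  (forall s, x <= s <= x + 3 * l -> cont_at f s y1 /\ cont_at f s y2) ->
  rint f x (x + 3 * l) y1 y2 = rint f x (x + l) y1 y2 +
    rint f (x + l) (x + l + l) y1 y2 + rint f (x + l + l) (x + l + l + l) y1 y2.
Proof.
move=> l0 fc.
rewrite (@rint_splitx f x (x + l) (x + 3 * l)); [|lra|lra|exact: fc].
rewrite (@rint_splitx f (x + l) (x + l + l) (x + 3 * l));
  [|lra|lra|by move=> s hs; apply: fc; lra].
have -> : x + 3 * l = x + l + l + l by ring.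
by rewrite addrA.
Qed.

Lemma rint_splity3 f x1 x2 y l : 0 <= l ->
  (forall s, y <= s <= y + 3 * l -> cont_at f x1 s /\ cont_at f x2 s) ->
  rint f x1 x2 y (y + 3 * l) = rint f x1 x2 y (y + l) +
    rint f x1 x2 (y + l) (y + l + l) + rint f x1 x2 (y + l + l) (y + l + l + l).
Proof.
move=> l0 fc.
rewrite (@rint_splity f _ _ y (y + l) (y + 3 * l)); [|lra|lra|exact: fc].
rewrite (@rint_splity f _ _ (y + l) (y + l + l) (y + 3 * l));
  [|lra|lra|by move=> s hs; apply: fc; lra].
have -> : y + 3 * l = y + l + l + l by ring.
by rewrite addrA.
Qed.

(** Nine pieces rather than four, so that one of them is concentric with the whole. Nothing is
    assumed in its interior, hence the formula still applies to f(z)/z on a square centred at the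
    singular point. *)
Lemma sqint_split f x y l : 0 <= l ->
  (forall s t, in_square x y (3 * l) s t ->
     ~~ ((x + l < s < x + l + l) && (y + l < t < y + l + l)) ->
       cont_at f s t) ->
  sqint f x y (3 * l) =
    (sqint f x y l + sqint f x (y + l) l + sqint f x (y + l + l) l) +
    (sqint f (x + l) y l + sqint f (x + l) (y + l) l
     + sqint f (x + l) (y + l + l) l) +
    (sqint f (x + l + l) y l + sqint f (x + l + l) (y + l) l
     + sqint f (x + l + l) (y + l + l) l).
Proof.
move=> l0 fc; rewrite /sqint rint_splitx3// ?rint_splity3//.
- move=> s hs; split; apply: fc; rewrite /in_square; lra.
- move=> s hs; split; apply: fc; rewrite /in_square; lra.
- move=> s hs; split; apply: fc; rewrite /in_square; lra.
- move=> s hs; split; apply: fc; rewrite /in_square; lra.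
Qed.

Lemma rintB f g x1 x2 y1 y2 :
  (forall x, x1 <= x <= x2 -> (cont_at f x y1 /\ cont_at f x y2) /\
     (cont_at g x y1 /\ cont_at g x y2)) ->
  (forall y, y1 <= y <= y2 -> (cont_at f x1 y /\ cont_at f x2 y) /\
     (cont_at g x1 y /\ cont_at g x2 y)) ->
  rint (fun z => f z - g z) x1 x2 y1 y2 = rint f x1 x2 y1 y2 - rint g x1 x2 y1
    y2.
Proof.
move=> hx hy; rewrite /rint.
rewrite (@cintB R (fun t => f (t +i* y1)) (fun t => g (t +i* y1)));
  last 2 first.
- by move=> x /hx [[h _] _]; exact: (cont_horiz h).
- by move=> x /hx [_ [h _]]; exact: (cont_horiz h).
rewrite (@cintB R (fun t => f (t +i* y2)) (fun t => g (t +i* y2)));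
  last 2 first.
- by move=> x /hx [[_ h] _]; exact: (cont_horiz h).
- by move=> x /hx [_ [_ h]]; exact: (cont_horiz h).
rewrite (@cintB R (fun t => f (x1 +i* t)) (fun t => g (x1 +i* t)));
  last 2 first.
- by move=> y /hy [[h _] _]; exact: (cont_vert h).
- by move=> y /hy [_ [h _]]; exact: (cont_vert h).
rewrite (@cintB R (fun t => f (x2 +i* t)) (fun t => g (x2 +i* t)));
  last 2 first.
- by move=> y /hy [[_ h] _]; exact: (cont_vert h).
- by move=> y /hy [_ [_ h]]; exact: (cont_vert h).
ring.
Qed.

Definition on_side x y l (s t : R) := in_square x y l s t &&
  [|| s == x, s == x + l, t == y | t == y + l].

Lemma sqint_bound f x y l (M : R) : 0 <= l ->
  (forall s t, on_side x y l s t -> cont_at f s t) ->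
  (forall s t, on_side x y l s t -> normc (f (s +i* t)) <= M) ->
  normc (sqint f x y l) <= 8 * M * l.
Proof.
move=> l0 fc fM.
have sd1 s : x <= s <= x + l -> on_side x y l s y.
  by move=> hs; rewrite /on_side /in_square eqxx !orbT andbT; lra.
have sd2 s : x <= s <= x + l -> on_side x y l s (y + l).
  by move=> hs; rewrite /on_side /in_square eqxx !orbT andbT; lra.
have sd3 s : y <= s <= y + l -> on_side x y l x s.
  by move=> hs; rewrite /on_side /in_square eqxx ?orbT andbT; lra.
have sd4 s : y <= s <= y + l -> on_side x y l (x + l) s.
  by move=> hs; rewrite /on_side /in_square eqxx ?orbT andbT; lra.
have xl : x <= x + l by lra.
have yl : y <= y + l by lra.
have bx (g : R -> Cplx R) : cont_on g x (x + l) ->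
   (forall s, x <= s <= x + l -> normc (g s) <= M) ->
   normc (cint g x (x + l)) <= 2 * M * l.
  by move=> gc gM; have := cint_bound xl gc gM; rewrite (addrC x) addrK.
have bv (g : R -> Cplx R) : cont_on g y (y + l) ->
   (forall s, y <= s <= y + l -> normc (g s) <= M) ->
   normc (cint g y (y + l)) <= 2 * M * l.
  by move=> gc gM; have := cint_bound yl gc gM; rewrite (addrC y) addrK.
have normci : normc ('i%C : R[i]) = 1.
  by rewrite /= expr0n /= add0r expr1n sqrtr1.
rewrite /sqint /rint; apply: (le_trans (normcD _ _)).
rewrite normcM normci mul1r.
have -> : 8 * M * l = (2 * M * l + 2 * M * l) + (2 * M * l + 2 * M * l) by ring.
rewrite lerD// (le_trans (normcB _ _))// lerD//.
- by apply: bx => s /sd1 hs; [exact: (cont_horiz (fc _ _ hs))|exact: fM].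
- by apply: bx => s /sd2 hs; [exact: (cont_horiz (fc _ _ hs))|exact: fM].
- by apply: bv => s /sd4 hs; [exact: (cont_vert (fc _ _ hs))|exact: fM].
- by apply: bv => s /sd3 hs; [exact: (cont_vert (fc _ _ hs))|exact: fM].
Qed.

Lemma cont_affine (A d c : Cplx R) (z : Cplx R) :
  {for z, continuous (fun w : Cplx R => A + d * (w - c))}.
Proof.
apply/continuous_cplxP => e e0.
have d1 : 0 < normc d + 1 by rewrite ltr_wpDl ?normc_ge0.
exists (e / (normc d + 1)); first by rewrite divr_gt0.
move=> w wz.
have -> : A + d * (w - c) - (A + d * (z - c)) = d * (w - z) by ring.
rewrite normcM; move: wz; rewrite ltr_pdivlMr//; apply: le_lt_trans.
by rewrite mulrC ler_wpM2l ?normc_ge0// lerDl.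
Qed.

(** On opposite sides the integrands differ by a constant, [d * l] up to a power of i, and the two
    contributions cancel; no primitive is involved. *)
Lemma sqint_affine (A d c : Cplx R) x y l : 0 <= l ->
  sqint (fun w => A + d * (w - c)) x y l = 0.
Proof.
move=> l0; rewrite /sqint /rint.
have ca z : {for z, continuous (fun w : Cplx R => A + d * (w - c))}.
  exact: cont_affine.
rewrite -cintB; last 2 first.
- by move=> s _; exact: (cont_horiz (ca (s +i* y))).
- by move=> s _; exact: (cont_horiz (ca (s +i* (y + l)))).
rewrite -cintB; last 2 first.
- by move=> s _; exact: (cont_vert (ca ((x + l) +i* s))). 
- by move=> s _; exact: (cont_vert (ca (x +i* s))).
have -> : (fun t : R => A + d * ((t +i* y : Cplx R) - c)
     - (A + d * ((t +i* (y + l) : Cplx R) - c)))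
   = (fun=> - (d * ('i%C * l%:C))).
  apply/funext => t.
  have -> : (t +i* (y + l) : Cplx R) = (t +i* y : Cplx R) + 'i%C * l%:C.
    by apply/eqP; rewrite eq_complex /=; apply/andP; split; apply/eqP; ring.
  ring.
have -> : (fun t : R => A + d * (((x + l) +i* t : Cplx R) - c)
     - (A + d * ((x +i* t : Cplx R) - c)))
   = (fun=> d * l%:C).
  apply/funext => t.
  have -> : ((x + l) +i* t : Cplx R) = (x +i* t : Cplx R) + l%:C.
    by apply/eqP; rewrite eq_complex /=; apply/andP; split; apply/eqP; ring.
  ring.
rewrite !cint_cst ?lerDl//.
rewrite (addrC x) (addrC y) !addrK; ring.
Qed.
End Goursat.

Section GoursatThm.
Context {R : realType}.
Implicit Types (f g : Cplx R -> Cplx R) (x y l : R).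

Definition subsquare (p q : R * R * R) :=
  [/\ p.1.1 <= q.1.1, q.1.1 + q.2 <= p.1.1 + p.2, p.1.2 <= q.1.2,
      q.1.2 + q.2 <= p.1.2 + p.2 & q.2 = p.2 / 3].

Lemma normc_sum9 (a b c d e f g h i : R[i]) (m : R) :
  normc a < m -> normc b < m -> normc c < m -> normc d < m ->
  normc e < m -> normc f < m -> normc g < m -> normc h < m ->
  normc i < m ->
  normc (a + b + c + (d + e + f) + (g + h + i)) < 9 * m.
Proof.
have n3 (u v w : R[i]) (k : R) : normc u < k -> normc v < k ->
    normc w < k -> normc (u + v + w) < 3 * k.
  move=> hu hv hw; have := normcD (u + v) w; have := normcD u v; lra.
move=> *; have -> : 9 * m = 3 * (3 * m) by ring.
by apply: (n3); apply: (n3).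
Qed.

(** Pigeonhole: nine integrals all below a ninth of the modulus of the total could not add up to
    it. *)
Lemma subsquare_exists f (p : R * R * R) : 0 < p.2 ->
  (forall s t, in_square p.1.1 p.1.2 p.2 s t -> cont_at f s t) ->
  exists2 q, subsquare p q &
    normc (sqint f p.1.1 p.1.2 p.2) <= 9 * normc (sqint f q.1.1 q.1.2 q.2).
Proof.
case: p => [[x y] l] /= l0 fc; apply: contrapT => /forall2NP H.
have l30 : 0 <= l / 3 by lra.
have l3 : l = 3 * (l / 3) by field.
set N := normc (sqint f x y l) in H.
have {}H u v : x <= u -> u + l / 3 <= x + l -> y <= v -> v + l / 3 <= y + l ->
    normc (sqint f u v (l / 3)) < N / 9.
  move=> hu1 hu2 hv1 hv2; have [[]//|/negP] := H (u, v, l / 3).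
  by rewrite -ltNge ltr_pdivlMr// mulrC.
have : N < 9 * (N / 9).
  rewrite {1}/N [X in sqint _ _ _ X]l3 sqint_split//.
    by apply: normc_sum9; apply: H; lra.
  by move=> s t st _; apply: fc; rewrite l3.
by rewrite mulrC divfK ?ltxx.
Qed.
End GoursatThm.

Section GoursatThm.
Context {R : realType}.
Implicit Types (f g : Cplx R -> Cplx R) (x y l : R).

(** Bernoulli's inequality for [q^-1] and the Archimedean property. *)
Lemma exists_small_pow (q a r : R) : 0 <= q < 1 -> 0 < r ->
  exists n, a * q ^+ n < r.
Proof.
move=> /andP[q0 q1] r0; have [a0|a0] := leP a 0.
  by exists 0; rewrite expr0 mulr1 (le_lt_trans a0).
have [->|qn0] := eqVneq q 0; first by exists 1; rewrite expr1 mulr0.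
have qp : 0 < q by rewrite lt0r qn0.
have h0 : 0 < q^-1 - 1 by rewrite subr_gt0 invf_gt1.
have := archi_boundP (ltW (divr_gt0 a0 (mulr_gt0 r0 h0))).
set n := Num.bound _ => hn; exists n.
have qn : 0 < q ^+ n by rewrite exprn_gt0.
rewrite -ltr_pdivlMr// -exprVn.
have bern : 1 + n%:R * (q^-1 - 1) <= q^-1 ^+ n.
  elim: (n) => [|k IH]; first by rewrite mul0r addr0 expr0.
  rewrite exprSr -natr1; have hk : 0 <= (k%:R : R) by [].
  set u := q^-1 in h0 IH *; have : 0 <= k%:R * (u - 1) ^+ 2.
    by rewrite mulr_ge0// sqr_ge0.
  have : (1 + k%:R * (u - 1)) * u <= u ^+ k * u by rewrite ler_wpM2r//; lra.
  nra.
have : a < r * (n%:R * (q^-1 - 1)).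
  by move: hn; rewrite ltr_pdivrMr ?mulr_gt0//; lra.
have : r * (n%:R * (q^-1 - 1)) < r * q^-1 ^+ n by rewrite ltr_pM2l//; lra.
lra.
Qed.

Lemma nested_sup (u v : nat -> R) :
  (forall n, u n <= u n.+1) -> (forall n, v n.+1 <= v n) ->
  (forall n, u n <= v n) -> exists s, forall n, u n <= s <= v n.
Proof.
move=> hu hv huv.
have um n m : (n <= m)%N -> u n <= u m.
  by elim: m => [|m IH]; rewrite leq_eqVlt => /predU1P[->|]// /IH/le_trans->.
have vm n m : (n <= m)%N -> v m <= v n.
  elim: m => [|m IH]; rewrite leq_eqVlt => /predU1P[->|]// /IH.
  exact: le_trans.
have uv n m : u n <= v m.
  apply: (le_trans (um _ _ (leq_maxl n m))).
  by apply: (le_trans (huv _)); apply: vm; exact: leq_maxr.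
have ne : range u !=set0 by exists (u 0%N), 0%N.
exists (sup (range u)) => n; apply/andP; split.
  by apply: ub_le_sup; [exists (v 0%N) => _ [m _ <-]|exists n].
by apply: ge_sup => // _ [m _ <-].
Qed.

Lemma goursat f x y l : 0 < l ->
  (forall s t, in_square x y l s t -> differentiable f (s +i* t : Cplx R)) ->
  sqint f x y l = 0.
Proof.
move=> l0 fd.
have fc s t : in_square x y l s t -> cont_at f s t.
  by move=> /fd; exact: differentiable_continuous.
pose inQ (p : R * R * R) := [/\ 0 < p.2, x <= p.1.1, p.1.1 + p.2 <= x + l,
  y <= p.1.2 & p.1.2 + p.2 <= y + l].
have /choice[g hg] : forall p, exists q, inQ p -> subsquare p q /\
    normc (sqint f p.1.1 p.1.2 p.2) <= 9 * normc (sqint f q.1.1 q.1.2 q.2).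
  move=> p; have [[p0 px1 px2 py1 py2]|np] := pselect (inQ p); last by exists p.
  have [|q sq hq] := @subsquare_exists R f p p0; last by exists q.
  by move=> s t st; apply: fc; move: st; rewrite /in_square; lra.
pose P n := iter n g (x, y, l).
have PS n : P n.+1 = g (P n) by [].
have PQ n : inQ (P n).
  elim: n => [|n IH]; first by split=> //=; lra.
  have [[h1 h2 h3 h4 h5] _] := hg _ IH; case: IH => i1 i2 i3 i4 i5.
  by rewrite PS; split => //; lra.
have Psub n : subsquare (P n) (P n.+1) by have [] := hg _ (PQ n).
have Psize n : (P n).2 = l * (1 / 3) ^+ n.
  elim: n => [|n IH]; first by rewrite expr0 mulr1.
  by have [_ _ _ _ e] := Psub n; rewrite e IH exprSr -mulrA mul1r.
have Pnorm n : normc (sqint f x y l) <=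
    9 ^+ n * normc (sqint f (P n).1.1 (P n).1.2 (P n).2).
  elim: n => [|n IH]; first by rewrite expr0 mul1r.
  rewrite (le_trans IH)// exprSr -mulrA ler_wpM2l ?exprn_ge0//.
  by have [] := hg _ (PQ n).
have [xs hxs] : exists s, forall n, (P n).1.1 <= s <= (P n).1.1 + (P n).2.
  apply: nested_sup => n; [by have [] := Psub n|by have [] := Psub n|].
  by rewrite lerDl; have [/ltW] := PQ n.
have [ys hys] : exists s, forall n, (P n).1.2 <= s <= (P n).1.2 + (P n).2.
  apply: nested_sup => n; [by have [] := Psub n|by have [] := Psub n|].
  by rewrite lerDl; have [/ltW] := PQ n.
pose z : Cplx R := xs +i* ys.
have zQ : in_square x y l xs ys.
  by have := hxs 0%N; have := hys 0%N; rewrite /in_square /=; lra.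
have [d hd] := differentiable_cplxP (fd _ _ zQ).
apply/eqP; rewrite -normc_eq0 eq_le normc_ge0 andbT; apply/ler_addgt0Pr => e e0.
(* The constant is chosen for the last line: with side l / 3^n, the bound 9^n * 8 * (precision * 2 *
   side) * side equals e exactly. *)
have le0 : 0 < e / (16 * l ^+ 2).
  by rewrite divr_gt0// mulr_gt0// exprn_gt0.
have [r r0 hr] := hd _ le0.
have [n hn] : exists n, 2 * l * (1 / 3) ^+ n < r by apply: exists_small_pow;
  lra.
set xn := (P n).1.1 in hn; set yn := (P n).1.2 in hn; set ln := (P n).2 in hn.
have ln0 : 0 < ln by have [] := PQ n.
have lnr : 2 * ln < r by rewrite /ln Psize mulrA.
have inn s t : in_square xn yn ln s t -> in_square x y l s t.
  by have [_ ? ? ? ?] := PQ n; rewrite /in_square -/xn -/yn -/ln; lra.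
(* The first order approximation of f at the common point z. By [sqint_affine] its integral is 0, so
   only the remainder is estimated on the small square. *)
pose h := fun w : Cplx R => f z + d * (w - z).
have hc s t : cont_at h s t by exact: cont_affine.
have near s t : in_square xn yn ln s t -> normc ((s +i* t : Cplx R) - z) <= 2 *
  ln.
  move=> st; rewrite (le_trans (normc_le_ReIm _))//=.
  have := hxs n; have := hys n; rewrite -/xn -/yn -/ln => *.
  have : `|s - xs| <= ln by rewrite ler_norml; move: st; rewrite /in_square;
    lra.
  have : `|t - ys| <= ln by rewrite ler_norml; move: st; rewrite /in_square;
    lra.
  lra.
have key : normc (sqint (fun w => f w - h w) xn yn ln) <=
    8 * (e / (16 * l ^+ 2) * (2 * ln)) * ln.
  apply: sqint_bound; first exact: ltW.
  - move=> s t /andP[/inn st _].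
    apply/differentiable_continuous/differentiableB; first exact: fd.
    rewrite /h; apply: differentiableD => //; apply: differentiableM => //.
  - move=> s t /andP[st _]; rewrite /h opprD addrA.
    have nst := near _ _ st.
    apply: (le_trans (hr _ (le_lt_trans nst lnr))).
    by rewrite ler_wpM2l// ltW.
rewrite add0r (le_trans (Pnorm n))//.
have -> : sqint f (P n).1.1 (P n).1.2 (P n).2 = sqint (fun w =>
  f w - h w) xn yn ln.
  have ha : sqint h xn yn ln = 0 by apply: sqint_affine; exact: ltW.
  rewrite /sqint rintB; first by rewrite -!/(sqint _ _ _ _) ha subr0.
  - move=> s hs; split; split; try exact: hc; apply: fc; apply: inn;
      rewrite /in_square; lra.
  - move=> s hs; split; split; try exact: hc; apply: fc; apply: inn;
      rewrite /in_square; lra.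
apply: (le_trans (ler_wpM2l _ key)); first by rewrite exprn_ge0.
rewrite /ln Psize.
have e3 : (9 : R) ^+ n * ((1 / 3) ^+ n * (1 / 3) ^+ n) = 1.
  by rewrite -!exprMn (_ : 9 * _ = 1) ?expr1n//; field.
have -> : 9 ^+ n * (8 * (e / (16 * l ^+ 2) * (2 * (l * (1 / 3) ^+ n))) * (l *
  (1 / 3) ^+ n))
  = e * ((9 : R) ^+ n * ((1 / 3) ^+ n * (1 / 3) ^+ n)).
  by field; rewrite lt0r_neq0.
by rewrite e3 mulr1.
Qed.
End GoursatThm.

(** * The maximum principle *)

Section MaxPrinciple.
Context {R : realType}.
Implicit Types (f g : Cplx R -> Cplx R) (x y l h : R).

Lemma differentiable_inv (z : Cplx R) : z != 0 ->
  differentiable (fun w : Cplx R => w^-1) z.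
Proof. by move=> z0; exact: (@differentiableV _ _ id). Qed.

Lemma cplx_neq0 (s t h : R) : 0 < h -> h <= `|s| \/ h <= `|t| ->
  (s +i* t : R[i]) != 0.
Proof.
move=> h0 H; rewrite eq_complex /=; apply/negP => /andP[/eqP s0 /eqP t0].
by move: H; rewrite s0 t0 normr0 => -[]; lra.
Qed.

(** The exact value is 2 pi i, but 4 is enough: on each side, of length 2h, the relevant part of 1/z
    has modulus at least 1 / (2h), so each side adds at least 1 to the imaginary part. *)
Lemma sqint_inv_ge h : 0 < h ->
  4 <= normc (sqint (fun w : Cplx R => w^-1) (- h) (- h) (2 * h)).
Proof.
move=> h0; apply: le_trans (normc_Im _); apply: le_trans (ler_norm _).
have c1 (s t : R) : h <= `|s| \/ h <= `|t| -> cont_at (fun w : Cplx R =>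
  w^-1) s t.
  move=> st; apply: differentiable_continuous; apply: differentiable_inv.
  exact: (cplx_neq0 h0).
have hh : h <= `|h| by rewrite ler_norm.
have hNh : h <= `|- h| by rewrite normrN ler_norm.
rewrite /sqint /rint; have -> : - h + 2 * h = h by ring.
have E (a b c d : R[i]) : Im (a - b + 'i%C * (c - d)) =
    Im a - Im b + (Re c - Re d).
  by case: a b c d => ? ? [? ?] [? ?] [? ?] /=; ring.
rewrite E {E}/cint /=.
have le_ : - h <= h by lra.
have cst_ : 1 = (2 * h)^-1 * (h - - h) by field; rewrite lt0r_neq0.
have dpos (t : R) : 0 < t ^+ 2 + h ^+ 2.
  by rewrite ltr_wpDl ?sqr_ge0// exprn_gt0.
have bnd (t : R) : - h <= t <= h -> (2 * h)^-1 <= h / (t ^+ 2 + h ^+ 2).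
  move=> th; rewrite ler_pdivlMr// mulrC ler_pdivrMr ?mulr_gt0//.
  have : 0 <= (h - t) * (h + t) by rewrite mulr_ge0//; lra.
  lra.
have b1 : 1 <= \int[lebesgue_measure]_(t in `[(- h),
  h]) - (- h / (t ^+ 2 + (- h) ^+ 2)).
  rewrite {1}cst_; apply: Rint_ge => //.
  - by move=> t _; apply: (@cont_on_Im R (fun t : R =>
      (t +i* (- h) : Cplx R)^-1) t t);
      rewrite ?lexx// => s _; apply: cont_horiz; apply: c1; right.
  - by move=> t /bnd; rewrite sqrrN mulNr opprK.
have b2 : \int[lebesgue_measure]_(t in `[(- h),
  h]) - (h / (t ^+ 2 + h ^+ 2)) <= - 1.
  rewrite {1}cst_ -mulNr; apply: Rint_le => //.
  - by move=> t _; apply: (@cont_on_Im R (fun t : R =>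
      (t +i* h : Cplx R)^-1) t t);
      rewrite ?lexx// => s _; apply: cont_horiz; apply: c1; right.
  - by move=> t /bnd; rewrite lerN2.
have b3 : 1 <= \int[lebesgue_measure]_(t in `[(- h),
  h]) (h / (h ^+ 2 + t ^+ 2)).
  rewrite {1}cst_; apply: Rint_ge => //.
  - by move=> t _; apply: (@cont_on_Re R (fun t : R =>
      (h +i* t : Cplx R)^-1) t t);
      rewrite ?lexx// => s _; apply: cont_vert; apply: c1; left.
  - by move=> t /bnd; rewrite addrC.
have b4 : \int[lebesgue_measure]_(t in `[(- h),
  h]) (- h / ((- h) ^+ 2 + t ^+ 2)) <= - 1.
  rewrite {1}cst_ -mulNr; apply: Rint_le => //.
  - by move=> t _; apply: (@cont_on_Re R (fun t : R =>
      (- h +i* t : Cplx R)^-1) t t);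
      rewrite ?lexx// => s _; apply: cont_vert; apply: c1; left.
  - by move=> t /bnd; rewrite addrC sqrrN mulNr lerN2.
rewrite /= in b1 b2 b3 b4 *.
lra.
Qed.
End MaxPrinciple.

Section MaxPrinciple.
Context {R : realType}.
Implicit Types (f g : Cplx R -> Cplx R) (x y l h : R).

Lemma side_norm h s t : 0 < h -> on_side (- h) (- h) (2 * h) s t ->
  h <= normc (s +i* t : R[i]) <= 2 * h.
Proof.
move=> h0 /andP[sq sd]; apply/andP; split.
  have hs := normc_Re (s +i* t : R[i]); have ht := normc_Im (s +i* t : R[i]).
  rewrite /= in hs ht.
  have [hN1 hN2] : h <= `|h| /\ h <= `|- h| by rewrite normrN ler_norm.
  have e : - h + 2 * h = h by ring.
  move: sd; rewrite e => /or4P[] /eqP E; rewrite ?E in hs ht *;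
    [exact: le_trans hs|exact: le_trans hs|exact: le_trans ht|exact: le_trans
      ht].
rewrite (le_trans (normc_le_ReIm _))//=.
have : `|s| <= h by rewrite ler_norml; move: sq; rewrite /in_square; lra.
have : `|t| <= h by rewrite ler_norml; move: sq; rewrite /in_square; lra.
lra.
Qed.

Lemma square_norm h s t : in_square (- h) (- h) (2 * h) s t ->
  normc (s +i* t : R[i]) <= 2 * h.
Proof.
move=> sq; rewrite (le_trans (normc_le_ReIm _))//=.
have : `|s| <= h by rewrite ler_norml; move: sq; rewrite /in_square; lra.
have : `|t| <= h by rewrite ler_norml; move: sq; rewrite /in_square; lra.
lra.
Qed.

(** * Integrals of f(z)/z around a possibly singular origin *)

Section Punctured.
Variables (f : Cplx R -> Cplx R) (rho : R).
Hypothesis fd : forall z : Cplx R, 0 < normc z < rho -> differentiable f z.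
Let psi := fun w : Cplx R => f w * w^-1.

Let psid (z : Cplx R) : 0 < normc z < rho -> differentiable psi z.
Proof.
move=> hz; apply: differentiableM; first exact: fd.
by apply: differentiable_inv; rewrite -normc_gt0; case/andP: hz.
Qed.

(** The eight outer squares avoid the origin and contribute 0 by [goursat]. The condition
    [6 * h < rho] puts the large square, of half side 3h, inside the disc of radius rho. *)
Lemma sqint_third h : 0 < h -> 6 * h < rho ->
  sqint psi (- (3 * h)) (- (3 * h)) (2 * (3 * h)) =
  sqint psi (- h) (- h) (2 * h).
Proof.
move=> h0 hr; have -> : 2 * (3 * h) = 3 * (2 * h) by ring.
have pd s t : in_square (- (3 * h)) (- (3 * h)) (3 * (2 * h)) s t ->
    (h <= `|s| \/ h <= `|t|) -> differentiable psi (s +i* t : Cplx R).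
  move=> st hst; apply: psid; rewrite normc_gt0 (cplx_neq0 h0 hst)/=.
  apply: (@le_lt_trans _ _ (2 * (3 * h))); last by lra.
  by apply: square_norm; move: st; rewrite /in_square; lra.
have absP (s : R) : s <= - h \/ h <= s -> h <= `|s|.
  by rewrite ler_normr => -[]; lra.
have gz u v : (- (3 * h) <= u <= h) && (- (3 * h) <= v <= h) ->
   (u <= - (3 * h) \/ h <= u) \/ (v <= - (3 * h) \/ h <= v) ->
   sqint psi u v (2 * h) = 0.
  move=> uv huv; apply: goursat; first by lra.
  move=> s t; rewrite /in_square => st; apply: pd; first by rewrite /in_square;
    lra.
  case: huv => huv; [left|right]; apply: absP; lra.
rewrite sqint_split; last 2 first.
- by lra.
- move=> s t st nst; apply: differentiable_continuous; apply: pd => //.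
  have [hs|hs] := boolP (- (3 * h) + 2 * h < s < - (3 * h) + 2 * h + 2 * h).
    by right; apply: absP; move: nst; rewrite hs/=; lra.
  by left; apply: absP; move: hs; lra.
do 4 (rewrite gz; [|lra|lra]).
have -> : - (3 * h) + 2 * h = - h by ring.
rewrite (gz (- h) (- h + 2 * h)); [|lra|lra].
do 3 (rewrite (gz (- h + 2 * h)); [|lra|lra]).
by rewrite !addr0 !add0r.
Qed.

Lemma sqint_third_iter h n : 0 < h -> 2 * h < rho ->
  sqint psi (- h) (- h) (2 * h) =
  sqint psi (- (h * (1 / 3) ^+ n)) (- (h * (1 / 3) ^+ n)) (2 * (h * (1 / 3) ^+
    n)).
Proof.
move=> h0 hr; elim: n => [|n ->]; first by rewrite expr0 mulr1.
have p0 : 0 < h * (1 / 3) ^+ n.+1 by rewrite mulr_gt0// exprn_gt0.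
have p1 : (1 / 3 : R) ^+ n.+1 <= 1 / 3.
  by rewrite exprS -[leRHS]mulr1 ler_wpM2l// exprn_ile1//; lra.
have e : h * (1 / 3) ^+ n = 3 * (h * (1 / 3) ^+ n.+1) by rewrite exprS; field.
by rewrite e sqint_third//; have := ler_wpM2l (ltW h0) p1; lra.
Qed.

(* Cauchy's formula for [f z / z], of which only the inequality between the
   value at the centre and the maximum on the boundary is kept. *)
Lemma weak_max_principle h (B : R) : {for (0 : Cplx R), continuous f} ->
  f 0 = 1 -> 0 < h -> 2 * h < rho ->
  (forall s t, on_side (- h) (- h) (2 * h) s t -> normc (f (s +i* t)) <= B) ->
  1 <= 4 * B.
Proof.
move=> /continuous_cplxP fc f0 h0 hr fB.
(* The integral of [psi] is the same over the squares of half side h and k. The large one bounds it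
   by 16 B; over the small one [psi] is so close to 1/z, where f is close to 1, that the integrals
   differ by at most e. The integral of 1/z has modulus at least 4. *)
suff : forall e, 0 < e -> 4 <= 16 * B + e by move=> /ler_addgt0Pr; lra.
move=> e e0; have [d d0 hd] := fc (e / 16) (divr_gt0 e0 (ltr0n _ 16)).
have [n hn] : exists n, 2 * h * (1 / 3) ^+ n < d by apply: exists_small_pow;
  lra.
set k := h * (1 / 3) ^+ n; have k0 : 0 < k by rewrite mulr_gt0// exprn_gt0.
have kh : k <= h.
  by rewrite /k -[leRHS]mulr1 ler_pM2l// exprn_ile1//; lra.
have sq_cont l s t : 0 < l -> l <= h -> on_side (- l) (- l) (2 * l) s t ->
    differentiable psi (s +i* t : Cplx R) /\ (s +i* t : R[i]) != 0.
  move=> l0 lh /(side_norm l0) st.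
  by split; [apply: psid|rewrite -normc_gt0]; lra.
have ub : normc (sqint psi (- h) (- h) (2 * h)) <= 16 * B.
  have -> : 16 * B = 8 * (B / h) * (2 * h) by field; rewrite lt0r_neq0.
  apply: sqint_bound; first by lra.
  - by move=> s t /sq_cont []// *; exact: differentiable_continuous.
  - move=> s t st; have := side_norm h0 st => /andP[hst _].
    rewrite /psi normcM normcV ler_pM ?normc_ge0 ?invr_ge0 ?normc_ge0 ?fB//.
    by rewrite lef_pV2// posrE (lt_le_trans h0).
have lb : normc (sqint (fun w => psi w - w^-1) (- k) (- k) (2 * k)) <= e.
  have -> : e = 8 * ((e / 16) / k) * (2 * k) by field; rewrite lt0r_neq0.
  apply: sqint_bound; first by lra.
  - move=> s t /(sq_cont _ _ _ k0 kh) [dp n0]; apply: differentiable_continuous.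
    exact: (differentiableB dp (differentiable_inv n0)).
  - move=> s t st; have := side_norm k0 st => /andP[hst hst2].
    have -> : psi (s +i* t) - (s +i* t)^-1 =
       (f (s +i* t) - f 0) * (s +i* t : R[i])^-1 by rewrite f0 /psi; ring.
    rewrite normcM normcV ler_pM ?normc_ge0 ?invr_ge0 ?normc_ge0//.
      apply/ltW/hd; rewrite subr0; apply: (le_lt_trans hst2).
      by rewrite /k mulrA.
    by rewrite lef_pV2// posrE (lt_le_trans k0).
have sub : sqint (fun w => psi w - w^-1) (- k) (- k) (2 * k) =
  sqint psi (- k) (- k) (2 * k) - sqint (fun w : Cplx R =>
    w^-1) (- k) (- k) (2 * k).
  have hx s t : on_side (- k) (- k) (2 * k) s t ->
     cont_at psi s t /\ cont_at (fun w : Cplx R => w^-1) s t.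
    move=> /(sq_cont _ _ _ k0 kh) [dp n0].
    exact: (conj (differentiable_continuous dp)
      (differentiable_continuous (differentiable_inv n0))).
  rewrite /sqint rintB// => s hs.
  - have [|c1 c2] := hx s (- k).
      by rewrite /on_side /in_square eqxx ?orbT andbT; lra.
    have [|c3 c4] := hx s (- k + 2 * k).
      by rewrite /on_side /in_square eqxx ?orbT andbT; lra.
    exact: (conj (conj c1 c3) (conj c2 c4)).
  - have [|c1 c2] := hx (- k) s.
      by rewrite /on_side /in_square eqxx ?orbT andbT; lra.
    have [|c3 c4] := hx (- k + 2 * k) s.
      by rewrite /on_side /in_square eqxx ?orbT andbT; lra.
    exact: (conj (conj c1 c3) (conj c2 c4)).
have := sqint_inv_ge k0.
rewrite (sqint_third_iter n h0 hr) -/k in ub.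
rewrite sub in lb.
have := normc_subl (sqint (fun w : Cplx R => w^-1) (- k) (- k) (2 * k))
  (sqint psi (- k) (- k) (2 * k)).
rewrite normc_distC; lra.
Qed.

End Punctured.
End MaxPrinciple.

Section MaxPrinciple.
Context {R : realType}.
Implicit Types (f g : Cplx R -> Cplx R).

Lemma continuous_mul_fun (K : numFieldType) (T : topologicalType) (f g : T ->
  K) (x : T) :
  {for x, continuous f} -> {for x, continuous g} ->
  {for x, continuous (fun y => f y * g y)}.
Proof. exact: continuousM. Qed.

Lemma continuous_add_fun (K : numFieldType) (T : topologicalType) (f g : T ->
  K) (x : T) :
  {for x, continuous f} -> {for x, continuous g} ->
  {for x, continuous (fun y => f y + g y)}.
Proof. exact: continuousD. Qed.

Lemma continuous_exp_fun (K : numFieldType) (T : topologicalType) (f : T ->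
  K) n (x : T) :
  {for x, continuous f} -> {for x, continuous (fun y => f y ^+ n)}.
Proof.
move=> fc; elim: n => [|n IH].
  exact: (@cst_continuous T K 1 x).
have -> : (fun y => f y ^+ n.+1) = (fun y => f y * f y ^+ n).
  by apply/funext => y; rewrite exprS.
exact: continuous_mul_fun.
Qed.

Lemma continuous_normc : continuous (fun z : Cplx R => normc z : R).
Proof.
move=> z A /nbhs_ballP [e /= e0 hA]; apply/nbhs_cplxP; exists e => // w wz.
apply: hA; rewrite /ball/= ltr_norml; apply/andP.
have := normc_subl z w; have := normc_subl w z.
rewrite (normc_distC z w); lra.
Qed.

Lemma continuous_of_real2 : continuous (fun x : R * R => x.1 +i* x.2 : Cplx R).
Proof.
move=> [x y] A /nbhs_cplxP [d d0 hd]; apply/nbhs_ballP.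
exists (d / 2); first by rewrite /= divr_gt0.
move=> [s t] [/= xs yt]; apply: hd.
rewrite (le_lt_trans (normc_le_ReIm _))//=.
by move: xs yt; rewrite /ball/= !(distrC x) !(distrC y); lra.
Qed.

Lemma compact_disc (t : R) : compact [set z : Cplx R | normc z <= t].
Proof.
have cK : compact [set z : Cplx R | `|Re z| <= t /\ `|Im z| <= t].
  have -> : [set z : Cplx R | `|Re z| <= t /\ `|Im z| <= t] =
     (fun x : R * R => x.1 +i* x.2 : Cplx R) @` (`[- t, t] `*` `[- t, t]).
    apply/seteqP; split => [z /= [zr zi]|_ [[x y] /= [xt yt] <-]].
      exists (Re z, Im z); last by case: z {zr zi}.
      by split; rewrite /= in_itv/= -ler_norml.
    by move: xt yt; rewrite /= !in_itv/= -!ler_norml.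
  apply: continuous_compact.
    by apply: continuous_subspaceT; exact: continuous_of_real2.
  by apply: compact_setX; exact: segment_compact.
apply: subclosed_compact cK _; last first.
  move=> z /= zt; split; [exact: le_trans (normc_Re _) zt|
    exact: le_trans (normc_Im _) zt].
rewrite (_ : [set _ | _] = (fun z : Cplx R => normc z : R) @^-1` [set x | x <=
  t])//.
by apply: preimage_closed; [move=> z _; exact: continuous_normc|exact:
  closed_le].
Qed.

Lemma differentiable_pow (V : normedModType (Cplx R)) (f : V ->
  Cplx R) n (z : V) :
  differentiable f z -> differentiable (fun w => f w ^+ n) z.
Proof.
move=> df; elim: n => [|n IH].
  exact: (@differentiable_cst _ _ _ (1 : Cplx R) z).
have -> : (fun w => f w ^+ n.+1) = (fun w => f w * f w ^+ n).
  by apply/funext => w; rewrite exprS.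
exact: differentiableM.
Qed.

Lemma differentiable_shift (a z : Cplx R) :
  differentiable (fun w : Cplx R => a + w) z.
Proof.
by apply: differentiableD; [exact: differentiable_cst|exact: ex_diff].
Qed.

(* Applying the weak principle to [f ^+ n] and letting n grow removes its
   constant 4. *)
Lemma max_at_center f (rho h B : R) :
  (forall z : Cplx R, 0 < normc z < rho -> differentiable f z) ->
  {for (0 : Cplx R), continuous f} -> 0 < h -> 2 * h < rho ->
  (forall s t, on_side (- h) (- h) (2 * h) s t -> normc (f (s +i* t)) <= B) ->
  normc (f 0) <= B.
Proof.
move=> fd fc h0 hr fB; rewrite leNgt; apply/negP => Bf.
have B0 : 0 <= B.
  apply: (le_trans (normc_ge0 _)); apply: (fB h 0).
  rewrite /on_side /in_square; have -> : - h + 2 * h = h by ring.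
  by rewrite eqxx !orbT andbT; lra.
have n0 : 0 < normc (f 0) by exact: le_lt_trans Bf.
have [n hn] : exists n, 4 * (B / normc (f 0)) ^+ n < 1.
  by apply: exists_small_pow => //; rewrite divr_ge0 ?normc_ge0//=
    ltr_pdivrMr// mul1r.
have fz : f 0 != 0 by rewrite -normc_gt0.
pose g (z : Cplx R) := (f 0)^-1 ^+ n * f z ^+ n.
have : 1 <= 4 * (B / normc (f 0)) ^+ n.
  have gd (z : Cplx R) : 0 < normc z < rho -> differentiable g z.
    move=> hz; apply: (@differentiableM _ _ (fun=> (f 0)^-1 ^+ n)).
      exact: differentiable_cst.
    exact: (differentiable_pow n (fd z hz)).
  apply: (@weak_max_principle R g rho gd h _ _ _ h0 hr).
  - apply: (@continuous_mul_fun R[i] (Cplx R) (fun=> (f 0)^-1 ^+ n));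
      first exact: cst_continuous.
    exact: continuous_exp_fun.
  - by rewrite /g -exprMn mulVf// expr1n.
  - move=> s t /fB st; rewrite /g -exprMn normcX normcM normcV mulrC.
    by rewrite lerXn2r ?nnegrE ?mulr_ge0 ?invr_ge0 ?normc_ge0// ler_pM2r
      ?invr_gt0.
lra.
Qed.

(** For [e >= 0] this is Lagrange's identity for the vectors (1, sqrt e z) and (1, sqrt e w). *)
Lemma normc_kernel (e : R) (z w : R[i]) :
  normc (1 + e%:C * z * conjc w) ^+ 2 =
  (1 + e * normc z ^+ 2) * (1 + e * normc w ^+ 2) - e * normc (z - w) ^+ 2.
Proof. by rewrite !normc_sqr; case: z w => a b [c d] /=; ring. Qed.

(* At a maximum point [z0] of |f|^2 (1 + e |z|^2), the function
   [f z * (1 + e z conj(z0))] has a strict local maximum of its modulus, with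
   the explicit gap given by [normc_kernel]. The origin is allowed to be a
   singular point. *)
Lemma max_principle_disc f (t A : R) : 0 < t ->
  (forall z : Cplx R, normc z <= t -> {for z, continuous f}) ->
  (forall z : Cplx R, 0 < normc z < t -> differentiable f z) ->
  (forall z : Cplx R, normc z = t -> normc (f z) <= A) ->
  forall z : Cplx R, normc z <= t -> normc (f z) <= A.
Proof.
move=> t0 fc fd fA z1 z1t; rewrite leNgt; apply/negP => Az1.
have A0 : 0 <= A.
  apply: (le_trans (normc_ge0 (f t%:C))); apply: fA.
  by rewrite normc_real gtr0_norm.
have A2 : A ^+ 2 < normc (f z1) ^+ 2.
  by rewrite ltrXn2r// ?nnegrE ?normc_ge0.
(* So small that A^2 (1 + e t^2) remains below |f z1|^2: the weight cannot push the maximum of [phi]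
   to the boundary circle. *)
pose e := (normc (f z1) ^+ 2 - A ^+ 2) / (2 * (A ^+ 2 + 1) * t ^+ 2).
have tt : 0 < t ^+ 2 by rewrite exprn_gt0.
have A1 : 0 < A ^+ 2 + 1 by rewrite ltr_wpDl// sqr_ge0.
have e0 : 0 < e by rewrite divr_gt0 ?subr_gt0// !mulr_gt0.
have eA : A ^+ 2 * (1 + e * t ^+ 2) < normc (f z1) ^+ 2.
  have h1 : e * t ^+ 2 * (2 * (A ^+ 2 + 1)) = normc (f z1) ^+ 2 - A ^+ 2.
    by rewrite /e; field; rewrite !lt0r_neq0.
  have : 0 < e * t ^+ 2 by rewrite mulr_gt0.
  move: h1; set u := e * t ^+ 2; set v := A ^+ 2;
    have : 0 <= v by rewrite sqr_ge0.
  nra.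
pose phi z := normc (f z) ^+ 2 * (1 + e * normc z ^+ 2).
have [z0] : exists2 z0 : Cplx R, z0 \in [set z : Cplx R | normc z <= t] &
    forall z : Cplx R, z \in [set z : Cplx R | normc z <= t] -> phi z <= phi z0.
  apply: compact_EVT_max; [by exists z1|exact: compact_disc|].
  apply: continuous_in_subspaceT => z; rewrite inE/= => zt.
  have c1 : {for z, continuous (fun z => normc (f z) : R)}.
    by apply: continuous_comp; [exact: fc|exact: continuous_normc].
  apply: (@continuous_mul_fun R (Cplx R) (fun z => normc (f z) ^+ 2)
    (fun z => 1 + e * normc z ^+ 2)); first exact: continuous_exp_fun.
  apply: (@continuous_add_fun R (Cplx R) (fun=> 1));
    first exact: cst_continuous.
  apply: (@continuous_mul_fun R (Cplx R) (fun=> e));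
    first exact: cst_continuous.
  by apply: (@continuous_exp_fun R (Cplx R) (fun z => normc z));
    exact: continuous_normc.
rewrite inE/= => z0t z0max.
have phi0 : normc (f z1) ^+ 2 <= phi z0.
  apply: (@le_trans _ _ (phi z1)); last by apply: z0max; rewrite inE.
  by rewrite /phi ler_peMr ?sqr_ge0// lerDl mulr_ge0 ?sqr_ge0// ltW.
have z0lt : normc z0 < t.
  rewrite lt_neqAle z0t andbT; apply/eqP => z0e.
  have : phi z0 <= A ^+ 2 * (1 + e * t ^+ 2).
    have fz0 : normc (f z0) ^+ 2 <= A ^+ 2.
      by rewrite lerXn2r ?nnegrE ?normc_ge0// fA.
    rewrite /phi z0e ler_wpM2r//; have := mulr_gt0 e0 tt; lra.
  lra.
(* The disc of radius rho about z0 must not contain the origin except as its centre, the one place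
   where [max_at_center] tolerates a singularity. *)
have [rho [rho0 rhod rhot]] : exists rho, [/\ 0 < rho,
   forall w : Cplx R, 0 < normc w < rho -> z0 + w != 0 & normc z0 + rho <= t].
  have [z00|z00] := eqVneq z0 0.
    exists t; split => //; last by rewrite z00 normc0 add0r.
    by move=> w /andP[w0 _]; rewrite z00 add0r -normc_gt0.
  exists (Num.min (normc z0) (t - normc z0)); split.
  - by rewrite lt_min normc_gt0 z00 subr_gt0.
  - move=> w /andP[_]; rewrite lt_min => /andP[wz _].
    rewrite -normc_gt0; have := normc_subl z0 (- w); rewrite opprK normc_opp.
    by apply: lt_le_trans; rewrite subr_gt0.
  - by rewrite -lerBrDl ge_min lexx orbT.
pose h := rho / 4; have h0 : 0 < h by rewrite divr_gt0.
pose k := 1 + e * normc z0 ^+ 2.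
have sq1 (a : R) : 1 <= 1 + e * a ^+ 2.
  by rewrite lerDl mulr_ge0 ?sqr_ge0// ltW.
have k1 : 1 <= k by exact: sq1.
pose T := 1 + e * t ^+ 2.
have T0 : 0 < T by exact: lt_le_trans (sq1 t).
have leT (z : Cplx R) : normc z <= t -> 1 + e * normc z ^+ 2 <= T.
  by move=> zt; rewrite lerD2l ler_pM2l// lerXn2r ?nnegrE ?normc_ge0 ?(ltW t0).
have kT : k <= T by exact: leT.
(* The relative gap: for |w| >= h the kernel identity subtracts e |w|^2 >= eta T^2, and T^2 bounds
   the product of the two weights from above. *)
pose eta := e * h ^+ 2 / T ^+ 2.
have eta0 : 0 < eta by apply: divr_gt0; [apply: mulr_gt0 => //|];
  exact: exprn_gt0.
have pz0 : 0 < phi z0.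
  by apply: lt_le_trans phi0; rewrite (le_lt_trans _ A2)// sqr_ge0.
have inT (w : Cplx R) : normc w < rho -> normc (z0 + w) <= t.
  by have := normcD z0 w; lra.
pose g (w : Cplx R) : Cplx R := f (z0 + w) * (1 + e%:C * (z0 + w) * conjc z0).
have dk (w : Cplx R) : differentiable (fun w : Cplx R =>
  1 + e%:C * (z0 + w) * conjc z0 : Cplx R) w.
  have d2 : differentiable (fun w : Cplx R => z0 + w) w by exact:
    differentiable_shift.
  have d3 : differentiable (fun w : Cplx R => e%:C * (z0 + w) : Cplx R) w.
    by apply: differentiableM.
  apply: differentiableD => //; exact: differentiableM.
have g0 : normc (g 0) ^+ 2 = phi z0 * k.
  rewrite /g normcM exprMn addr0 normc_kernel subrr normc0 expr0n /= mulr0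
    subr0.
  by rewrite /phi /k; ring.
have side (w : Cplx R) : h <= normc w <= 2 * h ->
  normc (g w) ^+ 2 <= phi z0 * k * (1 - eta).
  move=> /andP[hw wh]; have wr : normc w < rho by rewrite /h in wh; lra.
  have wt := inT _ wr; rewrite /g normcM exprMn normc_kernel.
  have -> : z0 + w - z0 = w by ring.
  have pw : phi (z0 + w) <= phi z0 by apply: z0max; rewrite inE.
  set F := normc (f (z0 + w)) ^+ 2 in pw *; set m :=
    1 + e * normc (z0 + w) ^+ 2 in pw *.
  have F0 : 0 <= F by rewrite sqr_ge0.
  have m1 : 1 <= m by exact: sq1.
  have mT : m <= T by exact: leT.
  have h1 : m * k * eta <= e * normc w ^+ 2.
    have : m * k <= T ^+ 2 by rewrite expr2 ler_pM//; lra.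
    rewrite -(ler_pM2r eta0) => /le_trans -> //.
    rewrite /eta mulrC divfK ?lt0r_neq0 ?exprn_gt0// ler_pM2l//.
    by rewrite lerXn2r ?nnegrE ?normc_ge0// ltW.
  have pw' : F * m <= phi z0 by exact: pw.
  have eta1 : eta <= 1.
    rewrite ler_pdivrMr ?exprn_gt0// mul1r.
    have hk : e * h ^+ 2 <= e * t ^+ 2.
      rewrite ler_pM2l// lerXn2r ?nnegrE ?(ltW h0) ?(ltW t0)//.
      by rewrite /h; have := normc_ge0 z0; lra.
    have : T <= T ^+ 2 by rewrite expr2 ler_peMr ?(ltW T0)//; lra.
    rewrite {1}/T; lra.
  apply: (@le_trans _ _ (F * (m * k * (1 - eta)))).
    by rewrite ler_wpM2l// -/k; lra.
  have -> : F * (m * k * (1 - eta)) = F * m * (k * (1 - eta)) by ring.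
  have -> : phi z0 * k * (1 - eta) = phi z0 * (k * (1 - eta)) by ring.
  by apply: ler_wpM2r => //; apply: mulr_ge0; lra.
have eta1 : 0 <= 1 - eta.
  have : normc (g h%:C) ^+ 2 <= phi z0 * k * (1 - eta).
    by apply: side; rewrite normc_real gtr0_norm//; lra.
  move=> /(le_trans (sqr_ge0 _)); rewrite pmulr_rge0// mulr_gt0//; lra.
have : normc (g 0) <= Num.sqrt (phi z0 * k * (1 - eta)).
  apply: (@max_at_center g rho h _ _ _ h0).
  - move=> w wr; apply: differentiableM; last exact: dk.
    have d1 : differentiable f (z0 + w).
      apply: fd; rewrite normc_gt0 rhod//=.
      by have := normcD z0 w; case/andP: wr; lra.
    have d2 : differentiable (fun w : Cplx R => z0 + w) w by exact:
      differentiable_shift.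
    exact: (differentiable_comp d2 d1).
  - apply: (@continuous_mul_fun R[i] (Cplx R) (fun w => f (z0 + w)));
      last exact: differentiable_continuous (dk 0).
    have d2 : {for (0 : Cplx R), continuous (fun w : Cplx R => z0 + w)}.
      by apply: differentiable_continuous; exact: differentiable_shift.
    have c1 : {for z0 + 0, continuous f} by apply: fc; rewrite addr0.
    exact: (continuous_comp d2 c1).
  - by rewrite /h; lra.
  - move=> s u /(side_norm h0) /side gle.
    by rewrite -(ger0_norm (normc_ge0 (g _))) -sqrtr_sqr; exact: ler_wsqrtr.
have kp : 0 < phi z0 * k by rewrite mulr_gt0//; lra.
rewrite -(ler_pXn2r (n := 2))// ?nnegrE ?normc_ge0 ?sqrtr_ge0//.
have kpe : 0 <= phi z0 * k * (1 - eta) by apply: mulr_ge0 => //; exact: ltW.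
rewrite g0 sqr_sqrtr//.
have := mulr_gt0 kp eta0; lra.
Qed.

End MaxPrinciple.

(** * The Schwarz lemma and its consequences *)

Section Schwarz.
Context {R : realType}.
Implicit Types (f g : Cplx R -> Cplx R).

(** The maximum principle is applied to f(z)/z with the derivative as value at 0. Only continuity of
    this quotient at 0 is available. *)
Lemma schwarz f (t A : R) : 0 < t ->
  (forall z : Cplx R, normc z <= t -> differentiable f z) -> f 0 = 0 ->
  (forall z : Cplx R, normc z = t -> normc (f z) <= A) ->
  forall z : Cplx R, normc z <= t -> normc (f z) <= A / t * normc z.
Proof.
move=> t0 fd f0 fA z zt.
have [d hd] : exists d : Cplx R, forall e : R, 0 < e -> exists2 r : R, 0 < r &
    forall w : Cplx R, normc (w - 0) < r ->
      normc (f w - f 0 - d * (w - 0)) <= e * normc (w - 0).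
  by apply: differentiable_cplxP; apply: fd; rewrite normc0 ltW.
pose q (w : Cplx R) : Cplx R := if w == 0 then d else f w * w^-1.
have qd (w : Cplx R) : 0 < normc w <= t -> differentiable q w.
  rewrite normc_gt0 => /andP[w0 wt]; apply/derivable1_diffP.
  apply: (@near_eq_derivable _ _ _ (fun w : Cplx R => f w * w^-1)).
    apply/nbhs_cplxP; exists (normc w); first by rewrite normc_gt0.
    move=> v; rewrite /q; case: eqVneq => // ->.
    by rewrite sub0r normc_opp ltxx.
  apply/derivable1_diffP; apply: differentiableM; first exact: fd.
  exact: differentiable_inv.
have [->|z0] := eqVneq z 0; first by rewrite f0 normc0 mulr0.
suff : normc (q z) <= A / t.
  rewrite /q (negbTE z0) normcM normcV ler_pdivrMr ?normc_gt0//.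
apply: (@max_principle_disc R q t) => //.
- move=> w wt; have [->|w0] := eqVneq w 0; last first.
    by apply: differentiable_continuous; apply: qd; rewrite normc_gt0 w0.
  apply/continuous_cplxP => e e0; have [r r0 hr] :=
    hd (e / 2) (divr_gt0 e0 (ltr0n _ 2)).
  exists r => // v vr; rewrite /q eqxx; case: eqVneq => [_|v0].
    by rewrite subrr normc0.
  have := hr v vr; rewrite f0 !subr0 => h.
  have -> : f v / v - d = (f v - d * v) / v by field.
  rewrite normcM normcV ltr_pdivrMr ?normc_gt0//; apply: (le_lt_trans h).
  by rewrite ltr_pM2r ?normc_gt0//; lra.
- by move=> w /andP[w0 /ltW wt]; apply: qd; rewrite w0.
- move=> w wt; have w0 : w != 0 by rewrite -normc_gt0 wt.
  by rewrite /q (negbTE w0) normcM normcV wt ler_pM2r ?invr_gt0// fA.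
Qed.

(** For A > 0 this shows that z / (2A - z) maps the half plane Re z <= A into the closed unit
    disc. *)
Lemma normc_sqr_double_sub (A : R) (z : R[i]) :
  normc ((2 * A)%:C - z) ^+ 2 = normc z ^+ 2 + 4 * A * (A - Re z).
Proof. by rewrite !normc_sqr; case: z => a b /=; ring. Qed.

(** Schwarz for f / (2A - f) gives |f| <= |2A - f| / 2 on the half disc, and the triangle inequality
    then gives |f| <= 2A. *)
Lemma borel_caratheodory f (t A : R) : 0 < t -> 0 < A ->
  (forall z : Cplx R, normc z <= t -> differentiable f z) -> f 0 = 0 ->
  (forall z : Cplx R, normc z <= t -> Re (f z) <= A) ->
  forall z : Cplx R, normc z <= t / 2 -> normc (f z) <= 2 * A.
Proof.
move=> t0 A0 fd f0 fA z zt.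
have nz (w : Cplx R) : normc w <= t -> (2 * A)%:C - f w != 0.
  move=> /fA; rewrite -normc_gt0 => h.
  rewrite (lt_le_trans _ (Re_le_normc _))//.
  by case: (f w) h => a b /=; lra.
have tt : normc z <= t by lra.
have := @schwarz (fun w => f w * ((2 * A)%:C - f w)^-1) t 1 t0 _ _ _ z tt.
rewrite f0 mul0r => H.
have {}H : normc (f z / ((2 * A)%:C - f z)) <= 1 / t * normc z.
  apply: H => // w wt.
  - apply: differentiableM; first exact: fd.
    apply: differentiableV; last exact: nz.
    by apply: differentiableB => //; exact: fd.
  - have wt' : normc w <= t by rewrite wt.
    rewrite normcM normcV ler_pdivrMr ?normc_gt0 ?nz// mul1r.
    rewrite -(ler_pXn2r (n := 2))// ?nnegrE ?normc_ge0// normc_sqr_double_sub.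
    by rewrite lerDl !mulr_ge0// ?(ltW A0)// subr_ge0 fA.
have h1 : 1 / t * normc z <= 1 / 2.
  by rewrite mul1r ler_pdivrMl//; lra.
move: (le_trans H h1); rewrite normcM normcV ler_pdivrMr ?normc_gt0 ?nz//.
have := normcB (2 * A)%:C (f z); rewrite normc_real gtr0_norm ?mulr_gt0//.
lra.
Qed.

(** The identity behind the disc automorphism (z - a) / (1 - conj(a) z). *)
Lemma normc_pick (a z : R[i]) :
  normc (1 - conjc a * z) ^+ 2 =
  normc (z - a) ^+ 2 + (1 - normc a ^+ 2) * (1 - normc z ^+ 2).
Proof. by rewrite !normc_sqr; case: z a => a b [c d] /=; ring. Qed.

(** The bound is of first order in 1 - |f 0|. This is what makes a function whose value at the
    centre is close to the unit circle nearly constant on the half disc. *)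
Lemma schwarz_pick f (t : R) : 0 < t ->
  (forall z : Cplx R, normc z <= t -> differentiable f z) ->
  (forall z : Cplx R, normc z <= t -> normc (f z) < 1) ->
  forall z : Cplx R, normc z <= t / 2 -> normc (f z - f 0) <= 1 - normc (f 0)
    ^+ 2.
Proof.
move=> t0 fd f1 z zt.
set a := f 0; have a1 : normc a < 1 by apply: f1; rewrite normc0 ltW.
have a0 := normc_ge0 a.
have nz (w : Cplx R) : normc w <= t -> 1 - conjc a * f w != 0.
  move=> /f1 h; rewrite -normc_gt0.
  have := normc_subl 1 (conjc a * f w); rewrite normc1 normcM normc_conj.
  have : normc a * normc (f w) <= normc a by rewrite ler_piMr// ltW.
  lra.
have tt : normc z <= t by lra.
have := @schwarz (fun w => (f w - a) * (1 - conjc a * f w)^-1) t 1 t0 _ _ _ z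
  tt.
rewrite subrr mul0r => H.
have {}H : normc ((f z - a) / (1 - conjc a * f z)) <= 1 / t * normc z.
  apply: H => // w wt.
  - apply: differentiableM.
      by apply: differentiableB => //; exact: fd.
    apply: differentiableV; last exact: nz.
    apply: differentiableB => //; apply: differentiableM => //; exact: fd.
  - have wt' : normc w <= t by rewrite wt.
    rewrite normcM normcV ler_pdivrMr ?normc_gt0 ?nz// mul1r.
    rewrite -(ler_pXn2r (n := 2))// ?nnegrE ?normc_ge0// normc_pick.
    rewrite lerDl mulr_ge0// subr_ge0 expr_le1 ?normc_ge0//; apply/ltW => //.
    exact: f1.
have h1 : 1 / t * normc z <= 1 / 2.
  by rewrite mul1r ler_pdivrMl//; lra.
move: (le_trans H h1); rewrite normcM normcV ler_pdivrMr ?normc_gt0 ?nz//.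
(* Rewriting the denominator around a turns |f z - a| <= |1 - conj(a) f z| / 2 into an inequality in
   which |f z - a| can be absorbed on the left. *)
have -> : 1 - conjc a * f z = (1 - normc a ^+ 2)%:C - conjc a * (f z - a).
  rewrite normc_sqr; case: (f z) (a) => x y [u v].
  by apply/eqP; rewrite eq_complex /=; apply/andP; split; apply/eqP; ring.
have aa : 0 <= 1 - normc a ^+ 2 by rewrite subr_ge0 expr_le1 ?normc_ge0// ltW.
have := normcB (1 - normc a ^+ 2)%:C (conjc a * (f z - a)).
rewrite normc_real (ger0_norm aa) normcM normc_conj.
have : normc a * normc (f z - a) <= normc (f z - a).
  by rewrite ler_piMl ?normc_ge0// ltW.
lra.
Qed.

(* In the proof, [0^-1 = 0] gives [q] its continuous value at 0. *)
Lemma flat_eq0 f (t A : R) : 0 < t ->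
  (forall z : Cplx R, normc z <= t -> differentiable f z) ->
  (forall z : Cplx R, normc z = t -> normc (f z) <= A) ->
  (forall k : nat, exists C : R, exists2 d : R, 0 < d &
    forall z : Cplx R, normc z < d -> normc (f z) <= C * normc z ^+ k) ->
  forall z : Cplx R, normc z < t -> f z = 0.
Proof.
move=> t0 fd fA flat z zt.
have A0 : 0 <= A.
  by apply: (le_trans (normc_ge0 (f t%:C))); apply: fA;
    rewrite normc_real gtr0_norm.
have f0 : f 0 = 0.
  have [C [d d0 /(_ 0)]] := flat 1%N; rewrite normc0 expr1 mulr0 => /(_ d0) h.
  by apply/eqP; rewrite -normc_eq0 eq_le h normc_ge0.
(* The maximum principle for f(z)/z^(k+1). As |z| < t, letting k grow forces f z = 0. *)
have key k : normc (f z) <= A * (normc z / t) ^+ k.+1.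
  pose q (w : Cplx R) : Cplx R := f w * (w^-1) ^+ k.+1.
  have qd (w : Cplx R) : 0 < normc w <= t -> differentiable q w.
    rewrite normc_gt0 => /andP[w0 wt]; apply: differentiableM; first exact: fd.
    by apply: differentiable_pow; exact: differentiable_inv.
  have [->|z0] := eqVneq z 0.
    by rewrite f0 normc0 mulr_ge0// exprn_ge0// divr_ge0// ltW.
  suff : normc (q z) <= A * t^-1 ^+ k.+1.
    rewrite /q normcM normcX normcV exprMn !exprVn ler_pdivrMr; last first.
      by rewrite exprn_gt0// normc_gt0.
    by move=> h; apply: (le_trans h); rewrite mulrAC mulrA.
  apply: (@max_principle_disc R q t) => //.
  - move=> w wt; have [->|w0] := eqVneq w 0; last first.
      by apply: differentiable_continuous; apply: qd; rewrite normc_gt0 w0.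
    (* One power more than the denominator of q, so that q tends to 0 at the origin. *)
    have [C [d d0 hC]] := flat k.+2.
    have C1 : 0 < `|C| + 1 by rewrite ltr_wpDl.
    apply/continuous_cplxP => e e0; exists (Num.min d (e / (`|C| + 1))).
      by rewrite lt_min d0 divr_gt0.
    move=> v; rewrite subr0 lt_min => /andP[vd ve].
    have q0 : q 0 = 0 by rewrite /q f0 mul0r.
    rewrite q0 subr0; have [->|v0] := eqVneq v 0; first by rewrite q0 normc0.
    have vp : 0 < normc v by rewrite normc_gt0.
    rewrite /q normcM normcX normcV exprVn ltr_pdivrMr ?exprn_gt0//.
    apply: (le_lt_trans (hC _ vd)); rewrite exprS mulrA ltr_pM2r ?exprn_gt0//.
    move: ve; rewrite ltr_pdivlMr//; apply: le_lt_trans.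
    by rewrite mulrC ler_wpM2l ?ltW//; have := ler_norm C; lra.
  - by move=> w /andP[w0 /ltW wt]; apply: qd; rewrite w0.
  - move=> w wt; rewrite /q normcM normcX normcV wt ler_wpM2r ?fA//.
    by rewrite exprn_ge0// invr_ge0 ltW.
  - exact: ltW.
apply/eqP; rewrite -normc_eq0 eq_le normc_ge0 andbT leNgt; apply/negP => fz.
have q01 : 0 <= normc z / t < 1.
  by rewrite divr_ge0 ?normc_ge0 ?(ltW t0)//= ltr_pdivrMr// mul1r.
have [k hk] := exists_small_pow (A * (normc z / t)) q01 fz.
by have := key k; rewrite exprS mulrA; lra.
Qed.

End Schwarz.

(** * Real functions: uniform first order expansion and Taylor dichotomy *)

Section RealCalculus.
Context {R : realType}.

Lemma le_pow1 (s : R) k : 0 <= s <= 1 -> s ^+ k.+1 <= s.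
Proof.
move=> /andP[s0 s1]; rewrite exprS -[leRHS]mulr1 ler_wpM2l//.
exact: exprn_ile1.
Qed.

Lemma exists_lt3 (a b c : R) : 0 < a -> 0 < b -> 0 < c ->
  exists t, [/\ 0 < t, t < a, t < b & t < c].
Proof.
move=> a0 b0 c0; have : 0 < Num.min (Num.min a b) c by rewrite !lt_min a0 b0 c0.
have : Num.min (Num.min a b) c <= c by rewrite ge_min lexx orbT.
have : Num.min (Num.min a b) c <= b by rewrite !ge_min lexx !orbT.
have : Num.min (Num.min a b) c <= a by rewrite !ge_min lexx.
move: (Num.min _ _) => m ma mb mc m0.
by exists (m / 2); split; lra.
Qed.

Lemma is_derive_line (V : normedModType R) (f : V -> R) (q v : V) (t : R) :
  derivable f (q + t *: v) v ->
  is_derive t 1 (fun s => f (q + s *: v)) ('D_v f (q + t *: v)).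
Proof.
have E : (fun h : R => h^-1 *: (((fun s => f (q + s *: v)) \o shift t) (h *: 1)
    - f (q + t *: v))) =
   (fun h : R => h^-1 *: ((f \o shift (q + t *: v)) (h *: v) - f (q + t *: v))).
  apply/funext => h /=; congr (_ *: (f _ - _)).
  by rewrite [h *: 1]mulr1 scalerDl addrCA.
move=> df; apply: DeriveDef; first by rewrite /derivable E.
by rewrite /derive E.
Qed.

Lemma line_MVT (V : normedModType R) (f : V -> R) (q v : V) (t : R) :
  (forall s, `|s| <= `|t| -> derivable f (q + s *: v) v) ->
  exists2 s, `|s| <= `|t| & f (q + t *: v) - f q = 'D_v f (q + s *: v) * t.
Proof.
move=> df; have [t0|t0|->] := ltgtP t 0.
- have cs (s : R) : s \in `]t, 0[ -> `|s| <= `|t|.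
    by rewrite in_itv/= => /andP[h1 h2]; rewrite !ltr0_norm//; lra.
  have [||s /cs st] := @MVT R (fun s => f (q + s *: v)) (fun s =>
    'D_v f (q + s *: v)) t 0 t0.
  + by move=> s /cs st; apply: is_derive_line; exact: df.
  + apply: derivable_within_continuous => s; rewrite in_itv/= => /andP[h1 h2].
    have ds : derivable f (q + s *: v) v.
      by apply: df; rewrite (ltr0_norm t0) ler0_norm//; lra.
    exact: (@ex_derive _ _ _ _ _ _ _ (is_derive_line ds)).
  + rewrite scale0r addr0 => e; exists s => //; lra.
- have cs (s : R) : s \in `]0, t[ -> `|s| <= `|t|.
    by rewrite in_itv/= => /andP[h1 h2]; rewrite !gtr0_norm//; lra.
  have [||s /cs st] := @MVT R (fun s => f (q + s *: v)) (fun s =>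
    'D_v f (q + s *: v)) 0 t t0.
  + by move=> s /cs st; apply: is_derive_line; exact: df.
  + apply: derivable_within_continuous => s; rewrite in_itv/= => /andP[h1 h2].
    have ds : derivable f (q + s *: v) v.
      by apply: df; rewrite (gtr0_norm t0) ger0_norm//; lra.
    exact: (@ex_derive _ _ _ _ _ _ _ (is_derive_line ds)).
  + rewrite scale0r addr0 subr0 => e; exists s => //.
- by exists 0; rewrite // scale0r addr0 subrr mulr0.
Qed.

(** The mean value theorem on a segment from a moving base point q: continuity of ['D_v f] at p
    makes the error uniform in q. An expansion at p alone would not compare two points that both
    differ from p. *)
Lemma uniform_step (V : normedModType R) (f : V -> R) (p v : V) :
  (\forall x \near p, derivable f x v) -> {for p, continuous ('D_v f)} ->
  forall e : R, 0 < e -> exists2 d : R, 0 < d & forall q t,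
    `|q - p| < d -> `|t| < d -> `|f (q + t *: v) - f q - t * 'D_v f p| <= e *
      `|t|.
Proof.
move=> df dc e e0.
have h1 : nbhs p (fun x => `|'D_v f x - 'D_v f p| < e).
  have /cvg_ballP/(_ e e0) := dc; apply: filterS => x.
  by rewrite /ball/= distrC.
have [d /= d0 hd] : nbhs_ball p (fun x => derivable f x v /\ `|'D_v f x - 'D_v
  f p| < e).
  by apply/nbhs_ballP; apply: filterI df h1.
have v1 : 0 < 1 + `|v| by rewrite ltr_pwDl.
exists (d / (2 * (1 + `|v|))); first by rewrite divr_gt0// mulr_gt0.
move=> q t qp td.
have hs (s : R) : `|s| <= `|t| -> derivable f (q + s *: v) v /\
     `|'D_v f (q + s *: v) - 'D_v f p| < e.
  move=> st; apply: hd; rewrite -ball_normE /= distrC.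
  have -> : q + s *: v - p = (q - p) + s *: v by rewrite addrAC.
  apply: (le_lt_trans (ler_normD _ _)); rewrite normrZ.
  have sd : `|s| < d / (2 * (1 + `|v|)) by exact: le_lt_trans td.
  move: qp sd; rewrite !ltr_pdivlMr ?mulr_gt0// => qp sd.
  have := normr_ge0 v; have := normr_ge0 (q - p); have := normr_ge0 s.
  nra.
have [|s st ->] := @line_MVT V f q v t; first by move=> s /hs[].
rewrite [t * _]mulrC -mulrBl normrM ler_wpM2r//.
by have [_ /ltW] := hs s st.
Qed.

Lemma is_derive_cvg (g : R -> R) (x d : R) : is_derive x 1 g d -> {for x,
  continuous g}.
Proof.
move=> h; apply: differentiable_continuous; apply/derivable1_diffP.
exact: ex_derive.
Qed.

Lemma MVT0 (g dg : R -> R) (d s : R) : 0 < s < d ->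
  (forall x : R, `|x| < d -> is_derive x 1 g (dg x)) ->
  exists2 c, 0 < c < s & g s - g 0 = dg c * s.
Proof.
move=> /andP[s0 sd] dd.
have [||c] := @MVT R g dg 0 s s0.
- by move=> x; rewrite in_itv/= => /andP[x0 xs]; apply: dd;
    rewrite gtr0_norm//; lra.
- apply: continuous_in_subspaceT => x; rewrite inE/= in_itv/= => /andP[x0 xs].
  by apply: is_derive_cvg (dd _ _); rewrite ger0_norm//; lra.
- by rewrite in_itv/= subr0 => cs e; exists c.
Qed.

(** * Taylor estimates from a sequence of successive derivatives *)

Section Taylor.
Variables (G : nat -> R -> R) (d : R).
Hypothesis d0 : 0 < d.
Hypothesis dG : forall k (s : R), `|s| < d -> is_derive s 1 (G k) (G k.+1 s).

Let near0 k (e : R) : 0 < e -> exists2 r, 0 < r < d & forall s,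
  `|s| <= r -> `|G k s - G k 0| < e.
Proof.
move=> e0.
have c0 : {for 0, continuous (G k)}.
  by apply: (@is_derive_cvg _ _ (G k.+1 0)); apply: dG; rewrite normr0.
have h1 : nbhs (0 : R) (fun x => `|G k x - G k 0| < e).
  have /cvg_ballP/(_ e e0) := c0; apply: filterS => x.
  by rewrite /ball/= distrC.
have /nbhs_ballP [r /= r0 hr] := h1.
exists (Num.min r d / 2).
  have : 0 < Num.min r d by rewrite lt_min r0.
  have : Num.min r d <= d by rewrite ge_min lexx orbT.
  lra.
move=> s sr; apply: hr; rewrite /ball/= sub0r normrN.
apply: (le_lt_trans sr).
have : 0 < Num.min r d by rewrite lt_min r0.
have : Num.min r d <= r by rewrite ge_min lexx.
lra.
Qed.

(** The induction treats all derivatives at once: the mean value theorem turns a bound of order k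
    for [G j.+1] into one of order k + 1 for [G j]. *)
Lemma flat_upper : (forall k, G k 0 = 0) -> forall k j, exists C : R,
  exists2 e : R, 0 < e < d & forall s, 0 <= s <= e -> `|G j s| <= C * s ^+ k.
Proof.
move=> G0; elim => [|k IH] j.
  have [r rd hr] := near0 j ltr01; exists 1, r => // s /andP[s0 sr].
  by rewrite expr0 mulr1; have := hr s; rewrite G0 subr0 ger0_norm// =>
    /(_ sr)/ltW.
have [C [e ed hC]] := IH j.+1; exists `|C|, e => // s /andP[s0 se].
have [->|sn0] := eqVneq s 0; first by rewrite G0 normr0 exprS mul0r mulr0.
have sp : 0 < s by rewrite lt0r sn0.
have [|c cs] := @MVT0 (G j) (G j.+1) d s.
  by rewrite sp (le_lt_trans se)//; case/andP: ed.
rewrite G0 subr0 => ->; rewrite normrM (gtr0_norm sp) exprSr mulrA.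
rewrite ler_wpM2r//; case/andP: cs => c0 cs.
apply: (le_trans (hC c _)); first by rewrite ltW//=; lra.
apply: (@le_trans _ _ (`|C| * c ^+ k)).
  by rewrite ler_wpM2r ?ler_norm// exprn_ge0// ltW.
by rewrite ler_wpM2l// lerXn2r// ?nnegrE ltW.
Qed.

(** The lower bound on the N-th derivative is integrated i times; each integration is the mean value
    theorem for [G (N - i.+1)] minus the expected monomial. *)
Lemma nonflat_lower N : (forall k, (k < N)%N -> G k 0 = 0) -> 0 < G N 0 ->
  forall i, (i <= N)%N -> exists2 c : R, 0 < c &
  exists2 e : R, 0 < e < d & forall s, 0 <= s <= e -> c * s ^+ i <= G (N - i) s.
Proof.
move=> G0 GN; elim => [|i IH] iN.
  rewrite subn0; have [|r rd hr] := near0 N (e := G N 0 / 2); first by lra.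
  exists (G N 0 / 2); first by lra.
  exists r => // s /andP[s0 sr]; rewrite expr0 mulr1.
  by have := hr s; rewrite ger0_norm// => /(_ sr); rewrite ltr_norml; lra.
have [c c0 [e ed hc]] := IH (ltnW iN).
have i0 : (0 : R) < i.+1%:R by rewrite ltr0n.
exists (c / i.+1%:R); first by rewrite divr_gt0.
exists e => // s /andP[s0 se].
have Ni : (N - i)%N = (N - i.+1).+1 by rewrite -subSn// subSS.
have GNi : G (N - i.+1)%N 0 = 0.
  by apply: G0; rewrite ltn_subrL/= (leq_ltn_trans (leq0n i) iN).
have [->|sn0] := eqVneq s 0; first by rewrite GNi exprS mul0r mulr0.
have sp : 0 < s by rewrite lt0r sn0.
have [|x xd|y /andP[y0 ys]] := @MVT0 (fun x => G (N - i.+1)%N x - c / i.+1%:R *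
  x ^+ i.+1)
   (fun x => G (N - i)%N x - c * x ^+ i) d s.
- by rewrite sp (le_lt_trans se)//; case/andP: ed.
- have := dG (N - i.+1) xd; rewrite -Ni => h.
  have hX : is_derive x 1 ((@id R : R -> R) ^+ i.+1) ((i.+1%:R * x ^+ i) *: 1).
    exact: is_deriveX.
  have -> : (fun x => G (N - i.+1)%N x - c / i.+1%:R * x ^+ i.+1) =
     (G (N - i.+1)%N - (c / i.+1%:R) \*: ((@id R : R -> R) ^+ i.+1)).
    by apply/funext => y; rewrite !fctE.
  apply: is_derive_eq; congr (_ - _).
  rewrite [_ *: 1]mulr1 -[_ *: _]/(_ * _) mulrA divfK // lt0r_neq0.
rewrite GNi [0 ^+ _]exprS mul0r mulr0 subrr subr0 => h.
rewrite -subr_ge0 h mulr_ge0// subr_ge0 hc//; lra.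
Qed.

End Taylor.

(** Look at the first derivative that does not vanish at 0. If it were negative, [nonflat_lower] for
    the opposite functions would contradict [0 <= G 0%N s]. *)
Lemma taylor_dichotomy (G : nat -> R -> R) (d : R) : 0 < d ->
  (forall k (s : R), `|s| < d -> is_derive s 1 (G k) (G k.+1 s)) ->
  (forall s, 0 <= s < d -> 0 <= G 0%N s) ->
  (forall k, exists C : R, exists2 e : R, 0 < e < d &
     forall s, 0 <= s <= e -> G 0%N s <= C * s ^+ k) \/
  (exists N : nat, exists2 c : R, 0 < c & exists2 e : R, 0 < e < d &
     forall s, 0 <= s <= e -> c * s ^+ N <= G 0%N s).
Proof.
move=> d0 dG G0.
have [all0|] := pselect (forall k, G k 0 = 0).
  left => k; have [C [e ed hC]] := flat_upper d0 dG all0 k 0.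
  by exists C, e => // s /hC; apply: le_trans; exact: ler_norm.
move=> /existsNP exk; right.
have ex : exists k, G k 0 != 0 by case: exk => k /eqP hk; exists k.
have [N GN Nmin] := ex_minnP ex.
have GlN k : (k < N)%N -> G k 0 = 0.
  by rewrite ltnNge => kN; apply/eqP; apply: contraNT kN => /Nmin.
have [GNneg|GNpos|/eqP] := ltgtP (G N 0) 0; last by rewrite (negbTE GN).
- have dN k (s : R) : `|s| < d -> is_derive s 1 (fun x => - G k x) (- G k.+1 s).
    by move=> sd; have h := dG k s sd; exact: is_deriveN.
  have [||c c0 [e ed hc]] := @nonflat_lower (fun k x =>
    - G k x) d d0 dN N _ _ N (leqnn N).
  - by move=> k /GlN ->; rewrite oppr0.
  - by rewrite oppr_gt0.
  move: hc; rewrite subnn => hc; have e0 : 0 < e by case/andP: ed.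
  have := hc e; rewrite lexx (ltW e0) => /(_ isT).
  have := G0 e; rewrite (ltW e0); case/andP: ed => _ -> /(_ isT).
  have := mulr_gt0 c0 (exprn_gt0 N e0); lra.
- have [c c0 [e ed hc]] := nonflat_lower d0 dG GlN GNpos (leqnn N).
  by exists N, c => //; exists e => //; rewrite subnn in hc.
Qed.

End RealCalculus.

(** * Complete Reinhardt domains and defining functions at (1, 0) *)

Section Reinhardt.
Context {R : realType}.
Implicit Types (D U : set (Cplx2 R)).

Lemma add_scale4 (q v : (R * R) * (R * R)) (t : R) :
  q + t *: v = ((q.1.1 + t * v.1.1, q.1.2 + t * v.1.2),
                (q.2.1 + t * v.2.1, q.2.2 + t * v.2.2)).
Proof. by case: q v => [[? ?] [? ?]] [[? ?] [? ?]]. Qed.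

(** The leading 1 keeps it positive at v = 0, so that one can divide by it. *)
Definition l1norm (v : (R * R) * (R * R)) : R :=
  1 + (`|v.1.1| + `|v.1.2| + `|v.2.1| + `|v.2.2|).

Lemma l1norm_gt0 v : 0 < l1norm v.
Proof. by rewrite ltr_pwDl// !addr_ge0. Qed.

Lemma exists_small_scaling (v : (R * R) * (R * R)) (m : R) : 0 < m ->
  exists t, [/\ 0 < t, t < m & [/\ t * `|v.1.1| < m, t * `|v.1.2| < m,
    t * `|v.2.1| < m & t * `|v.2.2| < m]].
Proof.
move=> m0; have S0 := l1norm_gt0 v.
have [t [t0 tmS tm _]] := exists_lt3 (divr_gt0 m0 S0) m0 m0.
have tS : t * l1norm v < m by rewrite -ltr_pdivlMr.
exists t; split => //; move: tS; rewrite /l1norm.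
have := normr_ge0 v.1.1; have := normr_ge0 v.1.2.
have := normr_ge0 v.2.1; have := normr_ge0 v.2.2.
move: (`|v.1.1|) (`|v.1.2|) (`|v.2.1|) (`|v.2.2|) => a b c d d0 c0 b0 a0 h.
by split; apply: le_lt_trans h; rewrite ler_pM2l//; lra.
Qed.

Lemma nbhs_cplx2P (z : Cplx2 R) (P : set (Cplx2 R)) :
  nbhs z P <-> exists2 d : R, 0 < d &
    forall w : Cplx2 R, normc (w.1 - z.1) < d -> normc (w.2 - z.2) < d -> P w.
Proof.
split.
- case=> -[A B] [/= /nbhs_cplxP[a a0 hA] /nbhs_cplxP[b b0 hB]] AB.
  exists (Num.min a b); first by rewrite lt_min a0.
  move=> w; rewrite !lt_min => /andP[wa _] /andP[_ wb].
  by apply: AB; split; [exact: hA|exact: hB].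
- case=> d d0 hd.
  exists ([set w | normc (w - z.1) < d], [set w | normc (w - z.2) < d]).
    by split; apply/nbhs_cplxP; exists d.
  by move=> w [/= w1 w2]; exact: hd.
Qed.

Lemma reinhardt_sub D (z1 z2 w1 w2 : Cplx R) : complete_reinhardt D ->
  D (z1, z2) -> normc w1 <= normc z1 -> normc w2 <= normc z2 -> D (w1, w2).
Proof.
move=> hr Dz h1 h2.
have key (w z : Cplx R) : normc w <= normc z ->
    exists2 m : Cplx R, normc m <= 1 & w = m * z.
  have [->|z0] := eqVneq z 0.
    rewrite normc0 => w0; exists 0; first by rewrite normc0.
    by apply/eqP; rewrite mul0r -normc_eq0 eq_le w0 normc_ge0.
  move=> wz; exists (w / z); last by rewrite divfK.
  by rewrite normcM normcV ler_pdivrMr ?normc_gt0// mul1r.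
have [m1 m11 ->] := key _ _ h1; have [m2 m21 ->] := key _ _ h2.
by apply: (hr m1 m2 (z1, z2)) => //; rewrite normc_norm lecR.
Qed.

Section Domain.
Variables (D : set (Cplx2 R)) (hD : domain D) (hrein : complete_reinhardt D).
Hypothesis hp0 : boundary D (1 : Cplx R, 0 : Cplx R).

Lemma notin_D_p0 : ~ D (1 : Cplx R, 0 : Cplx R).
Proof.
have [oD _ _] := hD; have [_ ] := hp0.
by move=> h Dp; apply: h; apply: open_nbhs_nbhs.
Qed.

Lemma D_abs (z1 z2 : Cplx R) :
  D (z1, z2) <-> D ((normc z1)%:C, (normc z2)%:C).
Proof.
by split=> h; apply: (reinhardt_sub hrein h);
  rewrite normc_real ger0_norm ?normc_ge0.
Qed.

Lemma D_z1_lt1 (z1 z2 : Cplx R) : D (z1, z2) -> normc z1 < 1.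
Proof.
move=> Dz; rewrite ltNge; apply/negP => z1n.
apply: notin_D_p0; apply: (reinhardt_sub hrein Dz); first by rewrite normc1.
by rewrite normc0 normc_ge0.
Qed.

Lemma D_axis (a : Cplx R) : normc a < 1 -> D (a, 0).
Proof.
move=> a1; have [cl _] := hp0.
have /cl [w [Dw /= w1]] : nbhs (1 : Cplx R, 0 : Cplx R)
    [set w : Cplx2 R | normc (w.1 - 1) < 1 - normc a].
  by apply/nbhs_cplx2P; exists (1 - normc a); [rewrite subr_gt0|move=> w].
have Dw' : D (w.1, w.2) by case: w Dw {w1}.
apply: (reinhardt_sub hrein Dw'); last by rewrite normc0 normc_ge0.
have := normc_subl 1 w.1; rewrite normc1 normc_distC; lra.
Qed.

Definition real_p0 : (R * R) * (R * R) := ((1, 0), (0, 0)).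

Section DefiningFunction.
Variable (r : Cplx2 R -> R).
Hypothesis hr : local_defining_function D (1 : Cplx R, 0 : Cplx R) r.

Definition coords (z1 z2 : Cplx R) : (R * R) * (R * R) :=
  ((Re z1, Im z1), (Re z2, Im z2)).

Lemma of_real4_coords (z1 z2 : Cplx R) : of_real4 (coords z1 z2) = (z1, z2).
Proof. by case: z1 z2 => a b [c d]. Qed.

Let rho := r \o of_real4.

Lemma norm4_lt (q : (R * R) * (R * R)) (a : R) :
  (`|q| < a) = [&& `|q.1.1| < a, `|q.1.2| < a, `|q.2.1| < a & `|q.2.2| < a].
Proof. by rewrite !prod_normE !gt_max -!andbA. Qed.

Lemma smooth_derivable (V : normedModType R) (W : set V) (g : V -> R) v x :
  smooth_on W g -> W x -> derivable g x v.
Proof. by move=> /(_ 1%N)[_ /(_ v)[h _]]; exact: h. Qed.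

Lemma smooth_cont (V : normedModType R) (W : set V) (g : V -> R) x :
  smooth_on W g -> W x -> {for x, continuous g}.
Proof. by move=> /(_ 0%N)[h _]; exact: h. Qed.

Lemma smooth_D (V : normedModType R) (W : set V) (g : V -> R) v :
  smooth_on W g -> smooth_on W ('D_v g).
Proof. by move=> h k; have [_ /(_ v)[]] := h k.+1. Qed.

(** That r vanishes at p is derived: r is not negative there because p is not in D, and not positive
    by continuity, p being a limit of points of D. *)
Lemma ldf_nbhd : exists d : R, [/\ 0 < d,
  forall q, `|q - real_p0| < d -> exists2 W, W q & smooth_on W rho,
  forall q, `|q - real_p0| < d -> D (of_real4 q) <-> rho q < 0 &
  rho real_p0 = 0 /\ exists v, 'D_v rho real_p0 != 0].
Proof.
have [U [oU Up sm HU gr]] := hr.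
have p4p : of_real4 real_p0 = (1 : Cplx R, 0 : Cplx R) by [].
have /nbhs_cplx2P[d d0 hd] : nbhs (1 : Cplx R, 0 : Cplx R) U by exact:
  open_nbhs_nbhs.
have Ud q : `|q - real_p0| < d / 2 -> U (of_real4 q).
  rewrite norm4_lt /= => /and4P[h1 h2 h3 h4].
  by apply: hd; rewrite (le_lt_trans (normc_le_ReIm _))//=; lra.
have p4U : U (of_real4 real_p0) by rewrite p4p.
have rho0 : rho real_p0 = 0.
  apply/eqP; rewrite eq_le; apply/andP; split; last first.
    by rewrite leNgt; apply/negP => /(HU _ p4U) /notin_D_p0.
  rewrite leNgt; apply/negP => rp.
  have cr : {for real_p0, continuous rho} by exact: (smooth_cont sm).
  have : nbhs real_p0 (fun q => 0 < rho q).
    have h0 : nbhs (rho real_p0) [set y | 0 < y].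
      by apply: open_nbhs_nbhs; split => //; exact: open_gt.
    exact: (cr _ h0).
  move=> /nbhs_ballP[e /= e0 he].
  have [cl _] := hp0.
  have /cl [w [Dw [w1 w2]]] : nbhs (1 : Cplx R, 0 : Cplx R)
    [set w : Cplx2 R | normc (w.1 - 1) < Num.min e d /\ normc (w.2 - 0) <
      Num.min e d].
    apply/nbhs_cplx2P; exists (Num.min e d); first by rewrite lt_min e0.
    by move=> w.
  have Uw : U w by apply: hd; [apply: lt_le_trans w1 _|apply: lt_le_trans w2 _];
    rewrite ge_min lexx orbT.
  have /(HU _ Uw) := Dw.
  have : 0 < rho (coords w.1 w.2).
    apply: he; rewrite -ball_normE /= distrC norm4_lt /=.
    have wm : Num.min e d <= e by rewrite ge_min lexx.
    have w1e := lt_le_trans w1 wm; have w2e := lt_le_trans w2 wm.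
    apply/and4P; split.
    + by apply: le_lt_trans w1e; have := normc_Re (w.1 - 1); case: (w.1).
    + by apply: le_lt_trans w1e; have := normc_Im (w.1 - 1);
        case: (w.1) => ? ? /=; rewrite oppr0.
    + by apply: le_lt_trans w2e; have := normc_Re (w.2 - 0); case: (w.2).
    + by apply: le_lt_trans w2e; have := normc_Im (w.2 - 0);
        case: (w.2) => ? ? /=; rewrite oppr0.
  rewrite /rho /= of_real4_coords -surjective_pairing; lra.
exists (d / 2); split.
- by rewrite divr_gt0.
- by move=> q /Ud Uq; exists (of_real4 @^-1` U).
- by move=> q /Ud /HU.
- by split => //; apply: gr => //; rewrite p4p.
Qed.

Let E1 : (R * R) * (R * R) := ((1, 0), (0, 0)).
Let E2 : (R * R) * (R * R) := ((0, 1), (0, 0)).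
Let E3 : (R * R) * (R * R) := ((0, 0), (1, 0)).
Let E4 : (R * R) * (R * R) := ((0, 0), (0, 1)).

Lemma ldf_step v (e : R) : 0 < e -> exists2 d : R, 0 < d & forall q t,
    `|q - real_p0| < d -> `|t| < d ->
    `|rho (q + t *: v) - rho q - t * 'D_v rho real_p0| <= e * `|t|.
Proof.
move=> e0; have [d [d0 sm _ _]] := ldf_nbhd.
apply: (@uniform_step R _ rho real_p0 v _ _ e e0).
- apply/nbhs_ballP; exists d => // q; rewrite -ball_normE /= distrC =>
    /sm[W Wq sW].
  exact: smooth_derivable sW Wq.
- have [|W Wq sW] := sm real_p0; first by rewrite subrr normr0.
  exact: smooth_cont (smooth_D v sW) Wq.
Qed.

(* The line avoids D, so that the defining function is minimal on it at p. *)
Lemma ldf_tangent v : (forall t : R, 1 <= normc (of_real4 (real_p0 + t *: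
  v)).1) ->
  'D_v rho real_p0 = 0.
Proof.
move=> hv; have [d [d0 sm hDd [rho0 _]]] := ldf_nbhd.
apply/eqP; rewrite -normr_le0; apply/ler_addgt0Pr => e e0; rewrite add0r.
have [d1 d10 h] := ldf_step v e0.
have v1 : 0 < 1 + `|v| by rewrite ltr_pwDl.
pose t := Num.min d1 (d / (1 + `|v|)) / 2.
have m0 : 0 < Num.min d1 (d / (1 + `|v|)) by rewrite lt_min d10 divr_gt0.
have t0 : 0 < t by rewrite divr_gt0.
have td1 : t < d1.
  have : Num.min d1 (d / (1 + `|v|)) <= d1 by rewrite ge_min lexx.
  rewrite /t; lra.
have td : t * (1 + `|v|) < d.
  have : Num.min d1 (d / (1 + `|v|)) <= d / (1 + `|v|) by rewrite ge_min lexx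
    orbT.
  by rewrite -ltr_pdivlMr// /t; lra.
have pos (s : R) : `|s| = t -> 0 <= rho (real_p0 + s *: v).
  move=> st; rewrite leNgt; apply/negP.
  have sd : `|real_p0 + s *: v - real_p0| < d.
    by rewrite addrC addKr normrZ st; apply: le_lt_trans td;
      rewrite ler_pM2l//; lra.
  by move=> /(hDd _ sd); case: (of_real4 _) (hv s) => a b /= an /D_z1_lt1; lra.
have h1 := h real_p0 t; have h2 := h real_p0 (- t).
rewrite subrr normr0 d10 gtr0_norm// td1 rho0 in h1.
rewrite subrr normr0 d10 normrN gtr0_norm// td1 rho0 in h2.
have {}h1 := h1 isT isT; have {}h2 := h2 isT isT.
have := pos t (gtr0_norm t0); have := pos (- t);
  rewrite normrN gtr0_norm// => /(_ erefl).
move: h1 h2; rewrite !ler_norml => /andP[h1 h1'] /andP[h2 h2'] p1 p2.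
have : `|t * 'D_v rho real_p0| <= t * e by rewrite ler_norml; lra.
by rewrite normrM (gtr0_norm t0) (ler_pM2l t0) ler_norml.
Qed.

Lemma ldf_normal_ge0 : 0 <= 'D_E1 rho real_p0.
Proof.
have [d [d0 sm hDd [rho0 _]]] := ldf_nbhd.
apply/ler_addgt0Pr => e e0.
have [d1 d10 h] := ldf_step E1 e0.
have [t [t0 td1 td tl]] := exists_lt3 d10 d0 ltr01.
have [t1 t1'] : 1 - t < 1 /\ 0 <= 1 - t by split; lra.
have := h real_p0 (- t); rewrite subrr normr0 d10 normrN gtr0_norm// td1 rho0.
move=> /(_ isT isT).
have : rho (real_p0 + (- t) *: E1) < 0.
  have E : real_p0 + (- t) *: E1 = coords (1 - t)%:C 0.
    by rewrite add_scale4 /coords /= !mulr0 mulr1 !addr0.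
  have nd : `|real_p0 + (- t) *: E1 - real_p0| < d.
    rewrite addrC addKr norm4_lt /= !scaler0 normr0 [_ *: 1]mulr1 normrN
      gtr0_norm//.
    by rewrite td d0.
  apply/(hDd _ nd); rewrite E of_real4_coords; apply: D_axis.
  by rewrite normc_real ger0_norm.
rewrite ler_norml => ? /andP[? ?].
have : t * ('D_E1 rho real_p0 + e) >= 0 by lra.
by rewrite pmulr_rge0.
Qed.

(** Some directional derivative is nonzero, while those along [E2], [E3], [E4] vanish by
    [ldf_tangent]. If the one along [E1] vanished too, all of them would. The additivity in v used
    here comes from the uniform expansions [ldf_step]. *)
Lemma ldf_normal_gt0 : 0 < 'D_E1 rho real_p0.
Proof.
have [d [d0 sm hDd [rho0 [v vn0]]]] := ldf_nbhd.
have D1 := ldf_normal_ge0.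
have D2 : 'D_E2 rho real_p0 = 0.
  apply: ldf_tangent => t; apply: le_trans (normc_Re _).
  by rewrite /= scaler0 addr0 normr1.
have D3 : 'D_E3 rho real_p0 = 0.
  apply: ldf_tangent => t; apply: le_trans (normc_Re _).
  by rewrite /= scaler0 addr0 normr1.
have D4 : 'D_E4 rho real_p0 = 0.
  apply: ldf_tangent => t; apply: le_trans (normc_Re _).
  by rewrite /= scaler0 addr0 normr1.
rewrite lt0r D1 andbT; apply/negP => /eqP D10; case/negP: vn0.
rewrite -normr_le0; apply/ler_addgt0Pr => e e0; rewrite add0r.
pose S := l1norm v; have S0 : 0 < S by exact: l1norm_gt0.
have eS : 0 < e / S by rewrite divr_gt0.
have [d1 d10 h1] := ldf_step E1 eS; have [d2 d20 h2] := ldf_step E2 eS.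
have [d3 d30 h3] := ldf_step E3 eS; have [d4 d40 h4] := ldf_step E4 eS.
have [d5 d50 h5] := ldf_step v eS.
pose m := Num.min d1 (Num.min d2 (Num.min d3 (Num.min d4 d5))).
have m0 : 0 < m by rewrite !lt_min d10 d20 d30 d40.
have [m1 m2 m3 m4 m5] : [/\ m <= d1, m <= d2, m <= d3, m <= d4 & m <= d5].
  by rewrite /m; split; rewrite !ge_min lexx ?orbT.
have [t [t0 tm [b1 b2 b3 b4]]] := exists_small_scaling v m0.
(* A path from p to p + t v along the four coordinate directions. On each leg the increment of rho
   is at most e / S times the length of the leg. *)
pose q1 := real_p0 + (t * v.1.1) *: E1; pose q2 := q1 + (t * v.1.2) *: E2.
pose q3 := q2 + (t * v.2.1) *: E3.
have nt (x : R) : `|t * x| = t * `|x| by rewrite normrM gtr0_norm.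
have qe : q3 + (t * v.2.2) *: E4 = real_p0 + t *: v.
  by rewrite /q3 /q2 /q1 !add_scale4 /= !(mulr0, mulr1, addr0, add0r).
have n0 : `|real_p0 - real_p0| < m by rewrite subrr normr0.
have n1 : `|q1 - real_p0| < m.
  rewrite norm4_lt /q1 !add_scale4 /= !(mulr0, mulr1, addr0, add0r, subr0).
  by rewrite ?[1 + _]addrC ?addrK ?subrr ?normr0 ?nt ?b1 ?b2 ?b3 ?m0.
have n2 : `|q2 - real_p0| < m.
  rewrite norm4_lt /q2 /q1 !add_scale4 /= !(mulr0, mulr1, addr0, add0r, subr0).
  by rewrite ?[1 + _]addrC ?addrK ?subrr ?normr0 ?nt ?b1 ?b2 ?b3 ?m0.
have n3 : `|q3 - real_p0| < m.
  rewrite norm4_lt /q3 /q2 /q1 !add_scale4 /= !(mulr0, mulr1, addr0, add0r,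
    subr0).
  by rewrite ?[1 + _]addrC ?addrK ?subrr ?normr0 ?nt ?b1 ?b2 ?b3 ?m0.
have k1 := h1 real_p0 (t * v.1.1) (lt_le_trans n0 m1).
have k2 := h2 q1 (t * v.1.2) (lt_le_trans n1 m2).
have k3 := h3 q2 (t * v.2.1) (lt_le_trans n2 m3).
have k4 := h4 q3 (t * v.2.2) (lt_le_trans n3 m4).
have k5 := h5 real_p0 t (lt_le_trans n0 m5).
rewrite nt (lt_le_trans b1 m1) D10 mulr0 subr0 -/q1 in k1.
rewrite nt (lt_le_trans b2 m2) D2 mulr0 subr0 -/q2 in k2.
rewrite nt (lt_le_trans b3 m3) D3 mulr0 subr0 -/q3 in k3.
rewrite nt (lt_le_trans b4 m4) D4 mulr0 subr0 qe in k4.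
rewrite (gtr0_norm t0) (lt_le_trans tm m5) in k5.
have {}k1 := k1 isT; have {}k2 := k2 isT; have {}k3 := k3 isT.
have {}k4 := k4 isT; have {}k5 := k5 isT.
have : `|t * 'D_v rho real_p0| <= e / S * (t * S).
  have -> : t * 'D_v rho real_p0 = - (rho (real_p0 + t *: v) - rho real_p0 - t
    * 'D_v rho real_p0) +
    ((rho q1 - rho real_p0) + (rho q2 - rho q1) + (rho q3 - rho q2) + (rho
      (real_p0 + t *: v) - rho q3)) by ring.
  apply: (le_trans (ler_normD _ _)); rewrite normrN.
  have -> : e / S * (t * S) = e / S * t + (e / S * (t * `|v.1.1|) + e / S * (t
    * `|v.1.2|)
    + e / S * (t * `|v.2.1|) + e / S * (t * `|v.2.2|)) by rewrite /S /l1norm;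
        ring.
  rewrite lerD// (le_trans (ler_normD _ _))// lerD// (le_trans (ler_normD _
    _))// lerD//.
  by rewrite (le_trans (ler_normD _ _))// lerD.
rewrite nt; have -> : e / S * (t * S) = t * e by field; rewrite lt0r_neq0.
by rewrite (ler_pM2l t0).
Qed.

End DefiningFunction.
End Domain.
End Reinhardt.

(** * Defining functions compared with the height of the boundary *)

Section DefiningFunction.
Context {R : realType}.
Variables (D : set (Cplx2 R)) (hD : domain D) (hrein : complete_reinhardt D).
Hypothesis hp0 : boundary D (1 : Cplx R, 0 : Cplx R).
Variable (r : Cplx2 R -> R).
Hypothesis hr : local_defining_function D (1 : Cplx R, 0 : Cplx R) r.

Lemma coords_near (z1 z2 : Cplx R) (d : R) : normc (z1 - 1) < d ->
  normc z2 < d ->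
  `|coords z1 z2 - real_p0| < d.
Proof.
move=> h1 h2; rewrite norm4_lt /=; apply/and4P; split.
- by apply: le_lt_trans h1; have := normc_Re (z1 - 1); case: (z1).
- by apply: le_lt_trans h1; have := normc_Im (z1 - 1); case: (z1) => ? ? /=;
    rewrite oppr0.
- by apply: le_lt_trans h2; have := normc_Re z2; rewrite subr0.
- by apply: le_lt_trans h2; have := normc_Im z2; rewrite subr0.
Qed.

(** The uniform expansion in the real direction of z1, with an error of half the normal derivative
    k; hence the constants k / 2 and 3 k / 2. It converts values of r into horizontal distances to
    the boundary and back. *)
Lemma ldf_comparable : exists c1 c2 d : R, [/\ 0 < c1, 0 < c2, 0 < d,
  forall (z1 z2 : Cplx R), normc (z1 - 1) <= d -> normc z2 <= d ->
    (D (z1, z2) <-> r (z1, z2) < 0) &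
  forall (z1 z2 : Cplx R) (x : R), normc (z1 - 1) <= d -> normc z2 <= d ->
    0 <= x <= d ->
    c1 * x <= r (z1, z2) - r (z1 - x%:C, z2) <= c2 * x].
Proof.
have k0 := ldf_normal_gt0 hD hrein hp0 hr.
have [d0 [d00 _ hDd _]] := ldf_nbhd hD hp0 hr.
have k20 := divr_gt0 k0 (ltr0n R 2).
have [d1 d10 hst] := ldf_step hD hp0 hr ((1, 0), (0, 0)) k20.
set k := derive _ _ _ in k0 k20 hst; move: k k0 k20 hst => k k0 k20 hst.
have [d [dp dd0 dd1 _]] := exists_lt3 d00 d10 d10.
exists (k / 2), (k / 2 + k), d; split => //; first lra.
- move=> z1 z2 h1 h2; have := hDd (coords z1 z2).
  rewrite /= of_real4_coords; apply; apply: coords_near; lra.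
- move=> z1 z2 x h1 h2 /andP[x0 xd].
  have cn : `|coords z1 z2 - real_p0| < d1 by apply: coords_near; lra.
  have xn : `|- x| < d1 by rewrite normrN ger0_norm//; lra.
  have := hst (coords z1 z2) (- x) cn xn.
  have -> : coords z1 z2 + (- x) *: ((1, 0), (0, 0)) = coords (z1 - x%:C) z2.
    rewrite add_scale4; case: (z1) (z2) => a b [u v].
    by rewrite /coords /= !mulr0 !addr0 mulr1 oppr0 !addr0.
  rewrite /= !of_real4_coords normrN (ger0_norm x0) ler_norml => /andP[? ?].
  apply/andP; split; lra.
Qed.

(** Points (1, s) lie outside D, so r is nonnegative along this line, and the Taylor dichotomy
    applies to the iterated derivatives in the direction [E3]. Real s suffices because D depends on
    |z2| only. *)
Lemma ldf_dichotomy :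
  (forall k, exists C e : R, 0 < e /\
     forall s : R, 0 <= s <= e -> r (1, s%:C) <= C * s ^+ k) \/
  (exists N : nat, exists c e : R, [/\ 0 < c, 0 < e &
     forall s : R, 0 <= s <= e -> c * s ^+ N <= r (1, s%:C)]).
Proof.
have [d [d0 sm hDd _]] := ldf_nbhd hD hp0 hr.
pose E3 : (R * R) * (R * R) := ((0, 0), (1, 0)).
pose G k (s : R) := iter k (fun g => 'D_E3 g) (r \o of_real4) (real_p0 + s *:
  E3).
have nE (s : R) : `|s| < d -> `|real_p0 + s *: E3 - real_p0| < d.
  by move=> sd; rewrite addrC addKr norm4_lt /= !scaler0 normr0 [_ *: 1]mulr1
    d0 sd.
have qE (s : R) : of_real4 (real_p0 + s *: E3) = (1 : Cplx R, s%:C : Cplx R).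
  by rewrite add_scale4 /of_real4 /= !mulr0 mulr1 !addr0 !add0r.
have dG k (s : R) : `|s| < d -> is_derive s 1 (G k) (G k.+1 s).
  move=> /nE /sm [W Wq sW].
  have sk : smooth_on W (iter k (fun g => 'D_E3 g) (r \o of_real4)).
    by elim: k => [//|k IH]; exact: smooth_D.
  have dk := smooth_derivable (v := E3) sk Wq.
  exact: (is_derive_line dk).
have G0 (s : R) : 0 <= s < d -> 0 <= G 0%N s.
  move=> /andP[s0 sd]; rewrite leNgt; apply/negP.
  have sd' : `|s| < d by rewrite ger0_norm.
  move=> /(hDd _ (nE _ sd')); rewrite qE => /(D_z1_lt1 hD hrein hp0).
  by rewrite normc1 ltxx.
have GE (s : R) : G 0%N s = r (1, s%:C) by rewrite /G /= qE.
have [H|[N [c c0 [e /andP[e0 _] H]]]] := taylor_dichotomy d0 dG G0;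
  [left|right].
- move=> k; have [C [e /andP[e0 _] H1]] := H k; exists C, e; split => // s /H1.
  by rewrite GE.
- by exists N, c, e; split => // s /H; rewrite GE.
Qed.
End DefiningFunction.

(** * Flat boundary: infinite contact and uniqueness *)

Section Vanishing.
Context {R : realType}.

Lemma norm_cplx2 (z : Cplx2 R) : `|z| = (Num.max (normc z.1) (normc z.2))%:C.
Proof.
rewrite prod_normE !normc_norm !maxEle lecR.
by case: ifP.
Qed.

Lemma vanishes_cplxP (g : Cplx R -> Cplx R) m : vanishes_to_order g m <->
  exists M d : R, 0 < d /\ forall z : Cplx R, normc z < d ->
    normc (g z) <= M * normc z ^+ m.
Proof.
split=> [[M /nbhs_cplxP[d d0 hd]]|[M [d [d0 hd]]]].
- exists M, d; split => // z zd.
  have := hd z; rewrite subr0 => /(_ zd).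
  by rewrite !normc_norm -rmorphXn -rmorphM lecR.
- exists M; apply/nbhs_cplxP; exists d => // z; rewrite subr0 => /hd.
  by rewrite !normc_norm -rmorphXn -rmorphM lecR.
Qed.

Lemma vanishes_cplx2P (g : Cplx R -> Cplx2 R) m : vanishes_to_order g m <->
  exists M d : R, 0 < d /\ forall z : Cplx R, normc z < d ->
    normc (g z).1 <= M * normc z ^+ m /\ normc (g z).2 <= M * normc z ^+ m.
Proof.
split=> [[M /nbhs_cplxP[d d0 hd]]|[M [d [d0 hd]]]].
- exists M, d; split => // z zd.
  have := hd z; rewrite subr0 => /(_ zd).
  rewrite norm_cplx2 normc_norm -rmorphXn -rmorphM lecR ge_max.
  by move=> /andP[].
- exists M; apply/nbhs_cplxP; exists d => // z; rewrite subr0 => /hd[h1 h2].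
  by rewrite norm_cplx2 normc_norm -rmorphXn -rmorphM lecR ge_max h1.
Qed.

Lemma differentiable_fst (z : Cplx2 R) :
  differentiable (fst : Cplx2 R -> Cplx R) z.
Proof.
apply: (@linear_differentiable _ _ _ (fst : {linear Cplx2 R -> Cplx R})).
by move=> w; exact: cvg_fst.
Qed.

Lemma differentiable_snd (z : Cplx2 R) :
  differentiable (snd : Cplx2 R -> Cplx R) z.
Proof.
apply: (@linear_differentiable _ _ _ (snd : {linear Cplx2 R -> Cplx R})).
by move=> w; exact: cvg_snd.
Qed.

Lemma differentiable_slice2 (F : Cplx2 R -> Cplx R) (z1 w : Cplx R) :
  differentiable F (z1, w) -> differentiable (fun w : Cplx R => F (z1, w)) w.
Proof.
by move=> h; apply: (@differentiable_comp _ _ _ _ (fun w : Cplx R => (z1,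
  w) : Cplx2 R) F).
Qed.

Lemma differentiable_slice1 (F : Cplx2 R -> Cplx R) (w z2 : Cplx R) :
  differentiable F (w, z2) -> differentiable (fun w : Cplx R => F (w, z2)) w.
Proof.
by move=> h; apply: (@differentiable_comp _ _ _ _ (fun w : Cplx R => (w,
  z2) : Cplx2 R) F).
Qed.

End Vanishing.

Section Flat.
Context {R : realType}.
Variables (D : set (Cplx2 R)) (hD : domain D) (hrein : complete_reinhardt D).
Hypothesis hp0 : boundary D (1 : Cplx R, 0 : Cplx R).
Variable (r : Cplx2 R -> R).
Hypothesis hr : local_defining_function D (1 : Cplx R, 0 : Cplx R) r.
Hypothesis flat : forall k, exists C e : R, 0 < e /\
     forall s : R, 0 <= s <= e -> r (1, s%:C) <= C * s ^+ k.

Lemma fst_left_inverse :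
  holomorphic_left_inverse D (fun l : Cplx R => (l, 0 : Cplx R)) fst.
Proof.
split=> //; first by move=> z _; exact: differentiable_fst.
case=> z1 z2 /(D_z1_lt1 hD hrein hp0).
by rewrite /unit_disc /= normc_norm ltcR.
Qed.

(** Moving left from (1, |z2|) by x lowers r by at least c1 x, which exceeds the flat value of r at
    (1, |z2|). *)
Lemma flat_contains k : exists C d : R, [/\ 0 < C, 0 < d &
  forall z1 z2 : Cplx R, normc z2 <= d -> normc z1 < 1 - C * normc z2 ^+ k.+1 ->
    D (z1, z2)].
Proof.
have [c1 [c2 [d [c10 c20 d0 hDr hcmp]]]] := ldf_comparable hD hrein hp0 hr.
have [C0 [e [e0 hC0]]] := flat k.+1.
pose A := `|C0| + 1; have A0 : 0 < A by rewrite ltr_wpDl.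
have [t [t0 td te tm]] := exists_lt3 d0 e0 (divr_gt0 (mulr_gt0 c10 d0) A0).
have [t' [t'0 t't t'1 _]] := exists_lt3 t0 ltr01 ltr01.
exists (A / c1), t'; split; [by rewrite divr_gt0|by []|].
move=> z1 z2 hz2 hz1; set s := normc z2 in hz2 hz1.
have s0 : 0 <= s by exact: normc_ge0.
(* The comparison is valid only up to distance d, hence the truncation; a smaller |z1| is then
   reached by the Reinhardt property. *)
pose x := 1 - normc z1; pose x' := Num.min x d.
have sk0 : 0 <= s ^+ k.+1 by rewrite exprn_ge0.
have xC : A * s ^+ k.+1 < c1 * x.
  have : A / c1 * s ^+ k.+1 < x by rewrite /x; lra.
  by rewrite mulrAC ltr_pdivrMr// [x * _]mulrC.
have dC : A * s ^+ k.+1 < c1 * d.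
  have : s ^+ k.+1 <= s by apply: le_pow1; rewrite s0; lra.
  move: tm; rewrite ltr_pdivlMr// => tm h.
  have : A * s ^+ k.+1 <= A * t by rewrite ler_pM2l//; lra.
  lra.
have x'C : A * s ^+ k.+1 < c1 * x'.
  by rewrite /x' minEle; case: ifP.
have x'0 : 0 < x'.
  have : 0 <= A * s ^+ k.+1 by rewrite mulr_ge0// ltW.
  by move=> /le_lt_trans/(_ x'C); rewrite pmulr_rgt0.
have x'd : x' <= d by rewrite ge_min lexx orbT.
have x'x : x' <= x by rewrite ge_min lexx.
have n1 : normc (1 - 1 : R[i]) <= d by rewrite subrr normc0 ltW.
have n2 : normc (s%:C) <= d by rewrite normc_real ger0_norm//; lra.
have := @hcmp 1 s%:C x' n1 n2; rewrite (ltW x'0) x'd => /(_ isT) /andP[h1 _].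
have hs : r (1, s%:C) <= A * s ^+ k.+1.
  apply: (le_trans (hC0 s _)); first by rewrite s0; lra.
  by rewrite ler_wpM2r// /A; have := ler_norm C0; lra.
have n3 : normc (1 - x'%:C - 1 : R[i]) <= d.
  by rewrite addrAC subrr add0r normc_opp normc_real gtr0_norm.
have Dx : D (1 - x'%:C, s%:C) by apply/hDr => //; lra.
apply: (reinhardt_sub hrein Dx); last first.
  by rewrite normc_real ger0_norm.
have := normc_subl 1 (x'%:C); rewrite normc1 normc_real gtr0_norm// => h.
by apply: le_trans h; rewrite /x in x'x; lra.
Qed.

(** Flatness is known for real s, and r need not be invariant under rotations. The detour is through
    D: [flat_contains] puts (1 - x, z) in D for some x of order |z|^(k+1), and [ldf_comparable] then
    bounds r (1, z) by c2 x. *)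
Lemma flat_line k : exists C d : R, 0 < d /\
  forall z : Cplx R, normc z < d -> `|r (1, z)| <= C * normc z ^+ k.+1.
Proof.
have [c1 [c2 [d [c10 c20 d0 hDr hcmp]]]] := ldf_comparable hD hrein hp0 hr.
have [C [e [C0 e0 hC]]] := flat_contains k.
have C20 : 0 < 2 * C by rewrite mulr_gt0.
have d10 : 0 < Num.min d 1 by rewrite lt_min d0 ltr01.
have [t [t0 td te tm]] := exists_lt3 d0 e0 (divr_gt0 d10 C20).
have [t' [t'0 t't t'1 _]] := exists_lt3 t0 ltr01 ltr01.
exists (c2 * (2 * C)), t'; split => // z zt.
have s0 : 0 <= normc z by exact: normc_ge0.
have n1 : normc (1 - 1 : R[i]) <= d by rewrite subrr normc0 ltW.
have zd : normc z <= d by lra.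
have rp : 0 <= r (1, z).
  rewrite leNgt; apply/negP => /(hDr _ _ n1 zd)/(D_z1_lt1 hD hrein hp0).
  by rewrite normc1 ltxx.
rewrite ger0_norm//.
have [z0|zn0] := eqVneq z 0.
  have [C0' [e' [e'0 h]]] := flat k.+1; have := h 0;
    rewrite lexx (ltW e'0) => /(_ isT).
  by rewrite z0 normc0 !exprS !mul0r !mulr0.
have zp : 0 < normc z by rewrite normc_gt0.
set s := normc z in s0 zd zp zt *.
have sp : 0 < s ^+ k.+1 by rewrite exprn_gt0.
have ss : s ^+ k.+1 <= s by apply: le_pow1; rewrite s0; lra.
(* The factor 2 gives the strict inequality that [flat_contains] asks for. *)
pose x := 2 * C * s ^+ k.+1.
have x0 : 0 < x by rewrite mulr_gt0.
have /andP[xd x1] : (x <= d) && (x <= 1).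
  rewrite -le_min /x.
  have : 2 * C * s ^+ k.+1 <= 2 * C * t by rewrite ler_pM2l//; lra.
  by move: tm; rewrite ltr_pdivlMr//; move: (Num.min _ _) => m; lra.
have Cx : C * s ^+ k.+1 < x.
  by rewrite /x ltr_pM2r// ltr_pMl// ltr1n.
have Dx : D (1 - x%:C, z).
  apply: hC; first by rewrite -/s; lra.
  by rewrite -/s -(rmorphB _ 1 x) normc_real ger0_norm; lra.
have n3 : normc (1 - x%:C - 1 : R[i]) <= d.
  by rewrite addrAC subrr add0r normc_opp normc_real gtr0_norm.
have /(hDr _ _ n3 zd) rx := Dx.
have := @hcmp 1 z x n1 zd; rewrite (ltW x0) xd => /(_ isT) /andP[_ h2].
by apply: le_trans (_ : c2 * x <= _); [lra|rewrite /x mulrA].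
Qed.

End Flat.

Section Flat.
Context {R : realType}.
Variables (D : set (Cplx2 R)) (hD : domain D) (hrein : complete_reinhardt D).
Hypothesis hp0 : boundary D (1 : Cplx R, 0 : Cplx R).
Variable (r : Cplx2 R -> R).
Hypothesis hr : local_defining_function D (1 : Cplx R, 0 : Cplx R) r.
Hypothesis flat : forall k, exists C e : R, 0 < e /\
     forall s : R, 0 <= s <= e -> r (1, s%:C) <= C * s ^+ k.

Lemma flat_infinite_contact (c : nat) : ~ (forall gamma,
    analytic_curve_at (1 : Cplx R, 0 : Cplx R) gamma ->
    forall nu m : nat,
      vanishing_order (fun z => gamma z - (1 : Cplx R, 0 : Cplx R)) nu ->
      vanishes_to_order (fun z => (r (gamma z))%:C : Cplx R) m ->
      (m <= c * nu)%N).
Proof.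
pose gamma (z : Cplx R) : Cplx2 R := (1, z).
have gE (z : Cplx R) : gamma z - (1 : Cplx R, 0 : Cplx R) = (0, z).
  by rewrite /gamma; congr (_, _); rewrite /= ?subrr ?subr0.
move=> /(_ gamma) H.
suff [h1 h2 h3] : [/\ analytic_curve_at (1 : Cplx R, 0 : Cplx R) gamma,
    vanishing_order (fun z => gamma z - (1 : Cplx R, 0 : Cplx R)) 1 &
    vanishes_to_order (fun z => (r (gamma z))%:C : Cplx R) c.+1].
  by have := H h1 1%N c.+1 h2 h3; rewrite muln1 ltnn.
split.
- split=> //.
    apply: filterE => z; apply: differentiable_pair.
      exact: differentiable_cst.
    exact: ex_diff.
  move=> /nbhs_cplxP[d d0 /(_ (d / 2)%:C)].
  rewrite subr0 normc_real gtr0_norm ?divr_gt0//.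
  have d2 : d / 2 < d by lra.
  move=> /(_ d2) [/eqP]; rewrite mulf_eq0 invr_eq0 (gt_eqF d0) pnatr_eq0.
  by [].
- split.
    apply/vanishes_cplx2P; exists 1, 1; split => // z _;
      rewrite gE /= expr0n /=.
    by rewrite addr0 sqrtr0 expr1 mul1r normc_ge0.
  move=> /vanishes_cplx2P[M [d [d0 hd]]].
  have M1 : 0 < `|M| + 1 by rewrite ltr_wpDl.
  have [t [t0 td tM _]] := exists_lt3 d0 (divr_gt0 ltr01 M1) d0.
  have := hd t%:C; rewrite normc_real gtr0_norm// => /(_ td)[_].
  rewrite gE [(_, _).2]/= normc_real gtr0_norm// expr2.
  move: tM; rewrite ltr_pdivlMr// => tM.
  have : M <= `|M| by exact: ler_norm.
  nra.
- have [C [d [d0 hd]]] := flat_line hD hrein hp0 hr flat c.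
  apply/vanishes_cplxP; exists C, d; split => // z zd.
  by rewrite normc_real; exact: hd.
Qed.

(* Schwarz-Pick in z2 on the circle |z1| = rho, where 1 - rho is of order
   |s|^(k+1), followed by the maximum principle in z1. *)
Lemma flat_slice_bound (G : Cplx2 R -> Cplx R) k (z1 : Cplx R) :
  holomorphic_left_inverse D (fun l : Cplx R => (l, 0 : Cplx R)) G ->
  normc z1 < 1 -> exists C d : R, 0 < d /\
  forall s : Cplx R, normc s < d -> normc (G (z1,
    s) - z1) <= C * normc s ^+ k.+1.
Proof.
move=> [Gd G1 Gl] z11.
have [C [e [C0 e0 hC]]] := flat_contains hD hrein hp0 hr flat k.
have Gl' (l : Cplx R) : normc l < 1 -> G (l, 0) = l.
  by move=> l1; apply: Gl; rewrite /unit_disc /= normc_norm ltcR.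
have G1' z : D z -> normc (G z) < 1.
  by move=> /G1; rewrite /unit_disc /= normc_norm ltcR.
have p0 : 0 < (1 - normc z1) / (4 * C).
  by rewrite divr_gt0 ?subr_gt0// mulr_gt0.
have [t [t0 te tp t1]] := exists_lt3 e0 p0 (ltr01 : 0 < 1 :> R).
exists (4 * C * 2 ^+ k.+1), (t / 2); split; first by rewrite divr_gt0.
move=> s st.
have [->|s0] := eqVneq s 0.
  by rewrite Gl'// subrr normc0 expr0n mulr0.
have sp : 0 < normc s by rewrite normc_gt0.
(* [schwarz_pick] controls only the half disc, so the disc in z2 has twice the radius |s|. *)
pose S := 2 * normc s; have S0 : 0 < S by rewrite mulr_gt0.
have S1 : S < t by rewrite /S; lra.
have Sk0 : 0 < S ^+ k.+1 by rewrite exprn_gt0.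
have SS : S ^+ k.+1 <= S by apply: le_pow1; rewrite ltW//=; lra.
(* Twice the defect allowed by [flat_contains], so that the closed bidisc of radii rho and S lies in
   D. On its edge 1 - rho^2 <= 2 (1 - rho) = 4 C S^(k+1). *)
pose rho := 1 - 2 * C * S ^+ k.+1.
have rz : normc z1 < rho.
  have : 4 * C * S ^+ k.+1 < 1 - normc z1.
    move: tp; rewrite ltr_pdivlMr ?mulr_gt0// => tp.
    have : C * S ^+ k.+1 <= C * t by rewrite ler_pM2l//; lra.
    lra.
  have : 0 < C * S ^+ k.+1 by rewrite mulr_gt0.
  rewrite /rho; lra.
have rho0 : 0 < rho by exact: le_lt_trans (normc_ge0 _) rz.
have rho1 : rho < 1.
  by rewrite /rho ltrBlDr ltrDl !mulr_gt0.
have Dw (z w : Cplx R) : normc z <= rho -> normc w <= S -> D (z, w).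
  move=> zr wS; apply: hC; first by lra.
  have : C * normc w ^+ k.+1 <= C * S ^+ k.+1.
    by rewrite ler_pM2l// lerXn2r ?nnegrE ?normc_ge0// ltW.
  have : 0 < C * S ^+ k.+1 by rewrite mulr_gt0.
  move: zr; rewrite /rho; lra.
have sS : normc s <= S by rewrite /S; lra.
have dG (z : Cplx R) : normc z <= rho ->
    differentiable (fun z : Cplx R => G (z, s) - z) z.
  move=> zr; apply: differentiableB; last exact: ex_diff.
  by apply: differentiable_slice1; apply: Gd; exact: Dw.
have -> : 4 * C * 2 ^+ k.+1 * normc s ^+ k.+1 = 4 * C * S ^+ k.+1.
  by rewrite /S exprMn; ring.
apply: (@max_principle_disc R (fun z => G (z, s) - z) rho _ rho0 _ _ _ z1 (ltW
  rz)).
- by move=> z zr; apply: differentiable_continuous; exact: dG.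
- by move=> z /andP[_ /ltW zr]; exact: dG.
- move=> z zr; have zr' : normc z <= rho by rewrite zr.
  have gd (w : Cplx R) : normc w <= S -> differentiable (fun w : Cplx R =>
    G (z, w)) w.
    by move=> wS; apply: differentiable_slice2; apply: Gd; exact: Dw.
  have g1 (w : Cplx R) : normc w <= S -> normc (G (z, w)) < 1.
    by move=> wS; apply: G1'; exact: Dw.
  have sS2 : normc s <= S / 2 by rewrite /S; lra.
  have := schwarz_pick S0 gd g1 sS2; rewrite Gl'; last by rewrite zr.
  move=> /le_trans; apply; rewrite zr.
  have : 0 <= (1 - rho) ^+ 2 by exact: sqr_ge0.
  have -> : 4 * C * S ^+ k.+1 = 2 * (1 - rho) by rewrite /rho; ring.
  lra.
Qed.

Lemma flat_unique :
  has_unique_left_inverse D (fun l : Cplx R => (l, 0 : Cplx R)).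
Proof.
exists fst; split; first exact: fst_left_inverse.
move=> G hG [z1 z2] Dz /=.
have z11 := D_z1_lt1 hD hrein hp0 Dz.
have [Gd G1 _] := hG; have [oD _ _] := hD.
(* [flat_eq0] concludes only inside the open disc, so a radius slightly larger than |z2| is
   needed. *)
have [t zt Dt] : exists2 t : R, normc z2 < t & D (z1, t%:C).
  have D' : D (z1, (normc z2)%:C).
    apply: (reinhardt_sub hrein Dz) => //.
    by rewrite normc_real ger0_norm ?normc_ge0.
  have /nbhs_cplx2P[d d0 hd] := open_nbhs_nbhs (conj oD D').
  exists (normc z2 + d / 2); first by rewrite ltrDl divr_gt0.
  have h2 : normc ((normc z2 + d / 2)%:C - (normc z2)%:C) < d.
    by rewrite -rmorphB addrAC subrr add0r normc_real gtr0_norm ?divr_gt0//;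
      lra.
  by apply: (hd (z1, (normc z2 + d / 2)%:C : Cplx R) _ h2);
    rewrite subrr normc0.
have t0 : 0 < t by exact: le_lt_trans (normc_ge0 _) zt.
have Dw (w : Cplx R) : normc w <= t -> D (z1, w).
  by move=> wt; apply: (reinhardt_sub hrein Dt);
    rewrite // normc_real gtr0_norm.
apply/eqP; rewrite -subr_eq0; apply/eqP.
apply: (@flat_eq0 R (fun w => G (z1, w) - z1) t 2 t0 _ _ _ z2 zt).
- move=> w wt; apply: differentiableB; last exact: differentiable_cst.
  by apply: differentiable_slice2; apply: Gd; exact: Dw.
- move=> w wt; apply: (le_trans (normcB _ _)).
  have : normc (G (z1, w)) < 1.
    have Dzw : D (z1, w) by apply: Dw; rewrite wt.
    by have := G1 _ Dzw; rewrite /unit_disc /= normc_norm ltcR.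
  lra.
- move=> k; have [C [d [d0 hd]]] := flat_slice_bound k hG z11.
  exists `|C|, (Num.min d 1); first by rewrite lt_min d0 ltr01.
  move=> w; rewrite lt_min => /andP[/hd h w1]; apply: (le_trans h).
  have wk : 0 <= normc w ^+ k.+1 by rewrite exprn_ge0// normc_ge0.
  apply: (@le_trans _ _ (`|C| * normc w ^+ k.+1)).
    by rewrite ler_wpM2r// ler_norm.
  rewrite ler_wpM2l// exprS -[leRHS]mul1r ler_wpM2r ?exprn_ge0 ?normc_ge0//.
  exact: ltW.
Qed.

End Flat.

(** * Non-flat boundary: finite type *)

Section NonFlat.
Context {R : realType}.
Variables (D : set (Cplx2 R)) (hD : domain D) (hrein : complete_reinhardt D).
Hypothesis hp0 : boundary D (1 : Cplx R, 0 : Cplx R).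
Variable (r : Cplx2 R -> R).
Hypothesis hr : local_defining_function D (1 : Cplx R, 0 : Cplx R) r.
Variable N : nat.
Hypothesis nonflat : exists c e : R, [/\ 0 < c, 0 < e &
     forall s : R, 0 <= s <= e -> c * s ^+ N <= r (1, s%:C)].

(** With x = 1 - |z1| <= d, the point (1 - x, |z2|) of D gives 0 > r (1, |z2|) - c2 x, hence c
    |z2|^N < c2 x; for x > d, |z2| is small enough. Replacing N by N + 1 guarantees a positive
    exponent without treating N = 0 apart. *)
Lemma nonflat_bound : exists c d : R, [/\ 0 < c, 0 < d &
  forall z1 z2 : Cplx R, D (z1, z2) -> normc z2 <= d ->
    normc z1 <= 1 - c * normc z2 ^+ N.+1].
Proof.
have [c1 [c2 [d [c10 c20 d0 hDr hcmp]]]] := ldf_comparable hD hrein hp0 hr.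
have [c [e [c0 e0 hc]]] := nonflat.
have cc0 : 0 < c / c2 by rewrite divr_gt0.
have [t [t0 td te tc]] := exists_lt3 d0 e0 (divr_gt0 d0 cc0).
have [t' [t'0 t't t'1 _]] := exists_lt3 t0 ltr01 ltr01.
exists (c / c2), t'; split => // z1 z2 Dz zt.
set s := normc z2 in zt *; have s0 : 0 <= s by exact: normc_ge0.
have z11 := D_z1_lt1 hD hrein hp0 Dz.
have sN : s ^+ N.+1 <= s by apply: le_pow1; rewrite s0; lra.
have sNN : s ^+ N.+1 <= s ^+ N.
  by rewrite exprS -[leRHS]mul1r ler_wpM2r ?exprn_ge0//; lra.
pose x := 1 - normc z1; have x0 : 0 < x by rewrite subr_gt0.
suff : c / c2 * s ^+ N.+1 <= x by rewrite /x; lra.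
have [xd|dx] := leP x d; last first.
  have : c / c2 * s ^+ N.+1 <= c / c2 * t by rewrite ler_pM2l//; lra.
  by move: tc; rewrite ltr_pdivlMr//; lra.
have n1 : normc (1 - 1 : R[i]) <= d by rewrite subrr normc0 ltW.
have n2 : normc (s%:C) <= d by rewrite normc_real ger0_norm//; lra.
have n3 : normc (1 - x%:C - 1 : R[i]) <= d.
  by rewrite addrAC subrr add0r normc_opp normc_real gtr0_norm.
have Dx : D (1 - x%:C, s%:C).
  have e1 : 1 - x%:C = (normc z1)%:C by rewrite /x rmorphB subKr.
  by rewrite e1; exact: (proj1 (D_abs hrein z1 z2) Dz).
have /(hDr _ _ n3 n2) rx := Dx.
have := @hcmp 1 s%:C x n1 n2; rewrite (ltW x0) xd => /(_ isT) /andP[_ h2].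
have hs : c * s ^+ N <= r (1, s%:C) by apply: hc; rewrite s0; lra.
rewrite mulrAC ler_pdivrMr// [x * _]mulrC.
have : c * s ^+ N.+1 <= c * s ^+ N by rewrite ler_pM2l.
lra.
Qed.

(** Moving gamma to the left by x = 2 M |z|^(m+1) / c1 lowers r by at least twice the bound on |r
    (gamma z)|. The shifted point is therefore in D and obeys [nonflat_bound]. *)
Lemma curve_bound : exists c K : R, [/\ 0 < c, 0 < K &
  forall (gamma : Cplx R -> Cplx2 R) m,
    {for (0 : Cplx R), continuous gamma} -> gamma 0 = (1 : Cplx R,
      0 : Cplx R) ->
    forall M d : R, 0 < M -> 0 < d ->
    (forall z : Cplx R, normc z < d -> `|r (gamma z)| <= M * normc z ^+ m.+1) ->
    exists d' : R, 0 < d' <= d /\ forall z : Cplx R, normc z < d' ->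
      normc (gamma z).1 + c * normc (gamma z).2 ^+ N.+1 <= 1 + K * M * normc z
        ^+ m.+1].
Proof.
have [c1 [c2 [d [c10 c20 d0 hDr hcmp]]]] := ldf_comparable hD hrein hp0 hr.
have [c [e [c0 e0 hc]]] := nonflat_bound.
exists c, (2 / c1); split=> //; first by rewrite divr_gt0.
move=> gamma m gc g0 M d1 M0 d10 hM.
have K0 : 0 < 2 / c1 * M by rewrite mulr_gt0// divr_gt0.
pose a := Num.min (d / 2) e; have a0 : 0 < a by rewrite lt_min divr_gt0.
have : nbhs (gamma 0) [set w : Cplx2 R | normc (w.1 - 1) < a /\ normc w.2 < a].
  rewrite g0; apply/nbhs_cplx2P; exists a => // w /=; rewrite subr0; by [].
move=> /gc /nbhs_cplxP[d2 d20 hd2].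
have [t [t0 td1 td2 tK]] := exists_lt3 d10 d20 (divr_gt0 (divr_gt0 d0 (ltr0n R
  2)) K0).
have [t' [t'0 t't t'1 _]] := exists_lt3 t0 ltr01 ltr01.
exists t'; split; first by rewrite t'0; lra.
move=> z zt.
have [->|z0] := eqVneq z 0.
  by rewrite g0 [(_, _).1]/= [(_, _).2]/= normc1 normc0 !expr0n !mulr0.
have zp : 0 < normc z by rewrite normc_gt0.
have [g1 g2] : normc ((gamma z).1 - 1) < a /\ normc (gamma z).2 < a.
  by apply: hd2; rewrite subr0; lra.
have hMz := hM z (_ : normc z < d1).
have {}hMz : `|r (gamma z)| <= M * normc z ^+ m.+1 by apply: hMz; lra.
set s := normc z ^+ m.+1 in hMz *.
have s0 : 0 < s by rewrite exprn_gt0.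
have st : s <= t by have : s <= normc z; [apply: le_pow1; rewrite ltW//=;
  lra|lra].
pose x := 2 / c1 * M * s; have x0 : 0 < x by rewrite mulr_gt0.
have ad : a <= d / 2 by rewrite ge_min lexx.
have ae : a <= e by rewrite ge_min lexx orbT.
have xd : x <= d / 2.
  have : x <= 2 / c1 * M * t by rewrite ler_pM2l.
  by move: tK; rewrite ltr_pdivlMr//; lra.
have n1 : normc ((gamma z).1 - 1) <= d by lra.
have n2 : normc (gamma z).2 <= d by lra.
have gE : ((gamma z).1, (gamma z).2) = gamma z by case: (gamma z).
have xd' : 0 <= x <= d by rewrite ltW//=; lra.
have := hcmp _ _ _ n1 n2 xd'; rewrite gE => /andP[h1 _].
have c1x : c1 * x = 2 * (M * s) by rewrite /x; field; rewrite lt0r_neq0.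
have Ms : 0 < M * s by rewrite mulr_gt0.
have n3 : normc ((gamma z).1 - x%:C - 1) <= d.
  rewrite addrAC; apply: (le_trans (normcB _ _)).
  rewrite normc_real gtr0_norm//; lra.
have Dg : D ((gamma z).1 - x%:C, (gamma z).2).
  apply/(hDr _ _ n3 n2).
  have := ler_norm (r (gamma z)); lra.
have g2e : normc (gamma z).2 <= e by lra.
have := hc _ _ Dg g2e.
have := normc_subl (gamma z).1 x%:C; rewrite normc_real gtr0_norm//.
rewrite /x; lra.
Qed.

(* If r o gamma = O(|z|^m), then Re (gamma_1 - 1) <= O(|z|^m), so that
   Borel-Caratheodory gives gamma_1 - 1 = O(|z|^m), whence
   gamma_2^(N+1) = O(|z|^m). *)
Lemma nonflat_finite_type : finite_type D (1 : Cplx R, 0 : Cplx R).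
Proof.
(* For nu >= 1, m > 2 (N + 1) nu implies m >= (N + 1) (nu + 1). Taking an (N + 1)-th root of
   O(|z|^m) then gives order nu + 1 for the second component, contradicting the choice of nu. *)
exists r; split => //; exists (2 * N.+1)%N.
move=> gamma [gd g0 _] nu m [_ nv] /vanishes_cplxP[M [d [d0 hM]]].
rewrite leqNgt; apply/negP => mN.
have /nbhs_cplxP[e e0 he] := gd.
have gd0 : differentiable gamma 0 by apply: he; rewrite subrr normc0.
have d1 (z : Cplx R) : normc z < e -> differentiable (fun w => (gamma w).1) z.
  move=> ze; apply: (@differentiable_comp _ _ _ _ gamma fst);
    last exact: differentiable_fst.
  by apply: he; rewrite subr0.
have d2 (z : Cplx R) : normc z < e -> differentiable (fun w => (gamma w).2) z.
  move=> ze; apply: (@differentiable_comp _ _ _ _ gamma snd);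
    last exact: differentiable_snd.
  by apply: he; rewrite subr0.
apply: nv; apply/vanishes_cplx2P.
have gE1 (z : Cplx R) : (gamma z - (1 : Cplx R,
  0 : Cplx R)).1 = (gamma z).1 - 1 by [].
have gE2 (z : Cplx R) : (gamma z - (1 : Cplx R, 0 : Cplx R)).2 = (gamma z).2.
  by rewrite -[RHS]subr0.
(* Order 0 is impossible: gamma is differentiable with value p at 0, so gamma - p = O(|z|). *)
have [nu0|nu0] := posnP nu.
  have lip (f : Cplx R -> Cplx R) : differentiable f 0 -> exists M d : R,
    0 < d /\
      forall z : Cplx R, normc z < d -> normc (f z - f 0) <= M * normc z.
    move=> /differentiable_cplxP[b hb]; have [k k0 hk] := hb 1 ltr01.
    exists (1 + normc b), k; split => // z zk.
    have := hk z; rewrite !subr0 => /(_ zk) h.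
    have := normcD (f z - f 0 - b * z) (b * z); rewrite subrK normcM; lra.
  have [|M1 [k1 [k10 h1]]] := lip (fun w => (gamma w).1) _; first by apply: d1;
    rewrite normc0.
  have [|M2 [k2 [k20 h2]]] := lip (fun w => (gamma w).2) _; first by apply: d2;
    rewrite normc0.
  exists (`|M1| + `|M2|), (Num.min k1 k2); split; first by rewrite lt_min k10.
  move=> z; rewrite lt_min => /andP[/h1 {}h1 /h2 {}h2].
  rewrite gE1 gE2 nu0 expr1; rewrite g0 /= in h1 h2; rewrite subr0 in h2.
  have z0 := normc_ge0 z.
  have m1 : M1 * normc z <= `|M1| * normc z by rewrite ler_wpM2r// ler_norm.
  have m2 : M2 * normc z <= `|M2| * normc z by rewrite ler_wpM2r// ler_norm.
  have p1 : 0 <= `|M1| * normc z by rewrite mulr_ge0.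
  have p2 : 0 <= `|M2| * normc z by rewrite mulr_ge0.
  rewrite mulrDl; split; lra.
have mE : m = (m.-1).+1 by rewrite (ltn_predK mN).
have mge : (N.+1 * nu.+1 <= m)%N.
  apply: leq_trans (ltnW mN); rewrite mulnAC mulnC leq_mul2r/= mul2n -addnn.
  by rewrite -addn1 leq_add2l.
have [c [K [c0 K0 hcK]]] := curve_bound.
pose M1 := `|M| + 1; have M10 : 0 < M1 by rewrite ltr_wpDl.
have hM1 (z : Cplx R) : normc z < d -> `|r (gamma z)| <= M1 * normc z ^+
  (m.-1).+1.
  rewrite -mE => /hM; rewrite normc_real => h; apply: (le_trans h).
  rewrite ler_wpM2r ?exprn_ge0 ?normc_ge0// /M1.
  by have := ler_norm M; lra.
have [d' [/andP[d'0 _] hd']] := hcK gamma m.-1 (differentiable_continuous gd0)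
  g0 M1 d M10 d0 hM1.
pose L := K * M1; have L0 : 0 < L by rewrite mulr_gt0.
rewrite -/L -mE in hd'.
have [t [t0 te td' t1]] := exists_lt3 e0 d'0 (ltr01 : 0 < 1 :> R).
(* Borel-Caratheodory is used on the disc of radius 2 |z|, whence 2^m, and contributes the other
   factor 2. *)
pose A := 2 * (L * 2 ^+ m); have A0 : 0 < A by rewrite !mulr_gt0// exprn_gt0.
have al (z : Cplx R) : normc z < t / 2 -> normc ((gamma z).1 - 1) <= A * normc
  z ^+ m.
  move=> zt; have [->|z0] := eqVneq z 0.
    by rewrite g0 subrr normc0 mulr_ge0 ?(ltW A0)// exprn_ge0.
  have zp : 0 < normc z by rewrite normc_gt0.
  have t20 : 0 < 2 * normc z by rewrite mulr_gt0.
  have AA0 : 0 < L * (2 * normc z) ^+ m by rewrite mulr_gt0// exprn_gt0.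
  have -> : A * normc z ^+ m = 2 * (L * (2 * normc z) ^+ m).
    by rewrite /A exprMn; ring.
  apply: (@borel_caratheodory R (fun w => (gamma w).1 - 1) _ _ t20 AA0).
  - move=> w wz; apply: differentiableB; last exact: differentiable_cst.
    by apply: d1; lra.
  - by rewrite g0 subrr.
  - move=> w wz.
    have h1 : Re ((gamma w).1 - 1) <= normc (gamma w).1 - 1.
      by have := Re_le_normc (gamma w).1; case: ((gamma w).1) => u v /=; lra.
    apply: (le_trans h1).
    have wd : normc w < d' by lra.
    have := hd' w wd.
    have : 0 <= c * normc (gamma w).2 ^+ N.+1.
      by rewrite mulr_ge0 ?(ltW c0)// exprn_ge0// normc_ge0.
    have : L * normc w ^+ m <= L * (2 * normc z) ^+ m.
      by rewrite ler_pM2l// lerXn2r ?nnegrE ?normc_ge0// ltW.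
    lra.
  - lra.
(* At least 1, so that B <= B^(N+1) when the (N + 1)-th powers are compared. *)
pose B := Num.max ((A + L) / c) 1.
have B1 : 1 <= B by rewrite le_max lexx orbT.
exists (A + B), (t / 2); split; first by rewrite divr_gt0.
move=> z zt; rewrite gE1 gE2.
have z0 := normc_ge0 z.
have z1 : normc z <= 1 by lra.
have pw k l : (k <= l)%N -> normc z ^+ l <= normc z ^+ k.
  by move=> kl; rewrite ler_wiXn2l.
have a1 := al z zt.
have nuk0 : 0 <= normc z ^+ nu.+1 by rewrite exprn_ge0.
have bn : normc (gamma z).2 <= B * normc z ^+ nu.+1.
  rewrite -(ler_pXn2r (n := N.+1))// ?nnegrE ?normc_ge0 ?mulr_ge0//;
    last by lra.
  rewrite exprMn -exprM.
  have h2 : c * normc (gamma z).2 ^+ N.+1 <= (A + L) * normc z ^+ m.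
    have zd' : normc z < d' by lra.
    have := hd' z zd'.
    have := normc_subl 1 (1 - (gamma z).1); rewrite subKr normc1 normc_distC.
    lra.
  have h3 : normc (gamma z).2 ^+ N.+1 <= (A + L) / c * normc z ^+ m.
    by rewrite mulrAC ler_pdivlMr// mulrC.
  apply: (le_trans h3).
  apply: (@le_trans _ _ (B * normc z ^+ m)).
    by rewrite ler_wpM2r ?exprn_ge0// le_max lexx.
  rewrite ler_pM ?exprn_ge0//; first lra.
    by rewrite ler_eXnr.
  by apply: pw; rewrite mulnC.
split; last first.
  by apply: (le_trans bn); rewrite ler_wpM2r// lerDr ltW.
apply: (le_trans a1); apply: (@le_trans _ _ (A * normc z ^+ nu.+1)).
  rewrite ler_pM2l//; apply: pw; apply: leq_trans mge.
  by rewrite mulSn leq_addr.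
by rewrite ler_wpM2r// lerDl; lra.
Qed.

End NonFlat.

(** * Plurisubharmonic functions on discs tangent to z2 z1^M = const *)

Section Psh.
Context {R : realType}.
Notation mu := (@lebesgue_measure R).

(** The real part of (p + iq) u + (p' + iq') u^2 at u = exp(it), a harmonic polynomial that vanishes
    at 0 and so has mean 0. *)
Definition trig2 (p q p' q' : R) (t : R) : R :=
  p * cos t - q * sin t + p' * (cos t ^+ 2 - sin t ^+ 2) - q' * (2 * cos t *
    sin t).

Lemma cont_trig2 p q p' q' (t : R) : {for t, continuous (trig2 p q p' q')}.
Proof.
have cc : {for t, continuous (@cos R)} by exact: continuous_cos.
have cs : {for t, continuous (@sin R)} by exact: continuous_sin.
have k (a : R) : {for t, continuous (fun _ : R => a)} by exact: cst_continuous.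
have cN (f : R -> R) : {for t, continuous f} -> {for t,
  continuous (fun y => - f y)}.
  exact: continuousN.
have c1 := continuous_mul_fun (k p) cc; have c2 :=
  cN _ (continuous_mul_fun (k q) cs).
have c3 := continuous_mul_fun (k p') (continuous_add_fun (continuous_exp_fun (n
  := 2) cc) (cN _ (continuous_exp_fun (n := 2) cs))).
have c4 := cN _ (continuous_mul_fun (k q') (continuous_mul_fun
  (continuous_mul_fun (k 2) cc) cs)).
exact: continuous_add_fun (continuous_add_fun (continuous_add_fun c1 c2) c3) c4.
Qed.

Lemma Rint_trig2 p q p' q' : \int[mu]_(t in `[0, 2 * pi]) trig2 p q p' q' t = 0.
Proof.
pose F (t : R) := p * sin t + q * cos t + p' * (sin t * cos t) + q' * (cos t *
  cos t).
have dF (t : R) : is_derive t 1 F (trig2 p q p' q' t).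
  have ds := @is_derive_sin R t; have dc := @is_derive_cos R t.
  have -> : F = p \*: (@sin R) + q \*: (@cos R) + p' \*: (@sin R * @cos R)
     + q' \*: (@cos R * @cos R).
    by apply/funext => x.
  apply: is_derive_eq; rewrite /trig2 -?[_ *: _]/(_ * _); ring.
rewrite /Rintegral (@continuous_FTC2 R (trig2 p q p' q') F).
- by rewrite -EFinB /= /F mulr_natl cos2pi sin2pi cos0 sin0 subrr.
- by rewrite mulr_gt0// pi_gt0.
- by apply: continuous_in_subspaceT => t _; exact: cont_trig2.
- split.
  + by move=> t _; exact: (@ex_derive _ _ _ _ _ _ _ (dF t)).
  + apply: cvg_at_right_filter; apply: differentiable_continuous.
    by apply/derivable1_diffP; exact: (@ex_derive _ _ _ _ _ _ _ (dF 0)).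
  + apply: cvg_at_left_filter; apply: differentiable_continuous.
    by apply/derivable1_diffP; exact: (@ex_derive _ _ _ _ _ _ _ (dF (2 * pi))).
- by move=> t _; rewrite derive1E; exact: derive_val.
Qed.

(** Terms harmonic in the disc variable may be dropped from an upper bound before taking means. *)
Lemma mean_le (h : R -> R) A p q p' q' :
  (forall t, {for t, continuous h}) ->
  (forall t, h t <= A + trig2 p q p' q' t) ->
  (2 * pi)^-1 * \int[mu]_(t in `[0, 2 * pi]) h t <= A.
Proof.
move=> hc hle.
have pi0 : 0 < 2 * pi :> R by rewrite mulr_gt0// pi_gt0.
rewrite ler_pdivrMl//.
have ic (g : R -> R) : (forall t, {for t, continuous g}) -> mu.-integrable `[0,
  2 * pi] (EFin \o g).
  by move=> gc; apply: integrable_cont => x _.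
have cA : forall t : R, {for t, continuous (fun=> A)} by move=> t;
  exact: cst_continuous.
have iT := ic _ (@cont_trig2 p q p' q').
apply: (@le_trans _ _ (\int[mu]_(t in `[0, 2 * pi]) (A + trig2 p q p' q' t))).
  apply: le_Rintegral => //; first exact: ic.
  by apply: ic => t; exact: continuous_add_fun (cA t) (@cont_trig2 p q p' q' t).
rewrite RintegralD//; last exact: (ic _ cA).
by rewrite Rint_trig2 addr0 Rint_cst ?(ltW pi0)// subr0 mulrC.
Qed.

(** The factor 1 - M eta is chosen to cancel the linear term of (1 + eta)^M. The expansion of the
    power alone is proved first, by induction on M. *)
Lemma pow_expand (M : nat) : exists (k : R[i]) (B : R), 0 <= B /\
  forall eta : R[i], normc eta <= 1 -> exists2 e : R[i], normc e <= B &
    (1 - M%:R * eta) * (1 + eta) ^+ M = 1 + k * eta ^+ 2 + e * eta ^+ 3.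
Proof.
have [k [B [B0 h]]] : exists (k : R[i]) (B : R), 0 <= B /\
  forall eta : R[i], normc eta <= 1 -> exists2 e : R[i], normc e <= B &
    (1 + eta) ^+ M = 1 + M%:R * eta + k * eta ^+ 2 + e * eta ^+ 3.
  elim: M => [|M [k [B [B0 IH]]]].
    exists 0, 0; split => // eta _; exists 0; first by rewrite normc0.
    by rewrite expr0; ring.
  exists (k + M%:R), (normc k + 2 * B); split.
    by rewrite addr_ge0 ?normc_ge0// mulr_ge0.
  move=> eta eta1; have [e eB E] := IH _ eta1.
  exists (k + e * (1 + eta)).
    apply: (le_trans (normcD _ _)); rewrite lerD2l normcM.
    have : normc (1 + eta) <= 2.
      by apply: (le_trans (normcD _ _)); rewrite normc1; lra.
    move=> h2; rewrite mulrC ler_pM ?normc_ge0//.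
  by rewrite exprSr E -natr1; ring.
exists (k - M%:R * M%:R), (B + normc (M%:R * k) + normc (M%:R : R[i]) * B).
split.
  by rewrite !addr_ge0 ?normc_ge0// mulr_ge0 ?normc_ge0.
move=> eta eta1; have [e eB E] := h _ eta1.
exists (e - M%:R * k - M%:R * (e * eta)); last by rewrite E; ring.
apply: (le_trans (normcB _ _)); apply: lerD.
  by apply: (le_trans (normcB _ _)); rewrite lerD2r.
rewrite !normcM ler_wpM2l ?normc_ge0//.
by rewrite -[leRHS]mulr1 ler_pM ?normc_ge0.
Qed.

Lemma unit_circle_normc (t : R) : normc (unit_circle t) = 1.
Proof. by rewrite /= cos2Dsin2 sqrtr1. Qed.

Lemma normc_sqr_circle (d : R) (t : R) :
  normc (1 + d%:C * unit_circle t) ^+ 2 = 1 + 2 * d * cos t + d ^+ 2.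
Proof.
rewrite normc_sqr /=.
transitivity (1 + 2 * d * cos t + d ^+ 2 * (cos t ^+ 2 + sin t ^+ 2));
  first by ring.
by rewrite cos2Dsin2 mulr1.
Qed.

Lemma normcD_sqr (x y : R[i]) : normc (x + y) ^+ 2 =
  normc x ^+ 2 + 2 * Re (conjc x * y) + normc y ^+ 2.
Proof. by rewrite !normc_sqr; case: x y => a b [c d] /=; ring. Qed.

Lemma Re_circle2 (g : R[i]) (t : R) : Re (g * unit_circle t ^+ 2) =
  Re g * (cos t ^+ 2 - sin t ^+ 2) - Im g * (2 * cos t * sin t).
Proof. by case: g => a b; rewrite expr2 /=; ring. Qed.

(** The only contribution of order d^2 is the real part of a multiple of u^2, which has mean 0. The
    cross term with e is of order d^3, and the square of the correction of order d^4, at most d^3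
    times a constant as d <= 1. *)
Lemma normc_perturb (a h k e : R[i]) (d B : R) (t : R) : 0 <= d <= 1 ->
  normc e <= B ->
  normc (a + h * (k * (d%:C * unit_circle t) ^+ 2 + e * (d%:C * unit_circle t)
    ^+ 3)) ^+ 2 <=
  normc a ^+ 2 + trig2 0 0 (2 * d ^+ 2 * Re (conjc a * h * k))
    (2 * d ^+ 2 * Im (conjc a * h * k)) t +
    d ^+ 3 * (2 * normc a * normc h * B + (normc h * (normc k + B)) ^+ 2).
Proof.
move=> /andP[d0 d1] eB; set u := unit_circle t.
have u1 : normc u = 1 by exact: unit_circle_normc.
have B0 : 0 <= B by exact: le_trans (normc_ge0 _) eB.
have dn : normc (d%:C * u) = d by rewrite normcM u1 mulr1 normc_real ger0_norm.
rewrite normcD_sqr.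
have -> : Re (conjc a * (h * (k * (d%:C * u) ^+ 2 + e * (d%:C * u) ^+ 3))) =
   d ^+ 2 * Re (conjc a * h * k * u ^+ 2) + Re (conjc a * h * e * (d%:C * u) ^+
     3).
  have aux (x h' k' e' y v : R[i]) (r : R) : Re (x * (h' * (k' * (r%:C * y) +
    e' * v)))
      = r * Re (x * h' * k' * y) + Re (x * h' * e' * v).
    by case: x h' k' e' y v => ? ? [? ?] [? ?] [? ?] [? ?] [? ?] /=; ring.
  by rewrite exprMn -rmorphXn aux.
rewrite Re_circle2.
have h1 : Re (conjc a * h * e * (d%:C * u) ^+ 3) <= d ^+ 3 * (normc a * normc h
  * B).
  apply: (le_trans (Re_le_normc _)); rewrite normcM normcX dn !normcM
    normc_conj mulrC.
  by rewrite ler_wpM2l ?exprn_ge0// ler_wpM2l// mulr_ge0 ?normc_ge0.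
have h2 : normc (h * (k * (d%:C * u) ^+ 2 + e * (d%:C * u) ^+ 3)) ^+ 2 <=
    d ^+ 3 * (normc h * (normc k + B)) ^+ 2.
  have : normc (h * (k * (d%:C * u) ^+ 2 + e * (d%:C * u) ^+ 3)) <=
     d ^+ 2 * (normc h * (normc k + B)).
    rewrite normcM [leRHS]mulrCA ler_wpM2l ?normc_ge0//.
    apply: (le_trans (normcD _ _)).
    rewrite (normcM k) (normcM e) !normcX dn mulrDr.
    rewrite lerD// [leRHS]mulrC; first by rewrite mulrC.
    rewrite ler_pM ?normc_ge0 ?exprn_ge0//.
    by rewrite ler_wiXn2l.
  move=> hle; apply: (@le_trans _ _ ((d ^+ 2 * (normc h * (normc k + B))) ^+
    2)).
    by rewrite lerXn2r ?nnegrE ?normc_ge0 ?mulr_ge0 ?exprn_ge0 ?addr_ge0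
      ?normc_ge0.
  rewrite exprMn ler_wpM2r ?sqr_ge0// -exprM.
  by rewrite ler_wiXn2l.
rewrite /trig2; lra.
Qed.

Variables (D : set (Cplx2 R)) (u : Cplx2 R -> R).
Hypothesis hu : continuous_plurisubharmonic D u.

(* The disc is tangent to the level set of z2 z1^M through (a1, a2): along it
   z2 z1^M varies by k eta^2 + O(eta^3), so that the penalty term changes the
   mean of w by O(|eta|^3) only, against a gain of order |eta|^2 from
   e |z1|^2. *)
Lemma no_interior_max (a1 a2 H0 : Cplx R) (M : nat) (e K d0 : R) :
  a1 != 0 -> 0 < e -> 0 <= K -> 0 < d0 ->
  let w (z : Cplx2 R) := u z + e * normc z.1 ^+ 2 - K * normc (z.2 * z.1 ^+ M -
    H0) ^+ 2 in
  (forall eta : Cplx R, normc eta <= d0 ->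
    D (a1 * (1 + eta), a2 * (1 - M%:R * eta)) /\
    w (a1 * (1 + eta), a2 * (1 - M%:R * eta)) <= w (a1, a2)) -> False.
Proof.
move=> a10 e0 K0 d00 w hw.
have [k [B [B0 hexp]]] := pow_expand M.
pose h := a2 * a1 ^+ M; pose A := h - H0.
pose C := 2 * normc A * normc h * B + (normc h * (normc k + B)) ^+ 2.
have C0 : 0 <= C.
  by rewrite addr_ge0 ?sqr_ge0// !mulr_ge0 ?normc_ge0.
have ea0 : 0 < e * normc a1 ^+ 2 by rewrite mulr_gt0// exprn_gt0// normc_gt0.
have KC1 : 0 < K * C + 1 by rewrite ltr_wpDl// mulr_ge0.
(* The last condition makes the gain e |a1|^2 d^2 larger than the loss K C d^3. *)
have [d [dp dd0 d1 dC]] : exists d, [/\ 0 < d, d < d0,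
  d < 1 & d < e * normc a1 ^+ 2 / (K * C + 1)].
  have ec0 := divr_gt0 ea0 KC1.
  pose m := Num.min (Num.min d0 1) (e * normc a1 ^+ 2 / (K * C + 1)).
  have m0 : 0 < m by rewrite !lt_min d00 ltr01 ec0.
  have [m1 m2 m3] : [/\ m <= d0, m <= 1 & m <= e * normc a1 ^+ 2 / (K * C + 1)].
    by rewrite /m; split; rewrite !ge_min lexx ?orbT.
  by exists (m / 2); split; move: m m0 m1 m2 m3 => m *; lra.
pose b : Cplx2 R := (d%:C * a1, - (M%:R * d%:C * a2)).
have bE (zeta : Cplx R) : (a1, a2) + zeta *: b =
    (a1 * (1 + d%:C * zeta), a2 * (1 - M%:R * (d%:C * zeta))) :> Cplx2 R.
  congr (_, _) => /=; rewrite -[_ *: _]/(_ * _); ring.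
have nd (zeta : Cplx R) : normc zeta <= 1 -> normc (d%:C * zeta) <= d.
  by move=> z1; rewrite normcM normc_real (gtr0_norm dp) ler_piMr// ltW.
have disc (zeta : Cplx R) : normc zeta <= 1 -> D ((a1, a2) + zeta *: b).
  move=> z1; rewrite bE; have [] := hw (d%:C * zeta) => //.
  by apply: le_trans (nd _ z1) _; exact: ltW.
have [uc usub] := hu.
have /usub : forall zeta : Cplx R, `|zeta| <= 1 -> D ((a1, a2) + zeta *: b).
  by move=> zeta; rewrite normc_norm lecR; exact: disc.
apply/negP; rewrite -ltNge.
(* The inequality w <= w (a1, a2) is solved for u on the circle. The mean of |1 + d u|^2 is 1 + d^2,
   which produces the negative term; the cosine and the second order part of the penalty go into
   [trig2]. *)
apply: (@le_lt_trans _ _ (u (a1, a2) - e * normc a1 ^+ 2 * d ^+ 2 + K * (d ^+ 3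
  * C))); last first.
  have h3 : d * (K * C + 1) < e * normc a1 ^+ 2 by rewrite -ltr_pdivlMr.
  have d20 : 0 < d ^+ 2 by rewrite exprn_gt0.
  have : d ^+ 2 * (d * (K * C + 1)) < d ^+ 2 * (e * normc a1 ^+ 2) by rewrite
    ltr_pM2l.
  have : 0 < d ^+ 2 * d by rewrite mulr_gt0.
  have -> : d ^+ 3 = d ^+ 2 * d by rewrite exprSr.
  move: (d ^+ 2) => x; lra.
pose g := conjc A * h * k.
apply: (@mean_le _ _ (- (2 * d * e * normc a1 ^+ 2)) 0
   (K * (2 * d ^+ 2 * Re g)) (K * (2 * d ^+ 2 * Im g))).
  move=> t.
  have ct : {for t, continuous (fun t : R => (a1,
    a2) + unit_circle t *: b : Cplx2 R)}.
    have cu : {for t, continuous (fun t : R => unit_circle t : Cplx R)}.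
      apply: (@continuous_comp _ _ _ (fun t : R => (cos t,
        sin t)) (fun x : R * R => x.1 +i* x.2 : Cplx R)).
        exact: (cvg_pair (@continuous_cos R t) (@continuous_sin R t)).
      exact: continuous_of_real2.
    have cz : {for t, continuous (fun t : R => unit_circle t *: b : Cplx2 R)}.
      apply: (@continuous_comp _ _ _ (fun t : R =>
        unit_circle t : Cplx R) (fun z : Cplx R => z *: b)) => //.
      exact: scalel_continuous.
    exact: (continuousD (@cst_continuous _ _ (a1, a2) t) cz).
  apply: (@continuous_comp _ _ _ (fun t : R => (a1,
    a2) + unit_circle t *: b : Cplx2 R) u) => //.
  by apply: uc; apply: disc; rewrite unit_circle_normc.
move=> t; set z := unit_circle t.
have z1 : normc z = 1 by exact: unit_circle_normc.
have ndz : normc (d%:C * z) <= d0.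
  by apply: le_trans (nd _ _) (ltW dd0); rewrite z1.
have [_ wle] := hw _ ndz; rewrite -bE in wle.
have n1 : normc ((a1, a2) + z *: b).1 ^+ 2 = normc a1 ^+ 2 * (1 + 2 * d * cos t
  + d ^+ 2).
  by rewrite bE [(_, _).1]/= normcM exprMn normc_sqr_circle.
have dz1 : normc (d%:C * z) <= 1.
  by apply: le_trans (nd _ _) (ltW d1); rewrite z1.
have [er erB E] := hexp _ dz1.
have HE : ((a1, a2) + z *: b).2 * ((a1, a2) + z *: b).1 ^+ M - H0 =
   A + h * (k * (d%:C * z) ^+ 2 + er * (d%:C * z) ^+ 3).
  rewrite bE [(_, _).1]/= [(_, _).2]/= exprMn.
  have -> : a2 * (1 - M%:R * (d%:C * z)) * (a1 ^+ M * (1 + d%:C * z) ^+ M) - H0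
    =
    h * ((1 - M%:R * (d%:C * z)) * (1 + d%:C * z) ^+ M) - H0 by rewrite /h;
      ring.
  by rewrite E /A; ring.
have := @normc_perturb A h k er d B t _ erB.
rewrite (ltW dp) (ltW d1) -/z -HE -/g => /(_ isT) np.
move: wle; rewrite /w n1 [(_, _).1]/= [(_, _).2]/= -/h -/A.
have := ler_wpM2l K0 np; rewrite -/C /trig2.
move: (normc _ ^+ 2) => N2.
lra.
Qed.

End Psh.

(** * A continuity principle and a second left inverse *)

Section Kontinuitaetssatz.
Context {R : realType}.

(** In logarithmic coordinates, the part of a vertical strip below a line of slope -M. *)
Definition hartogs_region (r0 r1 : R) (M : nat) (c : R) : set (Cplx2 R) :=
  [set z | r0 <= normc z.1 <= r1 /\ normc z.2 * normc z.1 ^+ M <= c].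

Lemma cont_normc_fst (z : Cplx2 R) :
  {for z, continuous (fun z : Cplx2 R => normc z.1 : R)}.
Proof.
apply: (@continuous_comp _ _ _ (fst : Cplx2 R ->
  Cplx R) (fun w : Cplx R => normc w : R)).
  exact: cvg_fst.
exact: continuous_normc.
Qed.

Lemma cont_normc_snd (z : Cplx2 R) :
  {for z, continuous (fun z : Cplx2 R => normc z.2 : R)}.
Proof.
apply: (@continuous_comp _ _ _ (snd : Cplx2 R ->
  Cplx R) (fun w : Cplx R => normc w : R)).
  exact: cvg_snd.
exact: continuous_normc.
Qed.

Lemma closed_sublevel (f : Cplx2 R -> R) (c : R) :
  (forall z, {for z, continuous f}) -> closed [set z | f z <= c].
Proof.
move=> fc; rewrite (_ : [set _ | _] = f @^-1` [set x | x <= c])//.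
by apply: preimage_closed; [move=> z _; exact: fc|exact: closed_le].
Qed.

Lemma closed_superlevel (f : Cplx2 R -> R) (c : R) :
  (forall z, {for z, continuous f}) -> closed [set z | c <= f z].
Proof.
move=> fc; rewrite (_ : [set _ | _] = f @^-1` [set x | c <= x])//.
by apply: preimage_closed; [move=> z _; exact: fc|exact: closed_ge].
Qed.

Lemma compact_hartogs_region (r0 r1 : R) (M : nat) (c : R) : 0 < r0 ->
  compact (hartogs_region r0 r1 M c).
Proof.
move=> r00.
have cK : compact ([set z : Cplx R | normc z <= r1] `*`
    [set z : Cplx R | normc z <= c / r0 ^+ M]).
  by apply: compact_setX; exact: compact_disc.
apply: subclosed_compact cK _.
  rewrite (_ : hartogs_region r0 r1 M c =
    [set z : Cplx2 R | r0 <= normc z.1] `&` [set z : Cplx2 R | normc z.1 <= r1]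
      `&`
    [set z : Cplx2 R | normc z.2 * normc z.1 ^+ M <= c]); last first.
    by apply/seteqP; split => [z [/andP[? ?] ?]|z [[? ?] ?]]; split => //;
      apply/andP.
  apply: closedI; first apply: closedI.
  - by apply: closed_superlevel; exact: cont_normc_fst.
  - by apply: closed_sublevel; exact: cont_normc_fst.
  - apply: closed_sublevel => z; apply: continuous_mul_fun;
      first exact: cont_normc_snd.
    by apply: continuous_exp_fun; exact: cont_normc_fst.
move=> z [/andP[z0 z1] zc]; split => //=.
rewrite ler_pdivlMr ?exprn_gt0//; apply: le_trans zc.
by rewrite ler_wpM2l ?normc_ge0// lerXn2r ?nnegrE ?normc_ge0// ltW.
Qed.

Variables (D : set (Cplx2 R)) (u : Cplx2 R -> R).
Hypothesis hu : continuous_plurisubharmonic D u.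

Lemma psh_bounded (r0 r1 : R) (M : nat) (c : R) : 0 < r0 -> r0 <= r1 ->
  0 <= c ->
  hartogs_region r0 r1 M c `<=` D ->
  exists m, forall z, hartogs_region r0 r1 M c z -> u z <= m.
Proof.
move=> r00 r01 c0 ED.
have [||z0 _ hz0] := @compact_EVT_max _ _ u _ _ (@compact_hartogs_region r0 r1
  M c r00).
- exists (r0%:C, 0); split; first by rewrite normc_real gtr0_norm// lexx.
  by rewrite /= expr0n /= addr0 sqrtr0 mul0r.
- apply: continuous_in_subspaceT => z; rewrite inE => /ED Dz.
  by have [uc _] := hu; exact: uc.
by exists (u z0) => z Ez; apply: hz0; rewrite inE.
Qed.

(* The penalty K |z2 z1^M - H(zs)|^2 keeps the maximum of w away from the
   Levi-flat part |z2 z1^M| = c of the boundary. *)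
Lemma region_max (r0 r1 : R) (M : nat) (c m : R) : 0 < r0 -> r0 <= r1 ->
  0 <= c ->
  hartogs_region r0 r1 M c `<=` D ->
  (forall z, hartogs_region r0 r1 M c z -> normc z.1 = r0 \/ normc z.1 = r1 ->
    u z <= m) ->
  forall z, hartogs_region r0 r1 M c z -> normc z.2 * normc z.1 ^+ M < c ->
    u z <= m.
Proof.
move=> r00 r01 c0 ED bd zs Ezs Hzs; rewrite leNgt; apply/negP => uzs.
have r10 : 0 < r1 by exact: lt_le_trans r01.
have [Mx hMx] := psh_bounded r00 r01 c0 ED.
pose H (z : Cplx2 R) : Cplx R := z.2 * z.1 ^+ M.
have nH z : normc (H z) = normc z.2 * normc z.1 ^+ M by rewrite normcM normcX.
(* Then e r1^2 is half of the excess u zs - m, so adding e |z1|^2 leaves w below u zs on the two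
   edges. *)
pose e := (u zs - m) / (2 * r1 ^+ 2).
have r12 : 0 < r1 ^+ 2 by rewrite exprn_gt0.
have e0 : 0 < e by rewrite divr_gt0 ?subr_gt0// mulr_gt0.
have er : e * r1 ^+ 2 = (u zs - m) / 2.
  by rewrite /e; field; rewrite lt0r_neq0.
pose g := c - normc (H zs).
have g0 : 0 < g by rewrite subr_gt0 nH.
have g20 : 0 < g ^+ 2 by rewrite exprn_gt0.
(* Where |H| = c, H is at distance at least g from H zs, so the penalty is at least K g^2. This K
   makes w smaller than u zs there, even if u reaches its maximum Mx. *)
pose K := (Mx + e * r1 ^+ 2 - u zs + 1) / g ^+ 2.
have Mxu : u zs <= Mx by exact: hMx.
have K0 : 0 <= K.
  by apply: divr_ge0; [have := mulr_gt0 e0 r12; lra|exact: ltW].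
pose w (z : Cplx2 R) := u z + e * normc z.1 ^+ 2 - K * normc (H z - H zs) ^+ 2.
have wzs : u zs <= w zs.
  rewrite /w subrr normc0 expr0n /= mulr0 subr0 lerDl mulr_ge0 ?sqr_ge0//.
  exact: ltW.
have Hc (z : Cplx2 R) : differentiable H z.
  apply: differentiableM; first exact: differentiable_snd.
  by apply: differentiable_pow; exact: differentiable_fst.
have [||a aE wmax] := @compact_EVT_max _ _ w _ _ (@compact_hartogs_region r0 r1
  M c r00).
- by exists zs.
- apply: continuous_in_subspaceT => z; rewrite inE => /ED Dz.
  have cu : {for z, continuous u} by have [uc _] := hu; exact: uc.
  have c1 : {for z, continuous (fun z : Cplx2 R => e * normc z.1 ^+ 2)}.
    apply: (continuous_mul_fun (f := fun=> e)); first exact: cst_continuous.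
    by apply: continuous_exp_fun; exact: cont_normc_fst.
  have c2 : {for z, continuous (fun z : Cplx2 R =>
    - (K * normc (H z - H zs) ^+ 2))}.
    apply: continuousN; apply: (continuous_mul_fun (f := fun=> K));
      first exact: cst_continuous.
    apply: continuous_exp_fun; apply: (@continuous_comp _ _ _ (fun z : Cplx2 R
      => H z - H zs)
      (fun w : Cplx R => normc w : R)); last exact: continuous_normc.
    apply: differentiable_continuous; apply: differentiableB => //.
  exact: continuous_add_fun (continuous_add_fun cu c1) c2.
have {}wmax z : hartogs_region r0 r1 M c z -> w z <= w a.
  by move=> Ez; apply: wmax; rewrite inE.
move: aE; rewrite inE => aE.
have wa : u zs <= w a by apply: (le_trans wzs); exact: wmax.
have Kn (z : Cplx2 R) : 0 <= K * normc (H z - H zs) ^+ 2.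
  by rewrite mulr_ge0// sqr_ge0.
have [/andP[ar0 ar1] aH] := aE.
have ae : e * normc a.1 ^+ 2 <= e * r1 ^+ 2.
  by rewrite ler_pM2l// lerXn2r ?nnegrE ?normc_ge0// ltW.
have nbd : ~ (normc a.1 = r0 \/ normc a.1 = r1).
  move=> /(bd _ aE); have := Kn a; rewrite /w in wa; lra.
have {}ar0 : r0 < normc a.1.
  by rewrite lt_neqAle ar0 andbT; apply/eqP => h; apply: nbd; left.
have {}ar1 : normc a.1 < r1.
  by rewrite lt_neqAle ar1 andbT; apply/eqP => h; apply: nbd; right.
have {}aH : normc (H a) < c.
  rewrite lt_neqAle nH aH andbT; apply/eqP => h.
  have gH : g <= normc (H a - H zs).
    by apply: le_trans (normc_subl _ _); rewrite /g -h -nH lexx.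
  have : K * g ^+ 2 <= K * normc (H a - H zs) ^+ 2.
    by rewrite ler_wpM2l// lerXn2r ?nnegrE ?normc_ge0// ltW.
  have -> : K * g ^+ 2 = Mx + e * r1 ^+ 2 - u zs + 1.
    by rewrite /K divfK// lt0r_neq0.
  have := hMx _ aE; rewrite /w in wa; lra.
have a10 : a.1 != 0 by rewrite -normc_gt0 (lt_trans r00).
have a1p : 0 < normc a.1 by rewrite normc_gt0.
have [k [B [B0 hexp]]] := @pow_expand R M.
(* Along the disc |H| grows by at most d |H a| (|k| + B), so d q <= c - |H a| keeps it under the
   level c. The added 1 makes q positive. *)
pose q := normc (H a) * (normc k + B) + 1.
have q0 : 0 < q.
  by rewrite ltr_wpDl// mulr_ge0 ?normc_ge0// addr_ge0 ?normc_ge0.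
have [d [d0 h1 h2 h3]] : exists d, [/\ 0 < d, d * normc a.1 <= normc a.1 - r0,
   d * normc a.1 <= r1 - normc a.1 & d <= 1 /\ d * q <= c - normc (H a)].
  have p1 : 0 < (normc a.1 - r0) / normc a.1 by rewrite divr_gt0// subr_gt0.
  have p2 : 0 < (r1 - normc a.1) / normc a.1 by rewrite divr_gt0// subr_gt0.
  have p3 : 0 < (c - normc (H a)) / q by rewrite divr_gt0// subr_gt0.
  have [d2 [d20 i1 i2 i3]] := exists_lt3 p1 p2 p3.
  have [d [d0 i4 i5 _]] := exists_lt3 d20 ltr01 ltr01.
  move: i1 i2 i3; rewrite !ltr_pdivlMr// => i1 i2 i3.
  have m1 : d * normc a.1 <= d2 * normc a.1 by rewrite ler_pM2r// ltW.
  have m2 : d * q <= d2 * q by rewrite ler_pM2r// ltW.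
  by exists d; split; [|lra|lra|split; lra].
have aE2 : (a.1, a.2) = a by case: (a).
apply: (@no_interior_max R D u hu a.1 a.2 (H zs) M e K d a10 e0 K0 d0).
rewrite aE2 => eta etad.
have eta1 : normc eta <= 1 by lra.
have Ez : hartogs_region r0 r1 M c (a.1 * (1 + eta), a.2 * (1 - M%:R * eta)).
  split.
    rewrite [(_, _).1]/= normcM.
    have u1 : normc (1 + eta) <= 1 + d.
      by apply: (le_trans (normcD _ _)); rewrite normc1 lerD2l.
    have u2 : 1 - d <= normc (1 + eta).
      have := normc_subl 1 (- eta); rewrite opprK normc1 normc_opp; lra.
    have v1 : normc a.1 * normc (1 + eta) <= normc a.1 * (1 + d) by rewrite
      ler_pM2l.
    have v2 : normc a.1 * (1 - d) <= normc a.1 * normc (1 + eta) by rewrite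
      ler_pM2l.
    by apply/andP; split; lra.
  rewrite -nH /H [(_, _).1]/= [(_, _).2]/=.
  have -> : a.2 * (1 - M%:R * eta) * (a.1 * (1 + eta)) ^+ M =
     H a * ((1 - M%:R * eta) * (1 + eta) ^+ M) by rewrite exprMn /H; ring.
  have [er' erB ->] := hexp _ eta1.
  rewrite normcM.
  have nn : normc (1 + k * eta ^+ 2 + er' * eta ^+ 3) <= 1 + d * (normc k + B).
    have eta2 : normc eta ^+ 2 <= d.
      by apply: le_trans etad; apply: le_pow1; rewrite normc_ge0.
    have eta3 : normc eta ^+ 3 <= d.
      by apply: le_trans etad; apply: le_pow1; rewrite normc_ge0.
    apply: (le_trans (normcD _ _)); rewrite mulrDr addrA; apply: lerD.
      apply: (le_trans (normcD _ _)); rewrite normc1 lerD2l (normcM k) normcX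
        mulrC.
      by rewrite ler_wpM2r ?normc_ge0.
    by rewrite (normcM er') normcX mulrC ler_pM ?exprn_ge0 ?normc_ge0.
  have := ler_wpM2l (normc_ge0 (H a)) nn; rewrite /q in h3; case: h3 => _ h3.
  have := normc_ge0 (H a); lra.
by split; [exact: ED|exact: wmax].
Qed.

End Kontinuitaetssatz.

Section Kontinuitaetssatz.
Context {R : realType}.
Variables (D : set (Cplx2 R)).
Hypothesis hD : domain D.
Hypothesis hrein : complete_reinhardt D.

(** Openness gives a factor near each point and compactness of K makes it uniform. Only z2 is
    dilated, since the regions grow in z2 over a fixed annulus. *)
Lemma compact_dilation (K : set (Cplx2 R)) : compact K -> K `<=` D ->
  exists2 eta : R, 0 < eta & forall z, K z -> D (z.1, (1 + eta)%:C * z.2).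
Proof.
move=> cK KD; have [oD _ _] := hD.
have near_D : \forall t \near (0 : R), K `<=` (fun z : Cplx2 R => D (z.1,
  (1 + t)%:C * z.2)).
  apply: ((proj1 (compact_near_coveringP K)) cK R (nbhs (0 : R))
     (fun t (z : Cplx2 R) => D (z.1, (1 + t)%:C * z.2))).
  move=> z Kz.
  have /nbhs_cplx2P[d d0 hd] := open_nbhs_nbhs (conj oD (KD _ Kz)).
  have n2 : 0 < normc z.2 + 1 by rewrite ltr_wpDl// normc_ge0.
  have [s [s0 sd sz s1]] := exists_lt3 d0 (divr_gt0 d0 n2) (ltr01 : 0 < 1 :> R).
  have s40 : 0 < s / 4 by rewrite divr_gt0.
  exists ([set z' : Cplx2 R | normc (z'.1 - z.1) < s / 4 /\ normc (z'.2 - z.2)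
    < s / 4],
          [set t : R | `|t| < s / 4]) => /=.
    split; first by apply/nbhs_cplx2P; exists (s / 4).
    apply/nbhs_ballP; exists (s / 4) => //= t.
    by rewrite /ball/= sub0r normrN.
  move=> [z' t] [/= [h1 h2] ht].
  apply: (hd (z'.1, (1 + t)%:C * z'.2)) => /=; first lra.
  have -> : (1 + t)%:C * z'.2 - z.2 = (z'.2 - z.2) + t%:C * (z'.2 - z.2) + t%:C
    * z.2.
    by rewrite rmorphD; ring.
  have tz : normc (t%:C * z.2) <= s / 4 * normc z.2.
    by rewrite normcM normc_real ler_wpM2r ?normc_ge0// ltW.
  have tz' : normc (t%:C * (z'.2 - z.2)) <= s / 4 * 1.
    by rewrite normcM normc_real ler_pM ?normc_ge0 ?(ltW ht)//; lra.
  have := normcD (z'.2 - z.2 + t%:C * (z'.2 - z.2)) (t%:C * z.2).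
  have := normcD (z'.2 - z.2) (t%:C * (z'.2 - z.2)).
  move: sz; rewrite ltr_pdivlMr// => sz; have := normc_ge0 z.2.
  have : 0 <= s * normc z.2 by rewrite mulr_ge0 ?normc_ge0// ltW.
  lra.
have /nbhs_ballP[e /= e0 he] := near_D.
exists (e / 2); first by rewrite divr_gt0.
move=> z Kz; apply: (he (e / 2)) => //.
by rewrite /ball/= sub0r normrN gtr0_norm ?divr_gt0//; lra.
Qed.

Hypothesis hpsc : pseudoconvex D.

(* Below the level c, the bound of u on the two edges propagates inside, so
   that each region extends by a fixed factor given by [compact_dilation]. *)
Lemma kontinuitaetssatz (r0 r1 : R) (M : nat) (c : R) : 0 < r0 -> r0 <= r1 ->
  0 < c ->
  D (r0%:C, (c / r0 ^+ M)%:C) -> D (r1%:C, (c / r1 ^+ M)%:C) ->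
  hartogs_region r0 r1 M c `<=` D.
Proof.
move=> r00 r01 c0 D0 D1; have [u [hu hcomp]] := hpsc.
have r10 : 0 < r1 by exact: lt_le_trans r01.
have edge (r : R) : 0 < r -> D (r%:C, (c / r ^+ M)%:C) ->
  hartogs_region r r M c `<=` D.
  move=> rp Dr [z1 z2] [/= zr zc].
  have zr' : normc z1 = r by apply/eqP; rewrite eq_le andbC.
  apply: (reinhardt_sub hrein Dr); rewrite normc_real gtr0_norm ?divr_gt0
    ?exprn_gt0//.
    by rewrite zr'.
  by rewrite ler_pdivlMr ?exprn_gt0// -zr'.
have [m0 hm0] := psh_bounded hu r00 (lexx r0) (ltW c0) (edge _ r00 D0).
have [m1 hm1] := psh_bounded hu r10 (lexx r1) (ltW c0) (edge _ r10 D1).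
pose m := Num.max m0 m1.
have [eta eta0 heta] := compact_dilation (hcomp m) (fun z => @proj1 _ _).
have bd c' : c' <= c -> forall z, hartogs_region r0 r1 M c' z ->
    normc z.1 = r0 \/ normc z.1 = r1 -> u z <= m.
  move=> cc z [_ zc] [zr|zr]; rewrite /m le_max; apply/orP; [left;
    apply: hm0|right; apply: hm1];
    by split; [rewrite zr lexx|exact: le_trans cc].
(* Half of eta is given up so that the contracted point lies strictly below the level c', as
   [region_max] requires. *)
have step c' : 0 < c' -> c' <= c -> hartogs_region r0 r1 M c' `<=` D ->
    hartogs_region r0 r1 M ((1 + eta / 2) * c') `<=` D.
  move=> c'0 cc ED z [zr zc].
  have e1 : 0 < 1 + eta by lra.
  pose z' : Cplx2 R := (z.1, (1 + eta)^-1%:C * z.2).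
  have Hz' : normc z'.2 * normc z'.1 ^+ M < c'.
    rewrite [z'.1]/= [z'.2]/= normcM normc_real gtr0_norm ?invr_gt0//.
    rewrite -mulrA mulrC ltr_pdivrMr//; apply: (le_lt_trans zc).
    by rewrite mulrC ltr_pM2l//; lra.
  have Ez' : hartogs_region r0 r1 M c' z' by split => //; exact: ltW.
  have uz' := region_max hu r00 r01 (ltW c'0) ED (bd _ cc) Ez' Hz'.
  have := heta z' (conj (ED _ Ez') uz').
  rewrite [z'.1]/= [z'.2]/= mulrA -rmorphM divff ?lt0r_neq0// mul1r.
  by case: (z).
(* At this starting level |z1| >= r0 implies |z2| <= c / r1^M, so the region lies in the bidisc
   spanned by the given point over r1. *)
pose c0' := c / r1 ^+ M * r0 ^+ M.
have c0'0 : 0 < c0' by rewrite mulr_gt0 ?divr_gt0 ?exprn_gt0.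
have E0 : hartogs_region r0 r1 M c0' `<=` D.
  move=> [z1 z2] [/= /andP[zr0 zr1] zc].
  apply: (reinhardt_sub hrein D1); rewrite normc_real gtr0_norm ?divr_gt0
    ?exprn_gt0//.
  rewrite -(ler_pM2r (exprn_gt0 M r00)); apply: le_trans zc.
  by rewrite ler_wpM2l ?normc_ge0// lerXn2r ?nnegrE ?normc_ge0// ltW.
have sub c' c'' : c' <= c'' -> hartogs_region r0 r1 M c'' `<=` D ->
    hartogs_region r0 r1 M c' `<=` D.
  by move=> cc ED z [zr zc]; apply: ED; split => //; exact: le_trans cc.
have iter n : hartogs_region r0 r1 M (Num.min c ((1 + eta / 2) ^+ n * c0'))
  `<=` D.
  elim: n => [|n IH].
    by rewrite expr0 mul1r; apply: sub E0; rewrite ge_min lexx orbT.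
  have e1 : 0 < 1 + eta / 2 by lra.
  have p0 : 0 < Num.min c ((1 + eta / 2) ^+ n * c0').
    by rewrite lt_min c0 mulr_gt0// exprn_gt0.
  have pc : Num.min c ((1 + eta / 2) ^+ n * c0') <= c by rewrite ge_min lexx.
  apply: sub (step _ p0 pc IH).
  rewrite minr_pMr ?(ltW e1)// (mulrA (1 + eta / 2)) -exprS le_min !ge_min lexx
    orbT andbT.
  by rewrite ler_peMl ?(ltW c0)//; lra.
have q1 : 0 <= (1 + eta / 2)^-1 < 1.
  by rewrite invr_ge0 invf_lt1; lra.
have [n hn] := exists_small_pow c q1 c0'0.
have := iter n; rewrite (_ : Num.min _ _ = c)//.
apply/min_idPl; move: hn; rewrite exprVn ltr_pdivrMr ?exprn_gt0//; last by lra.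
by move=> /ltW; rewrite mulrC.
Qed.

(** * Monomial bound and the second left inverse *)

Hypothesis hp0 : boundary D (1 : Cplx R, 0 : Cplx R).
Variables (N : nat) (c d : R).
Hypothesis c0 : 0 < c.
Hypothesis d0 : 0 < d.
Hypothesis bound : forall z1 z2 : Cplx R, D (z1, z2) -> normc z2 <= d ->
  normc z1 <= 1 - c * normc z2 ^+ N.+1.

(* [mid] and [r1] are such that the point (mid, d) lies outside D but below the
   curve |z2| |z1|^M = C through a point of D over r1: were this curve to meet D
   also over some |z1| <= mid, [kontinuitaetssatz] would put (mid, d) in D. *)
Lemma monomial_bounded : exists (M : nat) (C : R),
  forall z1 z2 : Cplx R, D (z1, z2) -> normc z2 * normc z1 ^+ M <= C.
Proof.
have p0 : 0 < c * d ^+ N.+1 by rewrite mulr_gt0// exprn_gt0.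
(* With t < c d^(N+1), the modulus 1 - t is too large for [bound] at height d. *)
have [t [t0 t1 t2 _]] := exists_lt3 p0 (ltr01 : 0 < 1 :> R) ltr01.
pose mid := 1 - t; have mid0 : 0 < mid by rewrite /mid; lra.
have nmid : ~ D (mid%:C, d%:C).
  move=> /bound; rewrite !normc_real !gtr0_norm// lexx => /(_ isT).
  rewrite /mid; lra.
pose r1 := 1 - t / 2; have r10 : 0 < r1 by rewrite /r1; lra.
have midr1 : mid < r1 by rewrite /mid /r1; lra.
have [eta eta0 Deta] : exists2 eta : R, 0 < eta & D (r1%:C, eta%:C).
  have Dr1 : D (r1%:C, 0).
    by apply: (D_axis hrein hp0); rewrite normc_real gtr0_norm// /r1; lra.
  have [oD _ _] := hD.
  have /nbhs_cplx2P[e e0 he] := open_nbhs_nbhs (conj oD Dr1).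
  exists (e / 2); first by rewrite divr_gt0.
  apply: (he (r1%:C, (e / 2)%:C)); first by rewrite subrr normc0.
  by rewrite subr0 normc_real gtr0_norm ?divr_gt0//; lra.
have q1 : 0 <= mid / r1 < 1.
  by rewrite divr_ge0 ?(ltW mid0) ?(ltW r10)//= ltr_pdivrMr// mul1r.
(* A steep enough slope: as mid < r1, for some M the point (mid, d) falls below the curve through
   (r1, eta), however small eta is. *)
have [M hM] := exists_small_pow d q1 eta0.
pose C := eta * r1 ^+ M.
have C0 : 0 < C by rewrite mulr_gt0// exprn_gt0.
have hM' : d * mid ^+ M < C.
  by move: hM; rewrite expr_div_n mulrA ltr_pdivrMr// exprn_gt0.
exists M, (Num.max C d) => z1 z2 Dz; rewrite le_max; apply/orP.
(* If |z1| > mid then |z2| <= d, for otherwise the Reinhardt property would put (mid, d) in D. *)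
have [zm|zm] := ltP mid (normc z1).
  right.
  have z11 := D_z1_lt1 hD hrein hp0 Dz.
  have zd : normc z2 <= d.
    rewrite leNgt; apply/negP => dz; apply: nmid;
      apply: (reinhardt_sub hrein Dz);
      by rewrite normc_real gtr0_norm// ltW.
  apply: le_trans zd; rewrite ler_piMr ?normc_ge0// exprn_ile1 ?normc_ge0//.
  exact: ltW.
left; rewrite leNgt; apply/negP => Cz.
(* For M > 0 the assumption [Cz] excludes z1 = 0, so |z1| can serve as inner radius. For M = 0 it
   does not, but then d < eta and (mid, d) lies in the bidisc of (r1, eta). *)
have [M0|M0] := posnP M.
  apply: nmid; move: hM' Cz; rewrite /C M0 !expr0 !mulr1 => dC Cz.
  by apply: (reinhardt_sub hrein Deta);
    rewrite !normc_real !gtr0_norm// ltW.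
have z1p : 0 < normc z1.
  rewrite lt0r normc_ge0 andbT; apply/eqP => z10; move: Cz.
  by rewrite z10 expr0n (gtn_eqF M0) mulr0 ltNge (ltW C0).
have Dr0 : D ((normc z1)%:C, (C / normc z1 ^+ M)%:C).
  apply: (reinhardt_sub hrein Dz); first by rewrite normc_real gtr0_norm.
  rewrite normc_real gtr0_norm ?divr_gt0 ?exprn_gt0//.
  by rewrite ler_pdivrMr ?exprn_gt0// ltW.
have Dr1 : D (r1%:C, (C / r1 ^+ M)%:C).
  by rewrite /C mulfK// lt0r_neq0// exprn_gt0.
apply: nmid; apply: (kontinuitaetssatz z1p _ C0 Dr0 Dr1).
  by rewrite (le_trans zm)// ltW.
split; rewrite [(_, _).1]/= ?[(_, _).2]/= !normc_real !gtr0_norm//;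
  last exact: ltW.
by rewrite zm ltW.
Qed.

Lemma not_unique_left_inverse :
  ~ has_unique_left_inverse D (fun l : Cplx R => (l, 0 : Cplx R)).
Proof.
move=> [F [_ uF]].
have [M [C hC]] := monomial_bounded.
pose C' := `|C| + 1; have C'0 : 0 < C' by rewrite ltr_wpDl.
have CN0 : 0 < C' ^+ N.+1 by rewrite exprn_gt0.
have p0 : 0 < c * d ^+ N.+1 by rewrite mulr_gt0// exprn_gt0.
(* The condition e < c serves |z2| <= d, where |z2 z1^M| <= |z2|; the condition e C'^(N+1) < c
   d^(N+1) serves |z2| > d. *)
have [e [e0 ec ed _]] := exists_lt3 c0 (divr_gt0 p0 CN0) c0.
pose G (z : Cplx2 R) : Cplx R := z.1 + e%:C * (z.2 * z.1 ^+ M) ^+ N.+1.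
have hG : holomorphic_left_inverse D (fun l : Cplx R => (l, 0 : Cplx R)) G.
  split.
  - move=> z _; apply: differentiableD; first exact: differentiable_fst.
    apply: (@differentiableM _ _ (fun=> e%:C : Cplx R));
      first exact: differentiable_cst.
    apply: differentiable_pow; apply: differentiableM;
      first exact: differentiable_snd.
    by apply: differentiable_pow; exact: differentiable_fst.
  - move=> [z1 z2] Dz; rewrite /unit_disc /= normc_norm ltcR.
    have z11 := D_z1_lt1 hD hrein hp0 Dz.
    apply: (le_lt_trans (normcD _ _)).
    rewrite [(_, _).1]/= [(_, _).2]/= normcM normc_real (gtr0_norm e0) normcX
      normcM normcX.
    have [zd|zd] := leP (normc z2) d.
      have h1 := bound Dz zd.
      have [->|z20] := eqVneq z2 0.
        by rewrite normc0 mul0r expr0n mulr0 addr0.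
      have z2p : 0 < normc z2 ^+ N.+1 by rewrite exprn_gt0// normc_gt0.
      have h2 : (normc z2 * normc z1 ^+ M) ^+ N.+1 <= normc z2 ^+ N.+1.
        rewrite lerXn2r ?nnegrE ?mulr_ge0 ?exprn_ge0 ?normc_ge0//.
        by rewrite ler_piMr ?normc_ge0// exprn_ile1 ?normc_ge0// ltW.
      have h3 : e * (normc z2 * normc z1 ^+ M) ^+ N.+1 <= e * normc z2 ^+ N.+1.
        by rewrite ler_pM2l.
      have h4 : e * normc z2 ^+ N.+1 < c * normc z2 ^+ N.+1 by rewrite ltr_pM2r.
      lra.
    (* For |z2| > d the bound does not apply directly, but lowering z2 to d keeps the same z1 and
       gives |z1| <= 1 - c d^(N+1). *)
    have Dd : D (z1, d%:C).
      by apply: (reinhardt_sub hrein Dz); rewrite // normc_real gtr0_norm// ltW.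
    have h1 : normc z1 <= 1 - c * d ^+ N.+1.
      by have := bound Dd; rewrite normc_real gtr0_norm// lexx => /(_ isT).
    have h2 : (normc z2 * normc z1 ^+ M) ^+ N.+1 <= C' ^+ N.+1.
      rewrite lerXn2r ?nnegrE ?mulr_ge0 ?exprn_ge0 ?normc_ge0 ?(ltW C'0)//.
      by apply: (le_trans (hC _ _ Dz)); rewrite /C'; have := ler_norm C; lra.
    have h3 : e * (normc z2 * normc z1 ^+ M) ^+ N.+1 <= e * C' ^+ N.+1.
      by rewrite ler_pM2l.
    have h4 : e * C' ^+ N.+1 < c * d ^+ N.+1 by rewrite -ltr_pdivlMr.
    lra.
  - by move=> l _; rewrite /G /= mul0r expr0n mulr0 addr0.
have hF1 := fst_left_inverse hD hrein hp0.
have D12 : D ((1 / 2)%:C, 0).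
  by apply: (D_axis hrein hp0); rewrite normc_real gtr0_norm; lra.
have [oD _ _] := hD.
have /nbhs_cplx2P[k k0 hk] := open_nbhs_nbhs (conj oD D12).
have Dk : D ((1 / 2)%:C, (k / 2)%:C).
  apply: (hk ((1 / 2)%:C, (k / 2)%:C)); first by rewrite subrr normc0.
  by rewrite subr0 normc_real gtr0_norm ?divr_gt0//; lra.
have := uF _ hG _ Dk; rewrite -(uF _ hF1 _ Dk) /G [(_, _).1]/= [(_, _).2]/=.
move=> /eqP; rewrite -subr_eq0 addrC addKr -normc_eq0 normcM normcX normcM
  normcX.
rewrite !normc_real !gtr0_norm ?divr_gt0//.
by rewrite gt_eqF// mulr_gt0// exprn_gt0// mulr_gt0 ?exprn_gt0 ?divr_gt0.
Qed.

End Kontinuitaetssatz.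

Theorem proposition4p4 (R : realType) (D : set (Cplx2 R))
    (hD : domain D) (hpsc : pseudoconvex D) (hrein : complete_reinhardt D)
    (hp0 : boundary D (1 : Cplx R, 0 : Cplx R))
    (hsmooth : smooth_boundary_near D (1 : Cplx R, 0 : Cplx R)) :
  has_unique_left_inverse D (fun l : Cplx R => (l, 0 : Cplx R)) <->
  infinite_type D (1 : Cplx R, 0 : Cplx R).
Proof.
(* Infinite type is a negation, so this direction assumes finite type and receives a defining
   function r with its constant n. The flat case for this r contradicts n, the other case
   contradicts uniqueness. *)
split=> [uniq [r [hr [n hn]]]|inf].
- have [flat|[N nonflat]] := ldf_dichotomy hD hrein hp0 hr.
    exact: (flat_infinite_contact hD hrein hp0 hr flat hn).
  have [c [d [c0 d0 hb]]] := nonflat_bound hD hrein hp0 hr nonflat.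
  exact: (not_unique_left_inverse hD hrein hpsc hp0 c0 d0 hb uniq).
- have [r hr] := hsmooth.
  have [flat|[N nonflat]] := ldf_dichotomy hD hrein hp0 hr.
    exact: (flat_unique hD hrein hp0 hr flat).
  by case: inf; exact: (nonflat_finite_type hD hrein hp0 hr nonflat).
Qed.
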